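(* Let $K$ be a number field and let $f: \mathbb A^2_K \to \mathbb A^2_K$ be a dominant morphism over $K$ with first dynamical degree $\delta_f>1$. Assume that at least one of the following holds: (a) $f^m$ is algebraically stable for some integer $m>0$; (b) $f$ is a quadratic map. Then there is a finite extension field $L \supset K$ such that $(\mathbb A^2_K,f)$ has densely many $L$-rational points with maximal arithmetic degree.
   Context: $\overline K$ is a fixed algebraic closure of $K$; finite extensions of $K$ are taken inside $\overline K$. A dominant morphism $f:\mathbb A^N_K\to\mathbb A^N_K$ is given by $N$ polynomials; its degree $\deg f$ is the maximum of their degrees, and $f$ is quadratic if $\deg f=2$. We also write $f$ for its extension to a dominant rational map $\mathbb P^N_K\dashrightarrow\mathbb P^N_K$. The map $f$ is algebraically stable if $\deg(f^n)=(\deg f)^n$ for all $n\ge 1$. The first dynamical degree is that of the rational map on $\mathbb P^N$, i.e. $\delta_f=\lim_{n\to\infty}(\deg f^n)^{1/n}$. Fix an ample height function $h\ge 1$ on $\mathbb P^N(\overline K)$. For $x\in\mathbb A^N(\overline K)$ put $\overline\alpha_f(x)=\limsup_{n\to\infty}h(f^n(x))^{1/n}$ and $\underline\alpha_f(x)=\liminf_{n\to\infty}h(f^n(x))^{1/n}$; if they coincide, the common value is denoted $\alpha_f(x)$ (the arithmetic degree of $f$ at $x$) and $\alpha_f(x)$ is said to exist. Let $O_f(x)=\{f^n(x)\mid n\ge 0\}$. Suppose $\delta_f>1$. For a field $L$ with $K\subset L\subset\overline K$, $(\mathbb A^N_K,f)$ has densely many $L$-rational points with maximal arithmetic degree if there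 is a subset $S\subset\mathbb A^N(L)$ such that: (1) $S$ is Zariski dense; (2) $\alpha_f(x)$ exists and $\alpha_f(x)=\delta_f$ for every $x\in S$; (3) $O_f(x)\cap O_f(y)=\varnothing$ for any two distinct points $x,y\in S$. *)

(* Defs.v *)
From HB Require Import structures.
From mathcomp Require Import all_boot all_order all_algebra all_field.
From mathcomp Require Import complex.
From mathcomp Require Import all_classical all_reals all_analysis.
(* The notations of mpoly clash with those of MathComp-Analysis, so only its
   constants and canonical structures are imported; [mpoly N K] is the ring of
   polynomials in N variables over K. *)
From mathcomp Require Import -(notations) mpoly.
Set Implicit Arguments.
Unset Strict Implicit.
Unset Printing Implicit Defensive.

Import Order.TTheory GRing.Theory Num.Theory.
Import numFieldNormedType.Exports.

Local Open Scope classical_set_scope.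
Local Open Scope ring_scope.

(** * Polynomial self-maps of affine space *)

(* A K-morphism from A^N to A^N, given by its N coordinate polynomials. *)
Definition affine_map (K : fieldType) (N : nat) : Type := N.-tuple (mpoly N K).

Definition affine_id (K : fieldType) (N : nat) : affine_map K N :=
  [tuple mpolyX K (mnm1 i) | i < N].

Definition affine_comp (K : fieldType) (N : nat) (f g : affine_map K N) :
    affine_map K N :=
  [tuple comp_mpoly g (tnth f i) | i < N].

Definition affine_iter (K : fieldType) (N : nat) (f : affine_map K N)
    (n : nat) : affine_map K N :=
  iter n (affine_comp f) (affine_id K N).

(* [mmeasure mdeg p] is the total degree of p plus one, and 0 when p = 0. *)
Definition map_degree (K : fieldType) (N : nat) (f : affine_map K N) : nat :=
  (\max_(i < N) (mmeasure mdeg (tnth f i)).-1)%N.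

Definition quadratic (K : fieldType) (N : nat) (f : affine_map K N) : Prop :=
  map_degree f = 2%N.

Definition algebraically_stable (K : fieldType) (N : nat)
    (f : affine_map K N) : Prop :=
  forall n : nat, (0 < n)%N ->
    map_degree (affine_iter f n) = (map_degree f ^ n)%N.

(* Homogenizing the coordinates of f^n to degree [map_degree (f^n)] leaves no
   common factor, so this is also the degree of f^n as a rational self-map
   of P^N. *)
Definition dynamical_degree (R : realType) (K : fieldType) (N : nat)
    (f : affine_map K N) : R :=
  limn (fun n : nat => (map_degree (affine_iter f n))%:R `^ (n%:R^-1) : R).

Definition map_eval (K E : fieldType) (iota : {rmorphism K -> E}) (N : nat)
    (f : affine_map K N) (x : 'rV[E]_N) : 'rV[E]_N :=
  \row_(i < N) meval (fun j => x ord0 j) (map_mpoly iota (tnth f i)).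

Definition orbit_of (K E : fieldType) (iota : {rmorphism K -> E}) (N : nat)
    (f : affine_map K N) (x : 'rV[E]_N) : set 'rV[E]_N :=
  [set y | exists n : nat, y = iter n (map_eval iota f) x].

(** * Zariski topology on A^N(E), for E algebraically closed *)

Definition zariski_closed (E : closedFieldType) (N : nat)
    (Z : set 'rV[E]_N) : Prop :=
  exists I : set (mpoly N E),
    Z = [set x : 'rV[E]_N |
         forall p, I p -> meval (fun j => x ord0 j) p = 0].

Definition zariski_dense (E : closedFieldType) (N : nat)
    (S : set 'rV[E]_N) : Prop :=
  forall Z : set 'rV[E]_N, zariski_closed Z -> S `<=` Z -> Z = setT.

Definition dominant (K : fieldType) (E : closedFieldType)
    (iota : {rmorphism K -> E}) (N : nat) (f : affine_map K N) : Prop :=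
  zariski_dense (range (map_eval iota f)).

(** * Projective space and Weil heights *)

(* P^N(E) as the set of lines of E^(N+1). *)
Definition proj_space (E : fieldType) (N : nat) : Type :=
  {U : {vspace 'rV[E]_(1 + N)} | \dim U == 1%N}.

Lemma affine_point_subproof (E : fieldType) (N : nat) (x : 'rV[E]_N) :
  \dim <[row_mx (1%:M : 'rV[E]_1) x]>%VS == 1%N.
Proof.
rewrite dim_vline eqb1; apply/eqP => /matrixP /(_ ord0 (lshift N ord0)) /eqP.
by rewrite row_mxEl !mxE eqxx oner_eq0.
Qed.

(* The point [1 : x_1 : ... : x_N]. *)
Definition affine_point (E : fieldType) (N : nat) (x : 'rV[E]_N) :
    proj_space E N :=
  exist _ <[row_mx (1%:M : 'rV[E]_1) x]>%VS (affine_point_subproof x).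

(* A complex place of F is represented by two conjugate embeddings, which
   accounts for its local degree 2 in [weil_height]. *)
Definition arch_embedding (R : realType) (F : fieldExtType rat) :
    set (F -> R[i]) :=
  [set s : F -> R[i] | exists g : {rmorphism F -> R[i]}, s = g :> (F -> R[i])].
Arguments arch_embedding R F : clear implicits.

(* u is the normalized absolute value of a finite place of F: u is
   non-archimedean, its residue field has q elements (r lists representatives
   of the residue classes), and its largest value smaller than 1 is 1/q.  This
   is |.|_v ^ [F_v : Q_p] for the extension |.|_v of the p-adic absolute
   value. *)
Definition finite_place (R : realType) (F : fieldExtType rat) : set (F -> R) :=
  [set u : F -> R |
    [/\ forall x, 0 <= u x,
        forall x, u x = 0 <-> x = 0,
        forall x y, u (x * y) = u x * u y,
        forall x y, u (x + y) <= Num.max (u x) (u y)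
      & exists q : nat,
          [/\ exists r : 'I_q -> F,
                (forall i, u (r i) <= 1) /\
                (forall x, u x <= 1 -> exists! i, u (x - r i) < 1),
              exists pi : F, u pi = q%:R^-1
            & forall x, u x < 1 -> u x <= q%:R^-1]]].
Arguments finite_place R F : clear implicits.

(* The absolute logarithmic Weil height of [x_0 : ... : x_N], computed in a
   number field F containing the coordinates; both sums have finite support
   when x != 0. *)
Definition weil_height (R : realType) (F : fieldExtType rat) (N : nat)
    (x : 'rV[F]_(1 + N)) : R :=
  (\dim {:F})%:R^-1 *
  (\sum_(s \in arch_embedding R F)
      ln (\big[Num.max/0]_(i < 1 + N) Normc.normc (s (x ord0 i)))
   + \sum_(u \in finite_place R F)
      ln (\big[Num.max/0]_(i < 1 + N) u (x ord0 i))).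

(* The ample line bundles on P^N are the O(d) with d > 0, and a height
   function attached to O(d) is, by definition, d times the Weil height up to a
   bounded function.  The Weil height of a point does not depend on the number
   field F over which its coordinates are taken, hence the universal
   quantification over F. *)
Definition ample_height (R : realType) (E : fieldType) (N : nat)
    (h : proj_space E N -> R) : Prop :=
  exists d : nat, (0 < d)%N /\ exists C : R,
    forall (F : fieldExtType rat) (j : {rmorphism F -> E})
           (x : 'rV[F]_(1 + N)) (P : proj_space E N),
      val P = <[map_mx j x]>%VS ->
      `|h P - d%:R * weil_height R x| <= C.

(** * Arithmetic degrees *)

Section ArithmeticDegree.
Variables (R : realType) (K E : fieldType) (iota : {rmorphism K -> E}).
Variables (N : nat) (h : proj_space E N -> R) (f : affine_map K N).

Definition height_root (x : 'rV[E]_N) (n : nat) : \bar R :=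
  (h (affine_point (iter n (map_eval iota f) x)) `^ (n%:R^-1))%:E.

Definition upper_arith_degree (x : 'rV[E]_N) : \bar R :=
  limn_esup (height_root x).

Definition lower_arith_degree (x : 'rV[E]_N) : \bar R :=
  limn_einf (height_root x).

(* The arithmetic degree of f at x exists and equals a. *)
Definition has_arith_degree (x : 'rV[E]_N) (a : R) : Prop :=
  lower_arith_degree x = a%:E /\ upper_arith_degree x = a%:E.

End ArithmeticDegree.

(* L is regarded as a subfield of E through jL. *)
Definition densely_many_max_arith_degree (R : realType) (K : fieldType)
    (E : closedFieldType) (iota : {rmorphism K -> E}) (N : nat)
    (h : proj_space E N -> R) (f : affine_map K N)
    (L : fieldType) (jL : {rmorphism L -> E}) : Prop :=
  exists S : set 'rV[L]_N,
    [/\ zariski_dense (map_mx jL @` S),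
        forall x, S x ->
          has_arith_degree iota h f (map_mx jL x) (dynamical_degree R f)
      & forall x y, S x -> S y -> x <> y ->
          orbit_of iota f (map_mx jL x) `&` orbit_of iota f (map_mx jL y)
          = set0].

(* Main.v *)
(** Let [g = f^m], of degree [d], and let [a] be a point of the line at infinity
    fixed by the map that the top forms of [g] induce there once their common
    factor is removed; [L] is generated by the slope of [a]. In linear coordinates
    [(X, Y)] with [a] on [Y = 0], the top forms of [g] vanish along [Y = 0] to
    orders [j < l]. At a prime [p] such that [L] embeds in [Q_p]
    and all coefficients are units there, the monomials
    [X^(d-j) Y^j] and [X^(d-l) Y^l] dominate near [a]: [(ln |X|, ln |Y|)] evolves
    linearly and is expanded by [d] along an eigenfunctional [G]. It does not
    matter that [j > 0], that is, that the common factor may vanish at [a].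
    When the top form of the second coordinate is zero, [a] is superattracting if
    [j = 0]; otherwise the top form of [g] is nilpotent, [g] is not stable, and
    for quadratic [f] the dominant monomials are [(X Y, X)] or [(Y^2, X)], with
    growth rate the golden ratio or [sqrt 2], unless [delta_f <= 1].

    A single finite place bounds the height from below, since all local
    contributions are nonnegative; the upper bound is [deg(f^k)^(1/k)] for every
    [k]. If the orbits of [x] and [y] meet, then [G x] lies in one of at most [m]
    classes modulo powers of [d] determined by [y], so that points
    [p^-n (e1 + p^s e2)] with disjoint orbits can be selected, infinitely many
    of them on each of the lines indexed by [s]. *)

Require Import Defs.
From HB Require Import structures.
From mathcomp Require Import all_boot all_order all_algebra all_field.
From mathcomp Require Import complex.
From mathcomp Require Import all_classical all_reals all_analysis.
From mathcomp Require Import -(notations) mpoly.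
From mathcomp Require Import zify ring lra.
Set Implicit Arguments.
Unset Strict Implicit.
Unset Printing Implicit Defensive.
Import Order.TTheory GRing.Theory Num.Theory.
Import numFieldNormedType.Exports.
Local Open Scope classical_set_scope.
Local Open Scope ring_scope.

(** * Ultrametric absolute values *)

(** Disjointness of orbits is the obstacle. Growth up to constants would give the arithmetic degree
    but could not separate orbits; at an ultrametric place a strictly dominant monomial gives the
    exact size of the image, so [G] is multiplied by exactly [lambda ^+ m]. Along a line [G] grows
    only linearly in [n], while a class modulo powers of [d] is geometric: a window from [G] to
    [d G] far out holds more points than there are classes to avoid.

    The value of [dynamical_degree] comes out of the same estimate. With integral coefficients,
    [ln |f^n x|] is at most [deg (f^n) * ln |x|], so one fast orbit bounds the degrees from below;
    submultiplicativity, or a weighted degree in the quadratic cases, bounds them from above.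

    The place has residue field of [p] elements and uniformizer [p], so it can be described by
    p-adic absolute values of rationals [P(s_k)], with [s_k] Hensel approximations of a root: no
    completion and no ring of integers is built. Since [weil_height] sums over all places, its
    finite support is derived from the axioms of [finite_place], through independence of distinct
    places. *)

Definition ultrametric_abs (R : realType) (K : fieldType) (u : K -> R) : Prop :=
  [/\ forall x, 0 <= u x,
      forall x, u x = 0 <-> x = 0,
      forall x y, u (x * y) = u x * u y
    & forall x y, u (x + y) <= Num.max (u x) (u y)].

Section UltrametricAbs.
Variables (R : realType) (K : fieldType) (u : K -> R).
Hypothesis u_abs : ultrametric_abs u.

Lemma uabs_ge0 x : 0 <= u x. Proof. by case: u_abs. Qed.

Lemma uabs_eq0 x : (u x == 0) = (x == 0).
Proof. by case: u_abs => _ h _ _; apply/eqP/eqP => /h. Qed.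

Lemma uabs0 : u 0 = 0. Proof. by apply/eqP; rewrite uabs_eq0. Qed.

Lemma uabs_gt0 x : (0 < u x) = (x != 0).
Proof. by rewrite lt_neqAle eq_sym uabs_eq0 uabs_ge0 andbT. Qed.

Lemma uabsM x y : u (x * y) = u x * u y. Proof. by case: u_abs. Qed.

Lemma uabsD x y : u (x + y) <= Num.max (u x) (u y).
Proof. by case: u_abs. Qed.

Lemma uabs1 : u 1 = 1.
Proof.
have u1 : u 1 != 0 by rewrite uabs_eq0 oner_eq0.
by apply: (mulfI u1); rewrite -uabsM !mulr1.
Qed.

Lemma uabsN x : u (- x) = u x.
Proof.
suff h : u (-1) = 1 by rewrite -mulN1r uabsM h mul1r.
have := uabs1; rewrite -[X in u X](mulr1 1) -mulrNN uabsM => /eqP.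
by rewrite -expr2 sqrp_eq1 ?uabs_ge0 // => /eqP.
Qed.

Lemma uabsB x y : u (x - y) <= Num.max (u x) (u y).
Proof. by rewrite -(uabsN y) uabsD. Qed.

Lemma uabsX x n : u (x ^+ n) = u x ^+ n.
Proof. by elim: n => [|n IH]; rewrite ?expr0 ?uabs1 // !exprS uabsM IH. Qed.

Lemma uabsV x : u x^-1 = (u x)^-1.
Proof.
have [->|x0] := eqVneq x 0; first by rewrite invr0 uabs0 invr0.
have ux0 : u x != 0 by rewrite uabs_eq0.
by apply: (mulfI ux0); rewrite -uabsM !divff // uabs1.
Qed.

Lemma uabs_nat n : u n%:R <= 1.
Proof.
elim: n => [|n IH]; first by rewrite uabs0.
by rewrite -addn1 natrD; apply: le_trans (uabsD _ _) _; rewrite ge_max IH uabs1 /=.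
Qed.

Lemma uabs_int (z : int) : u z%:~R <= 1.
Proof. by case: z => n; rewrite ?NegzE ?mulrNz ?uabsN; apply: uabs_nat. Qed.

Lemma uabs_sum_le (I : Type) (s : seq I) (P : pred I) (F : I -> K) (B : R) :
  0 <= B -> (forall i, P i -> u (F i) <= B) -> u (\sum_(i <- s | P i) F i) <= B.
Proof.
move=> B0 h; elim/big_ind: _ => //; first by rewrite uabs0.
by move=> x y hx hy; apply: le_trans (uabsD _ _) _; rewrite ge_max hx.
Qed.

Lemma uabs_sum_lt (I : Type) (s : seq I) (P : pred I) (F : I -> K) (B : R) :
  0 < B -> (forall i, P i -> u (F i) < B) -> u (\sum_(i <- s | P i) F i) < B.
Proof.
move=> B0 h; elim/big_ind: _ => //; first by rewrite uabs0.
by move=> x y hx hy; apply: le_lt_trans (uabsD _ _) _; rewrite gt_max hx.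
Qed.

Lemma uabs_dom x y : u y < u x -> u (x + y) = u x.
Proof.
move=> h; apply/eqP; rewrite eq_le; apply/andP; split.
  by apply: le_trans (uabsD _ _) _; rewrite ge_max lexx ltW.
have := uabsB (x + y) y; rewrite addrK le_max => /orP[//|h2].
by have := lt_le_trans h h2; rewrite ltxx.
Qed.

End UltrametricAbs.

(** * The p-adic absolute value on the rationals *)

Definition padic_abs (R : realType) (p : nat) (x : rat) : R :=
  if x == 0 then 0
  else p%:R ^ ((logn p `|denq x|%N)%:Z - (logn p `|numq x|%N)%:Z).

Section PadicAbs.
Variables (R : realType) (p : nat).
Hypothesis p_prime : prime p.
Let pabs : rat -> R := padic_abs R p.

Let pR_gt1 : 1 < p%:R :> R. Proof. by rewrite ltr1n prime_gt1. Qed.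
Let pR_neq0 : p%:R != 0 :> R.
Proof. by rewrite pnatr_eq0 -lt0n prime_gt0. Qed.

(** The fraction need not be reduced: this reduces multiplicativity and the ultrametric inequality
    to statements about integers. *)
Lemma padic_abs_frac (a b : int) : a != 0 -> b != 0 ->
  pabs (a%:~R / b%:~R) = p%:R ^ ((logn p `|b|%N)%:Z - (logn p `|a|%N)%:Z).
Proof.
move=> a0 b0; set x := a%:~R / b%:~R.
have b0' : b%:~R != 0 :> rat by rewrite intr_eq0.
have x0 : x != 0 by rewrite mulf_neq0 ?invr_neq0 ?intr_eq0.
rewrite /pabs /padic_abs (negPf x0).
have e : (numq x * b = a * denq x)%R.
  apply/eqP; rewrite -(eqr_int rat) !rmorphM /= numqE; apply/eqP.
  by rewrite mulrAC {1}/x mulfVK.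
have := congr1 (fun z : int => logn p `|z|%N) e.
rewrite !abszM !lognM ?absz_gt0 ?numq_eq0 ?denq_eq0 // => h.
congr (_ ^ _); lia.
Qed.

Lemma padic_abs_ultrametric : ultrametric_abs pabs.
Proof.
have posx (x : rat) : x != 0 -> 0 < pabs x.
  by move=> x0; rewrite /pabs /padic_abs (negPf x0) exprz_gt0 // ltr0n prime_gt0.
have p0 : pabs 0 = 0 by rewrite /pabs /padic_abs eqxx.
have frac (x : rat) : x != 0 -> exists a b : int,
    [/\ a != 0, b != 0 & x = a%:~R / b%:~R].
  move=> x0; exists (numq x), (denq x).
  by rewrite numq_eq0 x0 denq_eq0 divq_num_den.
split.
- by move=> x; have [->|/posx/ltW] := eqVneq x 0; rewrite ?p0.
- move=> x; split=> [|->//]; have [//|/posx] := eqVneq x 0.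
  by rewrite lt_neqAle eq_sym => /andP[/eqP].
- move=> x y; have [->|x0] := eqVneq x 0; first by rewrite mul0r p0 mul0r.
  have [->|y0] := eqVneq y 0; first by rewrite mulr0 p0 mulr0.
  have [a [b [a0 b0 ->]]] := frac _ x0; have [c [d [c0 d0 ->]]] := frac _ y0.
  rewrite mulf_div -!rmorphM !padic_abs_frac ?mulf_neq0 // -expfzDr //.
  rewrite !abszM !lognM ?absz_gt0 //; congr (_ ^ _); lia.
- move=> x y; have [->|x0] := eqVneq x 0.
    by rewrite add0r le_max lexx orbT.
  have [->|y0] := eqVneq y 0; first by rewrite addr0 le_max lexx.
  have [->|xy0] := eqVneq (x + y) 0.
    by rewrite p0 le_max ltW ?posx.
  move: xy0; have [a [b [a0 b0 ->]]] := frac _ x0.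
  have [c [d [c0 d0 ->]]] := frac _ y0 => xy0.
  have b0' : b%:~R != 0 :> rat by rewrite intr_eq0.
  have d0' : d%:~R != 0 :> rat by rewrite intr_eq0.
  have e : a%:~R / b%:~R + c%:~R / d%:~R = (a * d + c * b)%:~R / (b * d)%:~R :> rat.
    by rewrite rmorphD !rmorphM /= addf_div.
  move: xy0; rewrite e mulf_eq0 negb_or intr_eq0 => /andP[n0 _].
  rewrite !padic_abs_frac ?mulf_neq0 //.
  have h k : (p ^ k %| `|(a * d)%R|)%N -> (p ^ k %| `|(c * b)%R|)%N ->
      (p ^ k %| `|(a * d + c * b)%R|)%N.
    move=> h1 h2; have : ((p ^ k)%:Z %| a * d + c * b)%Z.
      by apply: rpredD; rewrite /dvdz.
    by [].
  rewrite le_max !ler_eXz2l //.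
  (* Over the common denominator, both terms are divisible by [p] to the smaller of their two
     valuations, hence so is their sum. *)
  have := h (minn (logn p `|(a * d)%R|) (logn p `|(c * b)%R|)).
  rewrite !pfactor_dvdn ?absz_gt0 ?mulf_neq0 // !geq_min !leqnn orbT.
  move=> /(_ isT isT).
  rewrite !abszM !lognM ?absz_gt0 //.
  lia.
Qed.

Lemma padic_abs_int_le (z : int) (k : nat) :
  ((p ^ k)%N%:Z %| z)%Z -> pabs z%:~R <= p%:R ^- k.
Proof.
have [->|z0] := eqVneq z 0.
  by rewrite /pabs /padic_abs eqxx invr_ge0 exprn_ge0.
move=> h; have {h} : (p ^ k %| `|z|)%N by exact: h.
rewrite pfactor_dvdn ?absz_gt0 // => h.
have := padic_abs_frac z0 (oner_neq0 _); rewrite divr1 => ->.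
have -> : p%:R ^- k = p%:R ^ (- k%:Z) :> R by rewrite -invr_expz.
by rewrite ler_eXz2l // logn1; lia.
Qed.

Lemma padic_abs_unit (z : int) : ~~ (p%:Z %| z)%Z -> pabs z%:~R = 1.
Proof.
move=> h; have z0 : z != 0 by apply: contraNneq h => ->; rewrite dvdz0.
have := padic_abs_frac z0 (oner_neq0 _); rewrite divr1 => ->.
rewrite logn1 (_ : logn p `|z| = 0%N) ?subrr ?expr0z //.
by apply/eqP; rewrite -leqn0 leqNgt logn_gt0 mem_primes p_prime absz_gt0 z0.
Qed.

Lemma padic_abs_p : pabs p%:R = p%:R^-1.
Proof.
have pz : p%:Z != 0 by rewrite eqz_nat -lt0n prime_gt0.
have := padic_abs_frac pz (oner_neq0 _); rewrite divr1 => ->.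
by rewrite /= logn1 logn_prime // eqxx sub0r.
Qed.

Lemma padic_abs_lt1 (x : rat) : pabs x < 1 -> pabs x <= p%:R^-1.
Proof.
rewrite /pabs /padic_abs; case: eqP => _; first by rewrite invr_ge0.
rewrite -[X in _ < X](expr0z p%:R) -(expr1 p%:R^-1) exprVn.
have -> : p%:R ^- 1 = p%:R ^ (-1) :> R by rewrite -invr_expz.
by rewrite ltr_eXz2l // ler_eXz2l //; lia.
Qed.

(** It is [p] that is large here: a prime beyond all denominators makes finitely many rational
    polynomials integral at [p]. *)
Lemma padic_abs_large (x : rat) : (`|denq x| < p)%N -> pabs x <= 1.
Proof.
move=> h; rewrite /pabs /padic_abs; case: eqP => _ //.
rewrite -[X in _ <= X](expr0z p%:R) ler_eXz2l //.
suff -> : logn p `|denq x| = 0%N by lia.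
apply/eqP; rewrite -leqn0 leqNgt logn_gt0 mem_primes p_prime absz_gt0 denq_eq0 /=.
by apply/negP => /dvdn_leq; rewrite absz_gt0 denq_eq0 leqNgt h => /(_ isT).
Qed.

Lemma padic_abs_le1_denq (y : rat) : pabs y <= 1 -> coprime p `|denq y|.
Proof.
have [->|y0] := eqVneq y 0; first by rewrite /= coprimen1.
have [n0 d0] : numq y != 0 /\ denq y != 0 by rewrite numq_eq0 denq_eq0.
move=> y1; rewrite prime_coprime //; apply/negP => hp.
have hn : ~~ (p %| `|numq y|)%N.
  apply/negP => hp'; have := coprime_num_den y.
  rewrite /coprime => /eqP g1; have := dvdn_gcd p `|numq y| `|denq y|.
  rewrite hp hp' g1 dvdn1 => /eqP pe; by move: p_prime; rewrite pe.
move: y1; rewrite /pabs /padic_abs (negPf y0) -[X in _ <= X](expr0z p%:R).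
rewrite ler_eXz2l // (_ : logn p `|numq y| = 0%N); last first.
  by apply/eqP; rewrite -leqn0 leqNgt logn_gt0 mem_primes p_prime absz_gt0 n0.
have : (0 < logn p `|denq y|)%N by rewrite logn_gt0 mem_primes p_prime absz_gt0 d0.
lia.
Qed.

(** The residue is the numerator times an inverse of the denominator modulo [p], read off from a
    Bezout relation. *)
Lemma padic_residue (y : rat) : pabs y <= 1 ->
  exists2 i : nat, (i < p)%N & pabs (y - i%:R) < 1.
Proof.
have pu := padic_abs_ultrametric.
move=> /padic_abs_le1_denq cop.
have [v [w e]] := Bezoutz p%:Z (denq y).
have e1 : v * p%:Z + w * denq y = 1.
  by rewrite e /gcdz /=; move: cop; rewrite /coprime => /eqP ->.
pose c := (numq y * w)%R; pose i := `|(c %% p%:Z)%Z|%N.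
have pz : p%:Z != 0 by rewrite eqz_nat -lt0n prime_gt0.
have iE : i%:Z = (c %% p%:Z)%Z by rewrite /i gez0_abs ?modz_ge0.
exists i.
  by have : (i%:Z < p%:Z)%R by rewrite iE ltz_pmod // ltz_nat prime_gt0.
have h : ((p ^ 1)%N%:Z %| numq y - i%:Z * denq y)%Z.
  rewrite expn1 iE.
  have -> : numq y - (c %% p%:Z)%Z * denq y
      = p%:Z * (numq y * v + (c %/ p%:Z)%Z * denq y).
    have := divz_eq c p%:Z; set q := (c %/ _)%Z; set r := (c %% _)%Z => hc.
    have -> : r = c - q * p%:Z by rewrite hc addrC addKr.
    rewrite -[X in X - _](mulr1 (numq y)) -e1 /c; ring.
  exact: dvdz_mulr.
have d0' : (denq y)%:~R != 0 :> rat by rewrite intr_eq0.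
have -> : y - i%:R = (numq y - i%:Z * denq y)%:~R / (denq y)%:~R.
  by rewrite rmorphB rmorphM /= mulrBl mulfK // divq_num_den.
rewrite (uabsM pu) (uabsV pu) [pabs (denq y)%:~R]padic_abs_unit; last first.
  by rewrite /dvdz /=; move: cop; rewrite prime_coprime.
rewrite invr1 mulr1; apply: le_lt_trans (padic_abs_int_le h) _.
by rewrite expr1 invf_lt1 ?(lt_trans ltr01).
Qed.

End PadicAbs.

(** * A number field embeds in infinitely many fields of p-adic numbers *)

Lemma primitive_generator (F : fieldExtType rat) :
  exists theta : F, forall x : F, exists p : {poly rat},
    x = (map_poly (in_alg F) p).[theta].
Proof.
have sep : separable 1%AS (aspacef F).
  by apply/separableP => y _; apply: pcharf0_separable => p; rewrite pchar_lalg pchar_num.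
exists (separable_generator 1%AS (aspacef F)) => x.
apply/Fadjoin1_polyP; rewrite -(eq_adjoin_separable_generator sep) ?memvf //.
exact: subvf.
Qed.

(** Taylor's formula of order one with an integral remainder; the quadratic term is what a Newton
    step leaves over. *)
Lemma horner_sub_int (P : {poly int}) (a h : int) :
  exists S : int, P.[a + h] = P.[a] + P^`().[a] * h + S * h ^+ 2.
Proof.
elim/poly_ind: P => [|P c [S IH]].
  by exists 0; rewrite deriv0 !horner0 !mul0r !addr0.
exists (P^`().[a] + S * (a + h)).
rewrite derivMXaddC !hornerMXaddC hornerD hornerMX IH; ring.
Qed.

Lemma horner_sub_dvd (P : {poly int}) (a b d : int) :
  (d %| a - b)%Z -> (d %| P.[a] - P.[b])%Z.
Proof.
move=> h; have [S] := horner_sub_int P b (a - b).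
rewrite addrC subrK => ->.
rewrite [X in (d %| X)%Z](_ : _ = (P^`().[b] + S * (a - b)) * (a - b)); last by ring.
exact: dvdz_mull.
Qed.

Lemma hensel_step (P : {poly int}) (p k : nat) (r : int) :
  prime p -> (0 < k)%N -> ((p ^ k)%N%:Z %| P.[r])%Z -> ~~ (p%:Z %| P^`().[r])%Z ->
  exists r' : int, [/\ ((p ^ k)%N%:Z %| r' - r)%Z,
    ((p ^ k.+1)%N%:Z %| P.[r'])%Z & ~~ (p%:Z %| P^`().[r'])%Z].
Proof.
move=> pp k0 /dvdzP[c hc] hd.
have [v [w e]] := Bezoutz p%:Z P^`().[r].
have e1 : v * p%:Z + w * P^`().[r] = 1.
  rewrite e /gcdz /=; move: hd; rewrite /dvdz /= -prime_coprime // /coprime.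
  by move=> /eqP ->.
(* Newton's correction, with [w] in place of the inverse of [P'(r)] modulo [p]. The linear part
   becomes [c p^k (1 - w P'(r)) = c p^k v p], and [h^2] carries [p^(2k)], which suffices because
   [k > 0]. *)
pose h := - (c * w) * (p ^ k)%N%:Z.
exists (r + h).
have hk : ((p ^ k)%N%:Z %| r + h - r)%Z by rewrite addrC addKr dvdz_mull.
split=> //.
- have [S ->] := horner_sub_int P r h.
  have -> : P.[r] + P^`().[r] * h + S * h ^+ 2
     = (p ^ k.+1)%N%:Z * (c * v + S * (c * w) ^+ 2 * (p ^ k.-1)%N%:Z).
    rewrite hc /h -{1}(mulr1 c) -e1.
    have -> : (p ^ k.+1)%N%:Z = p%:Z * (p ^ k)%N%:Z by rewrite expnS PoszM.
    have -> : (p ^ k)%N%:Z = p%:Z * (p ^ k.-1)%N%:Z.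
      by rewrite -{1}(prednK k0) expnS PoszM.
    ring.
  exact: dvdz_mulr.
- apply: contra hd => hd'.
  have hp : (p%:Z %| r + h - r)%Z.
    by apply: dvdz_trans hk; rewrite dvdzE !absz_nat dvdn_exp.
  have hq := horner_sub_dvd P^`() hp.
  have -> : P^`().[r] = P^`().[r + h] - (P^`().[r + h] - P^`().[r]) by ring.
  exact: rpredB.
Qed.

Lemma hensel_sequence (P : {poly int}) (p : nat) (r : int) :
  prime p -> (p%:Z %| P.[r])%Z -> ~~ (p%:Z %| P^`().[r])%Z ->
  exists s : nat -> int, forall k, 
    ((p ^ k)%N%:Z %| s k.+1 - s k)%Z /\ ((p ^ k)%N%:Z %| P.[s k])%Z.
Proof.
move=> pp h1 h2.
(* The state carries its own index so that the choice can be iterated. At index [k] the root is good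
   modulo [p^(k+1)], one power more than is finally claimed. *)
pose T := {kr : nat * int | ((p ^ kr.1.+1)%N%:Z %| P.[kr.2])%Z
   /\ ~~ (p%:Z %| P^`().[kr.2])%Z}.
have step (t : T) : exists t' : T, (projT1 t').1 = (projT1 t).1.+1 /\
   ((p ^ (projT1 t).1.+1)%N%:Z %| (projT1 t').2 - (projT1 t).2)%Z.
  case: t => -[k a] /= [ha hb].
  have [r' [q1 q2 q3]] := hensel_step pp (ltn0Sn k) ha hb.
  by exists (exist _ (k.+1, r') (conj q2 q3)).
have t0 : (((p ^ 1)%N%:Z %| P.[r])%Z /\ ~~ (p%:Z %| P^`().[r])%Z).
  by rewrite expn1.
have [next hnext] := choice step.
pose tk k := iter k next (exist _ (0%N, r) t0 : T).
have tk1 k : (projT1 (tk k)).1 = k.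
  by elim: k => //= k IH; have [-> _] := hnext (tk k); rewrite IH.
exists (fun k => (projT1 (tk k)).2) => k; split.
  have [_] := hnext (tk k); rewrite tk1; apply: dvdz_trans.
  by rewrite dvdzE !absz_nat dvdn_exp2l.
have [+ _] := projT2 (tk k); rewrite tk1; apply: dvdz_trans.
by rewrite dvdzE !absz_nat dvdn_exp2l.
Qed.

(* Schur's argument: the values of [P] at multiples of [P(0) N!] are
   [P(0)] times integers congruent to 1 modulo [N!]. *)
Lemma large_prime_root (P : {poly int}) (N : nat) : (1 < size P)%N ->
  exists (p : nat) (r : int), [/\ prime p, (N < p)%N & (p%:Z %| P.[r])%Z].
Proof.
move=> sP.
have root_case r : P.[r] = 0 -> exists (p : nat) (r : int),
    [/\ prime p, (N < p)%N & (p%:Z %| P.[r])%Z].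
  by move=> r0; have [p Np pp] := prime_above N; exists p, r; rewrite r0 dvdz0.
have [/root_case//|P0] := eqVneq P.[0] 0.
have ex t : exists c : int,
    P.[N`!%:Z * P.[0] * t] = P.[0] * (1 + N`!%:Z * c).
  have := @horner_sub_dvd P (N`!%:Z * P.[0] * t) 0 (N`!%:Z * P.[0]).
  rewrite subr0 dvdz_mulr // => /(_ isT) /dvdzP[c hc].
  by exists c; rewrite -[LHS](subrK P.[0]) hc; ring.
pose a0 := P.[0]; pose z (i : nat) := N`!%:Z * P.[0] * i%:Z.
have z_inj : injective z.
  move=> i j /mulfI; rewrite mulf_neq0 // => [/(_ isT) []//|].
  by rewrite eqz_nat -lt0n fact_gt0.
(* The values [P(0)] and [-P(0)] are taken finitely often. At a [z i] where neither is taken, the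
   cofactor [w], congruent to 1 modulo [N!], is not a unit; unless it is 0, it has a prime divisor,
   necessarily larger than [N]. *)
have [i hi] : exists i, ~~ root ((P - a0%:P) * (P + a0%:P)) (z i).
  apply: contrapT => h.
  have Q0 (b : int) : P + b%:P != 0.
    rewrite addr_eq0; apply: contraTneq sP => ->.
    by rewrite -polyCN -leqNgt size_polyC_leq1.
  have Q1 : (P - a0%:P) * (P + a0%:P) != 0 by rewrite mulf_neq0 // -polyCN.
  have := @max_poly_roots _ _ (map z (iota 0 (size ((P - a0%:P) * (P + a0%:P))))) Q1.
  rewrite size_map size_iota ltnn => H.
  suff : false by []; apply: H.
    apply/allP => x /mapP[i _ ->]; apply: contrapT => /negP hr; apply: h.
    by exists i.
  by rewrite map_inj_uniq ?iota_uniq.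
have [c hc] := ex i%:Z; rewrite -/(z i) in hc.
move: hi; rewrite rootM !rootE !hornerE hc -/a0 subr_eq0 addr_eq0 negb_or.
move=> /andP[e1 e2]; pose w := 1 + N`!%:Z * c.
have w1 : (`|w|%N != 1)%N.
  apply/negP => /eqP hw.
  have : w = 1 \/ w = -1 by lia.
  by case=> hw'; move: e1 e2; rewrite -/w hw' ?mulr1 ?mulrN1 eqxx.
have [w0|w0] := eqVneq w 0.
  by apply: (root_case (z i)); rewrite hc -/w w0 mulr0.
have w2 : (1 < `|w|)%N by rewrite ltn_neqAle eq_sym w1 absz_gt0.
have pw : (pdiv `|w| %| `|w|)%N := pdiv_dvd _.
exists (pdiv `|w|), (z i); split.
- exact: pdiv_prime.
- rewrite ltnNge; apply/negP => h.
  have := dvdn_fact (n := N) (m := pdiv `|w|).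
  rewrite pdiv_gt0 h => /(_ isT) h1.
  have : ((pdiv `|w|)%:Z %| w - N`!%:Z * c)%Z.
    by apply: rpredB => //; apply: dvdz_mulr.
  rewrite /w addrK dvdz1 /= => /eqP h2.
  by have := pdiv_prime w2; rewrite h2.
- by rewrite hc; apply: dvdz_mull.
Qed.

Section SplitPlace.
Variables (R : realType) (F : fieldExtType rat) (theta : F).
Hypothesis theta_gen : forall x : F, exists p : {poly rat},
  x = (map_poly (in_alg F) p).[theta].
Local Notation ev := (fieldExt_horner theta).

Lemma ev_surj (x : F) : exists P, ev P = x.
Proof. by have [P ->] := theta_gen x; exists P. Qed.

(** The minimal polynomial of [theta]. Irreducibility is stated as coprimality with everything that
    does not vanish at [theta], so that nonvanishing becomes a Bezout identity that can be evaluated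
    at approximate roots. *)
Lemma rat_minimal_poly : exists m : {poly rat},
  [/\ (1 < size m)%N, ev m = 0, forall P, ev P = 0 -> m %| P
    & forall P, ev P != 0 -> coprimep m P].
Proof.
have /polyOver1P [m hm] := minPolyOver 1%AS theta.
have m_dvd P : ev P = 0 -> m %| P.
  move=> P0; rewrite -(dvdp_map (in_alg F)) -hm minPoly_dvdp ?alg_polyOver //.
  by rewrite rootE; apply/eqP.
have ms : (1 < size m)%N.
  rewrite -(size_map_poly (in_alg F)) -hm size_minPoly ltnS adjoin_degreeE.
  by rewrite divn_gt0 ?adim_gt0 ?dimvS ?subv_adjoin.
have evm : ev m = 0 by have := minPolyxx 1%AS theta; rewrite hm.
exists m; split => // P P0.
have [/dvdpP[h hh] /dvdpP[h' hh']] := (dvdp_gcdl m P, dvdp_gcdr m P).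
have m0 : m != 0 by rewrite -size_poly_gt0 (ltn_trans _ ms).
have g0 : gcdp m P != 0 by rewrite gcdp_eq0 negb_and m0.
have h0 : h != 0 by apply: contraNneq m0 => h0; rewrite hh h0 mul0r.
(* The gcd divides [P], so it does not vanish at [theta]; its cofactor [h] in [m] does, hence is as
   large as [m], and the gcd is constant. *)
have : ev h = 0.
  move: evm; rewrite {1}hh rmorphM /= => /eqP; rewrite mulf_eq0 => /orP[/eqP //|].
  by move=> /eqP e; move: P0; rewrite hh' rmorphM /= e mulr0 eqxx.
move=> /m_dvd /(dvdp_leq h0); rewrite {1}hh size_mul // => hs.
rewrite /coprimep eqn_leq size_poly_gt0 g0 andbT.
have hs0 : (0 < size h)%N by rewrite size_poly_gt0.
move: hs; rewrite addnC; case: (size h) hs0 => // n _; by rewrite addnS /= -add1n leq_add2r.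
Qed.

Lemma coprimep_bezout1 (P Q : {poly rat}) : coprimep P Q ->
  exists A B, A * P + B * Q = 1.
Proof.
move=> /Bezout_eq1_coprimepP [[A B] h]; by exists A, B.
Qed.

Definition denom_bound (N : nat) (P : {poly rat}) :=
  forall i, (`|denq P`_i| <= N)%N.

Lemma denom_bound_ex (P : {poly rat}) : exists N, denom_bound N P.
Proof.
exists (1 + \max_(i < size P) `|denq P`_i|)%N => i.
have [h|h] := ltnP i (size P); last by rewrite nth_default.
apply: leq_trans (leq_addl 1 _).
exact: (leq_bigmax (F := fun i : 'I_(size P) => `|denq P`_i|%N) (Ordinal h)).
Qed.

Lemma denom_bound_le N N' P : (N <= N')%N -> denom_bound N P -> denom_bound N' P.
Proof. by move=> h hP i; apply: leq_trans (hP i) h. Qed.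

Lemma archi_exp (p : nat) (C e : R) : prime p -> 0 < e ->
  \forall k \near \oo, C * p%:R ^- k < e.
Proof.
move=> pp e0; have [C0|C0] := leP C 0.
  by near=> k; apply: le_lt_trans e0; rewrite mulr_le0_ge0 // invr_ge0 exprn_ge0.
have e1 : 0 <= C / e by rewrite divr_ge0 ?ltW.
exists (Num.bound (C / e)) => // k /= hk.
have pk : 0 < p%:R ^+ k :> R by rewrite exprn_gt0 // ltr0n prime_gt0.
rewrite ltr_pdivrMr // mulrC -ltr_pdivrMr //.
apply: lt_le_trans (archi_boundP e1) _; rewrite -natrX ler_nat.
by apply: leq_trans hk _; apply/ltnW/ltn_expl/prime_gt1.
Unshelve. all: by end_near.
Qed.

(** The place sends [P(theta)] to the eventual value of [|P(s_k)|_p], where [s_k] converges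
    p-adically to a simple root of the minimal polynomial [m]. A nonzero [c = P(theta)] in [cs] is a
    unit because in [A P + B m = 1] both [A] and [P] are integral at [p], so two values at most 1
    have product 1. *)
Lemma split_place (cs : seq F) : exists u : F -> R,
  [/\ finite_place R F u, forall c, c \in cs -> c != 0 -> u c = 1
    & exists2 p, prime p & u p%:R = p%:R^-1].
Proof.
have [m [ms evm m_dvd m_cop]] := rat_minimal_poly.
have [N hN] : exists N, forall c, c \in cs -> c != 0 ->
   exists P A B, [/\ ev P = c, A * P + B * m = 1, denom_bound N P,
     denom_bound N A & denom_bound N B].
  elim: cs => [|c cs [N hN]]; first by exists 0%N.
  have [->|c0] := eqVneq c 0.
    by exists N => d; rewrite inE => /orP[/eqP->|//]; [rewrite eqxx|exact: hN].
  have [P hP] := ev_surj c.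
  have [|B [A e]] := @coprimep_bezout1 m P; first by apply: m_cop; rewrite hP.
  have [N1 h1] := denom_bound_ex P; have [N2 h2] := denom_bound_ex A.
  have [N3 h3] := denom_bound_ex B.
  exists (N + (N1 + (N2 + N3)))%N => d; rewrite inE => /orP[/eqP->|dcs] d0.
    exists P, A, B; split; rewrite 1?addrC //;
      [apply: denom_bound_le h1|apply: denom_bound_le h2|apply: denom_bound_le h3]; lia.
  have [P' [A' [B' [q1 q2 q3 q4 q5]]]] := hN _ dcs d0.
  exists P', A', B'; split=> //;
    [apply: denom_bound_le q3|apply: denom_bound_le q4|apply: denom_bound_le q5]; lia.
have [M [a a0 hM]] := rat_poly_scale m.
have m'0 : ev m^`() != 0.
  apply/eqP => /m_dvd /dvdp_leq h.
  have : m^`() != 0.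
    apply/eqP => /(congr1 (fun P : {poly rat} => P`_(size m).-2)).
    rewrite coef0 coef_deriv => /eqP; rewrite mulrn_eq0 /= prednK; last by case: (size m) ms => [|[]].
    by rewrite lead_coef_eq0 => /eqP m0; rewrite m0 size_poly0 in ms.
  move=> /h; apply/negP; rewrite -ltnNge lt_size_deriv // -size_poly_gt0.
  exact: ltn_trans ms.
have [U [V hUV]] := coprimep_bezout1 (m_cop _ m'0).
have [NU hNU] := denom_bound_ex U; have [NV hNV] := denom_bound_ex V.
(* The prime exceeds the denominators of all the Bezout identities for [cs], those of [U] and [V] in
   the identity for [m] and its derivative, and the scaling factor [a] of [m]. *)
have [p [r [pp Np pr]]] : exists (p : nat) (r : int),
    [/\ prime p, (N + (NU + (NV + `|a|)) < p)%N & (p%:Z %| M.[r])%Z].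
  apply: large_prime_root.
  have : size m = size M; last by move=> <-.
  rewrite hM size_scale ?invr_neq0 ?intr_eq0 // size_map_poly_id0 //.
  rewrite intr_eq0 lead_coef_eq0; apply: contraTneq ms => M0.
  by rewrite hM M0 map_poly0 scaler0 size_poly0.
have up := padic_abs_ultrametric R pp.
set pabs := padic_abs R p in up.
have a1 : pabs a%:~R = 1.
  apply: padic_abs_unit => //; rewrite dvdzE /=; apply/negP => /dvdn_leq.
  by rewrite absz_gt0 a0 => /(_ isT); move: Np; lia.
have int_horner (P : {poly int}) (x : int) : (map_poly intr P).[x%:~R] = P.[x]%:~R :> rat.
  by rewrite horner_map.
have mM (x : int) : pabs m.[x%:~R] = pabs M.[x]%:~R.
  by rewrite hM hornerZ int_horner (uabsM up) (uabsV up) a1 invr1 mul1r.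
have m'M (x : int) : pabs m^`().[x%:~R] = pabs M^`().[x]%:~R.
  by rewrite hM derivZ hornerZ deriv_map int_horner (uabsM up) (uabsV up) a1 invr1 mul1r.
have db_le P n (x : int) : (n < p)%N -> denom_bound n P -> pabs P.[x%:~R] <= 1.
  move=> np hP; rewrite horner_coef; apply: (uabs_sum_le up) => // i _.
  rewrite (uabsM up) (uabsX up) mulr_ile1 ?exprn_ge0 ?(uabs_ge0 up) //.
    by apply: padic_abs_large => //; apply: leq_ltn_trans (hP i) np.
  by rewrite exprn_ile1 ?(uabs_ge0 up) ?(uabs_int up).
have pinv1 : p%:R^-1 < 1 :> R by rewrite invf_lt1 ?ltr1n ?ltr0n ?prime_gt1 ?prime_gt0.
(* The root is simple modulo [p]: otherwise [U m + V m' = 1] with [U], [V] integral at [p] would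
   give 1 an absolute value below 1. *)
have pr' : ~~ (p%:Z %| M^`().[r])%Z.
  apply/negP => pr'; have := congr1 (fun P => pabs P.[r%:~R]) hUV.
  rewrite hornerD !hornerM hornerC (uabs1 up) => h.
  suff : pabs (U.[r%:~R] * m.[r%:~R] + V.[r%:~R] * m^`().[r%:~R]) <= p%:R^-1.
    by rewrite h leNgt pinv1.
  apply: le_trans (uabsD up _ _) _; rewrite ge_max !(uabsM up) mM m'M.
  have {}pr : pabs M.[r]%:~R <= p%:R^-1.
    by rewrite -(expr1 p%:R^-1) exprVn padic_abs_int_le // expn1.
  have {}pr' : pabs M^`().[r]%:~R <= p%:R^-1.
    by rewrite -(expr1 p%:R^-1) exprVn padic_abs_int_le // expn1.
  have U1 : pabs U.[r%:~R] <= 1 by apply: db_le hNU; move: Np; lia.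
  have V1 : pabs V.[r%:~R] <= 1 by apply: db_le hNV; move: Np; lia.
  by apply/andP; split; [apply: le_trans (ler_piMl _ U1) pr | apply: le_trans (ler_piMl _ V1) pr'];
    rewrite (uabs_ge0 up).
have [s hs] := hensel_sequence pp pr pr'.
have s_dvd k j : ((p ^ k)%N%:Z %| s (k + j)%N - s k)%Z.
  elim: j => [|j IH]; first by rewrite addn0 subrr dvdz0.
  rewrite -[X in (_ %| X)%Z](subrKA (s (k + j)%N)) rpredD // addnS.
  by have [+ _] := hs (k + j)%N; apply: dvdz_trans; rewrite dvdzE !absz_nat dvdn_exp2l ?leq_addr.
(* For each fixed [k], [w k] is multiplicative and ultrametric on polynomials; only in the limit
   does it depend on [ev P] alone. *)
pose w k P := pabs P.[(s k)%:~R].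
have wM k P Q : w k (P * Q) = w k P * w k Q by rewrite /w hornerM (uabsM up).
have w_ge0 k P : 0 <= w k P by apply: (uabs_ge0 up).
have wm k : w k m <= p%:R ^- k.
  by rewrite /w mM padic_abs_int_le //; case: (hs k).
have w_bnd P : exists2 C : R, 0 < C & forall k, w k P <= C.
  exists (1 + \sum_(i < size P) pabs P`_i).
    by rewrite ltr_wpDr // sumr_ge0 // => i _; apply: (uabs_ge0 up).
  move=> k; rewrite /w horner_coef; apply: (uabs_sum_le up).
    by rewrite addr_ge0 // sumr_ge0 // => i _; apply: (uabs_ge0 up).
  move=> i _; rewrite (uabsM up) (uabsX up).
  apply: (@le_trans _ _ (pabs P`_i)).
    by rewrite ler_piMr ?(uabs_ge0 up) // exprn_ile1 ?(uabs_ge0 up) ?(uabs_int up).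
  rewrite (bigD1 i) //= addrCA ler_wpDr // addr_ge0 // sumr_ge0 // => j _.
  exact: (uabs_ge0 up).
have w_cauchy P : exists C : R, forall k j,
    pabs (P.[(s (k + j)%N)%:~R] - P.[(s k)%:~R]) <= C * p%:R ^- k.
  have [Q [b b0 ->]] := rat_poly_scale P.
  exists (pabs b%:~R^-1) => k j.
  rewrite !hornerZ !int_horner -mulrBr -rmorphB /= (uabsM up).
  rewrite ler_wpM2l ?(uabs_ge0 up) // padic_abs_int_le //.
  by apply: horner_sub_dvd; apply: s_dvd.
have w_zero P : ev P = 0 -> forall e : R, 0 < e -> \forall k \near \oo, w k P < e.
  move=> /m_dvd /dvdpP[S ->] e e0; have [C C0 hC] := w_bnd S.
  have := archi_exp C pp e0; apply: filterS => k; apply: le_lt_trans.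
  by rewrite wM ler_pM.
have w_bez A P B k : A * P + B * m = 1 -> w k (B * m) < 1 -> w k A * w k P = 1.
  move=> hAB hk; rewrite -wM /w (_ : (A * P).[_] = 1 - (B * m).[(s k)%:~R]).
    by rewrite (uabs_dom up) (uabs1 up) // (uabsN up).
  by rewrite -[X in X - _](hornerC 1 (s k)%:~R) polyC1 -hAB hornerD addrK.
(* The Bezout identity with [m] keeps [w k P] away from 0, while the increments of [P(s_k)] tend to
   0; the ultrametric inequality then makes [w k P] eventually constant. *)
have w_const P : ev P != 0 -> exists2 c : R, 0 < c & \forall k \near \oo, w k P = c.
  move=> P0; have [B [A hAB]] := coprimep_bezout1 (m_cop _ P0).
  have [C C0 hC] := w_bnd A.
  have Bm : ev (B * m) = 0 by rewrite rmorphM /= evm mulr0.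
  have lb : \forall k \near \oo, C^-1 <= w k P.
    have := w_zero _ Bm _ ltr01; apply: filterS => k hk.
    have := w_bez _ _ _ _ (etrans (addrC _ _) hAB) hk.
    move=> h; rewrite -(ler_pM2l C0) divff ?gt_eqF // -h.
    exact: ler_wpM2r.
  have [C' hC'] := w_cauchy P.
  have Ci : 0 < C^-1 by rewrite invr_gt0.
  have [K _ hK] := filterI lb (archi_exp C' pp Ci).
  have [hK1 hK2] := hK K (leqnn K).
  exists (w K P); first exact: lt_le_trans hK1.
  exists K => // k /= /subnKC <-.
  rewrite /w -[X in pabs X = _](subrK P.[(s K)%:~R]) addrC (uabs_dom up) //.
  apply: le_lt_trans (hC' K (k - K)%N) _; exact: lt_le_trans hK2 hK1.
have w_eq P Q c : ev P = ev Q -> 0 < c -> (\forall k \near \oo, w k P = c) ->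
    \forall k \near \oo, w k Q = c.
  move=> PQ c0 h; have z : ev (Q - P) = 0 by rewrite rmorphB /= PQ subrr.
  apply: filterS (filterI h (w_zero _ z _ c0)) => k [hk1 hk2].
  rewrite /w -[Q](subrK P) addrC hornerD (uabs_dom up) //.
  by rewrite -/(w k P) hk1.
have /choice [u hu] : forall x : F, exists c : R, (x = 0 -> c = 0) /\
    (x != 0 -> 0 < c /\ forall P, ev P = x -> \forall k \near \oo, w k P = c).
  move=> x; have [->|x0] := eqVneq x 0.
    by exists 0; split=> //; rewrite eqxx.
  have [P hP] := ev_surj x; have [|c c0 hc] := w_const P; first by rewrite hP.
  exists c; split=> [x0'|_]; first by rewrite x0' eqxx in x0.
  split=> // Q hQ; apply: (w_eq P) => //; by rewrite hP hQ.
have u0 : u 0 = 0 by case: (hu 0) => ->.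
have upos x : x != 0 -> 0 < u x by move=> x0; case: (hu x) => _ /(_ x0) [].
have uw P : ev P != 0 -> \forall k \near \oo, w k P = u (ev P).
  by move=> x0; case: (hu (ev P)) => _ /(_ x0) [_ /(_ P)]; apply.
have uabs : ultrametric_abs u.
  split.
  - by move=> x; have [->|/upos/ltW] := eqVneq x 0; rewrite ?u0.
  - move=> x; split=> [|->//]; have [//|/upos] := eqVneq x 0.
    by rewrite lt_neqAle eq_sym => /andP[/eqP].
  - move=> x y; have [->|x0] := eqVneq x 0; first by rewrite mul0r u0 mul0r.
    have [->|y0] := eqVneq y 0; first by rewrite mulr0 u0 mulr0.
    move: x0 y0; have [P <-] := ev_surj x; have [Q <-] := ev_surj y => x0 y0.
    have xy0 : ev (P * Q) != 0 by rewrite rmorphM mulf_neq0.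
    have [k [+ [h1 h2]]] := filter_ex (filterI (uw _ xy0) (filterI (uw _ x0) (uw _ y0))).
    by rewrite wM h1 h2 rmorphM.
  - move=> x y; have [->|x0] := eqVneq x 0.
      by rewrite add0r le_max lexx orbT.
    have [->|y0] := eqVneq y 0; first by rewrite addr0 le_max lexx.
    have [->|xy0] := eqVneq (x + y) 0.
      by rewrite u0 le_max ltW ?upos.
    move: x0 y0 xy0; have [P <-] := ev_surj x; have [Q <-] := ev_surj y => x0 y0.
    rewrite -rmorphD => xy0.
    have [k [<- [<- <-]]] := filter_ex (filterI (uw _ xy0) (filterI (uw _ x0) (uw _ y0))).
     rewrite /w hornerD; exact: (uabsD up).
have evC (c : rat) : ev c%:P = c%:A by rewrite fieldExt_hornerC.
have u_rat (c : rat) : u c%:A = pabs c.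
  have [->|c0] := eqVneq c 0; first by rewrite scale0r u0 (uabs0 up).
  have c0' : ev c%:P != 0 by rewrite evC scaler_eq0 oner_eq0 orbF.
  by have /filter_ex [k] := uw _ c0'; rewrite evC /w hornerC => ->.
have u_nat (n : nat) : u n%:R = pabs n%:R by rewrite -u_rat scaler_nat.
have near_u P (z : R) : u (ev P) < z -> \forall k \near \oo, w k P < z.
  move=> h; have [e0|/uw] := eqVneq (ev P) 0.
    by apply: w_zero => //; apply: le_lt_trans h; rewrite e0 u0.
  by apply: filterS => k ->.
have u_near P (z : R) : 0 < z -> (\forall k \near \oo, w k P < z) -> u (ev P) < z.
  move=> z0 h; have [->|/uw h2] := eqVneq (ev P) 0; first by rewrite u0.
  by have [k [h3 <-]] := filter_ex (filterI h h2).
exists u; split; last by exists p => //; rewrite u_nat; apply: padic_abs_p.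
- have [h1 h2 h3 h4] := uabs; split=> //; exists p; split.
  + exists (fun i => (val i)%:R); split=> [i|x x1].
      by rewrite u_nat (uabs_nat up).
    move: x1; have [P <-] := ev_surj x => x1.
    have {}x1 : \forall k \near \oo, w k P <= 1.
      have [e0|/uw] := eqVneq (ev P) 0.
        by have := w_zero _ e0 _ ltr01; apply: filterS => k /ltW.
      by apply: filterS => k ->.
    (* Beyond some [K] the values [P(s_k)] differ from [P(s_K)] by less than 1, so the residue of
       the rational number [P(s_K)] is that of [P(theta)]. *)
    have [C hC] := w_cauchy P.
    have [K _ hK] := filterI x1 (archi_exp C pp ltr01).
    have [hK1 hK2] := hK K (leqnn K).
    have [i ip hi] := padic_residue pp hK1.
    have uPi (j : nat) : ev P - j%:R = ev (P - j%:R%:P).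
      by rewrite rmorphB /= evC scaler_nat.
    exists (Ordinal ip); split.
      rewrite uPi; apply: u_near => //; exists K => // k /= /subnKC <-.
      rewrite /w hornerD hornerN hornerC -(subrKA P.[(s K)%:~R]).
      apply: le_lt_trans (uabsD up _ _) _; rewrite gt_max hi andbT.
      exact: le_lt_trans (hC _ _) hK2.
    move=> j hj.
    have hij : u ((i : nat)%:R - (j : nat)%:R) < 1.
      have -> : i%:R - (j : nat)%:R = (ev P - (j : nat)%:R) - (ev P - i%:R) by ring.
      apply: le_lt_trans (uabsB uabs _ _) _; rewrite gt_max hj /=.
      rewrite uPi; apply: u_near => //; exists K => // k /= /subnKC <-.
      rewrite /w hornerD hornerN hornerC -(subrKA P.[(s K)%:~R]).
      apply: le_lt_trans (uabsD up _ _) _; rewrite gt_max hi andbT.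
      exact: le_lt_trans (hC _ _) hK2.
    have {hij} : u (i%:Z - (j : nat)%:Z)%:~R < 1 by rewrite rmorphB.
    have -> : u (i%:Z - (j : nat)%:Z)%:~R = pabs (i%:Z - (j : nat)%:Z)%:~R.
      by rewrite -u_rat scaler_int.
    have [hij|hij] := boolP (p%:Z %| i%:Z - (j : nat)%:Z)%Z; last first.
      by rewrite [pabs _]padic_abs_unit // ltxx.
    move=> _; apply/val_inj => /=.
    by move: hij; rewrite -eqz_mod_dvd !modz_nat => /eqP []; rewrite !modn_small.
  + by exists p%:R; rewrite u_nat; apply: padic_abs_p.
  + move=> x; have [->|] := eqVneq x 0; first by rewrite u0 invr_ge0.
    have [P <-] := ev_surj x => /uw /filter_ex [k <-].
    exact: padic_abs_lt1.
- move=> c ccs c0; have [P [A [B [<- hAB dP dA dB]]]] := hN c ccs c0.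
  have evP : ev P != 0.
    apply/eqP => e0; have := congr1 ev hAB.
    by rewrite rmorphD !rmorphM rmorph1 /= e0 evm !mulr0 addr0 => /eqP; rewrite eq_sym oner_eq0.
  have Bm : ev (B * m) = 0 by rewrite rmorphM /= evm mulr0.
  have [k [hk1 hk2]] := filter_ex (filterI (uw _ evP) (w_zero _ Bm _ ltr01)).
  rewrite -hk1.
  have hAP : w k A * w k P = 1.
    exact: (w_bez _ _ _ _ hAB).
  have A1 : w k A <= 1 by apply: db_le dA; move: Np; lia.
  have P1 : w k P <= 1 by apply: db_le dP; move: Np; lia.
  apply/eqP; rewrite eq_le P1 /= -hAP ler_piMl //.
Qed.

End SplitPlace.

(** * Finiteness of the places above a prime *)

Lemma powers_below (R : realType) (a c e : R) : 0 <= a < 1 -> 0 < e ->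
  \forall k \near \oo, a ^+ k * c < e.
Proof.
move=> /andP[a0 a1] e0; have [c0|c0] := leP c 0.
  by near=> k; apply: le_lt_trans e0; rewrite mulr_ge0_le0 // exprn_ge0.
have h : a ^+ k @[k --> \oo] --> 0 by apply: cvg_expr; rewrite ger0_norm.
have ec : 0 < e / c by rewrite divr_gt0.
move/cvgrPdist_lt: h => /(_ _ ec); apply: filterS => k.
by rewrite sub0r normrN ger0_norm ?exprn_ge0 // ltr_pdivlMr.
Unshelve. all: by end_near.
Qed.

Section PlacesAboveP.
Variables (R : realType) (F : fieldExtType rat).
Implicit Types u v : F -> R.

Lemma finite_place_abs u : finite_place R F u -> ultrametric_abs u.
Proof. by case=> h1 h2 h3 h4 _. Qed.

(** The bound [1 < q] has to be derived: 0 and 1 lie in different residue classes, since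
    [u 1 = 1]. *)
Lemma finite_place_residue u : finite_place R F u ->
  exists (q : nat) (r : 'I_q -> F) (pi : F),
  [/\ (1 < q)%N, forall i, u (r i) <= 1,
      forall x, u x <= 1 -> exists! i, u (x - r i) < 1,
      u pi = q%:R^-1 & forall x, u x < 1 -> u x <= q%:R^-1].
Proof.
move=> fu; have uu := finite_place_abs fu.
case: fu => _ _ _ _ [q [[r [r1 rx]] [pi hpi] hmax]].
exists q, r, pi; split=> //.
have [i [hi i_uniq]] := rx 0 ltac:(by rewrite (uabs0 uu)).
have [j [hj j_uniq]] := rx 1 ltac:(by rewrite (uabs1 uu)).
rewrite ltnNge; apply/negP => hq.
have ij : i = j.
  by apply/val_inj; move: (ltn_ord i) (ltn_ord j) hq => /=; lia.
have : u (1 - r j - (0 - r i)) < 1.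
  by apply: le_lt_trans (uabsB uu _ _) _; rewrite gt_max hi hj.
by rewrite ij (_ : _ - _ = 1) ?(uabs1 uu) ?ltxx //; ring.
Qed.

Lemma finite_place_unif u : finite_place R F u ->
  exists2 pi : F, 0 < u pi < 1 & forall x, u x < 1 -> u x <= u pi.
Proof.
move=> /finite_place_residue [q [r [pi [q1 _ _ hpi hmax]]]].
have q0 : (0 < q)%N := ltn_trans (ltn0Sn 0) q1.
by exists pi; rewrite hpi // invr_gt0 invf_lt1 ?ltr0n ?ltr1n ?q0.
Qed.

Lemma finite_place_le1P u v : finite_place R F u -> finite_place R F v ->
  (forall x, u x < 1 -> v x < 1) -> forall x, (u x < 1) = (v x < 1).
Proof.
move=> fu fv h x; have uu := finite_place_abs fu; have uv := finite_place_abs fv.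
apply/idP/idP; first exact: h.
move=> vx; have [//|ux] := ltP (u x) 1.
have [pi /andP[pi0 pi1] _] := finite_place_unif fu.
have pi_neq0 : pi != 0 by rewrite -(uabs_gt0 uu).
(* [v x < 1] would bound all powers of [x^-1] times [pi] if [u x >= 1]. *)
have [x0|x0] := eqVneq x 0; first by rewrite x0 (uabs0 uu) ler10 in ux.
have vpi : 0 < v pi by rewrite (uabs_gt0 uv).
have vx01 : 0 <= v x < 1 by rewrite (uabs_ge0 uv) vx.
have [k hk] := filter_ex (powers_below 1 vx01 vpi).
have : u (x^-1 ^+ k * pi) < 1.
  rewrite (uabsM uu) (uabsX uu) (uabsV uu).
  rewrite (le_lt_trans _ pi1) // ler_piMl ?(uabs_ge0 uu) //.
  by rewrite exprn_ile1 ?invr_ge0 ?(uabs_ge0 uu) // invf_le1 // (lt_le_trans ltr01).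
move=> /h; rewrite (uabsM uv) (uabsX uv) (uabsV uv) exprVn mulrC.
rewrite ltr_pdivrMr ?exprn_gt0 ?(uabs_gt0 uv) // mul1r => /ltW.
by rewrite leNgt -(mulr1 (v x ^+ k)) hk.
Qed.

(** Inequivalent representatives for [u] stay inequivalent for [v], so the open unit ball alone
    determines [q], and with it the normalization. *)
Lemma finite_place_residue_le u v (q q' : nat) (r : 'I_q -> F) (r' : 'I_q' -> F) :
  ultrametric_abs u -> ultrametric_abs v ->
  (forall x, (u x < 1) = (v x < 1)) ->
  (forall i, u (r i) <= 1) ->
  (forall x, u x <= 1 -> exists! i, u (x - r i) < 1) ->
  (forall x, v x <= 1 -> exists! i, v (x - r' i) < 1) -> (q <= q')%N.
Proof.
move=> uu uv h hr1 hr hr'.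
have h1 x : u x <= 1 -> v x <= 1.
  have [->|x0] := eqVneq x 0; first by rewrite (uabs0 uv).
  move=> ux; rewrite leNgt; apply/negP => vx.
  have : v x^-1 < 1 by rewrite (uabsV uv) invf_lt1 ?(uabs_gt0 uv).
  rewrite -h (uabsV uu) invf_lt1 ?(uabs_gt0 uu) //.
  by rewrite ltNge ux.
have /choice [sg hsg] : forall i, exists j, v (r i - r' j) < 1.
  by move=> i; have [j [hj _]] := hr' (r i) (h1 _ (hr1 i)); exists j.
rewrite -(card_ord q) -(card_ord q'); apply: (leq_card sg) => i i' e.
have [k [_ k_uniq]] := hr (r i) (hr1 i).
rewrite -(k_uniq i) ?subrr ?(uabs0 uu) // -(k_uniq i') // h.
have -> : r i - r i' = (r i - r' (sg i)) - (r i' - r' (sg i')) by rewrite e; ring.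
by apply: le_lt_trans (uabsB uv _ _) _; rewrite gt_max !hsg.
Qed.

(** Equal unit balls give equal [q], hence a common uniformizer [pi] with the same value. An element
    of value at most 1 is a unit times a power of [pi], with exponent the least [n] such that
    [u pi ^+ n <= u x]; the others follow by inversion. *)
Lemma finite_place_eq u v : finite_place R F u -> finite_place R F v ->
  (forall x, u x < 1 -> v x < 1) -> u = v.
Proof.
move=> fu fv /(finite_place_le1P fu fv) h.
have uu := finite_place_abs fu; have uv := finite_place_abs fv.
have h1 x : (u x <= 1) = (v x <= 1).
  have [->|x0] := eqVneq x 0; first by rewrite (uabs0 uv) (uabs0 uu).
  have := h x^-1; rewrite (uabsV uu) (uabsV uv) !invf_lt1 ?(uabs_gt0 uu, uabs_gt0 uv) //.
  by rewrite !leNgt => ->.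
have [pi [pi01 pimax pi_eq]] :
    exists pi, [/\ 0 < u pi < 1, forall x, u x < 1 -> u x <= u pi & u pi = v pi].
  have [pi0 pi01 pimax] := finite_place_unif fu.
  have [q [r [pi [q1 r1 rx hpi hmax]]]] := finite_place_residue fu.
  have [q' [r' [pi' [q1' r1' rx' hpi' hmax']]]] := finite_place_residue fv.
  have qq : q = q'.
    apply/eqP; rewrite eqn_leq (finite_place_residue_le uu uv h r1 rx rx').
    by rewrite (finite_place_residue_le uv uu (fun x => esym (h x)) r1' rx' rx).
  subst q'; have q01 : 0 < (q%:R^-1 : R) < 1.
    have q0 : (0 < q)%N := ltn_trans (ltn0Sn 0) q1.
    by rewrite invr_gt0 invf_lt1 ?ltr0n ?ltr1n ?q0.
  have /andP[q0 q01'] := q01.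
  have upi : 0 < u pi by rewrite hpi.
  have vpi : 0 < v pi by rewrite (uabs_gt0 uv) -(uabs_gt0 uu).
  exists pi; split; rewrite ?hpi //; apply/eqP; rewrite eq_le.
  rewrite [X in _ && X]hmax' ?andbT; last by rewrite -h hpi.
  have : u (pi' / pi) <= 1.
    by rewrite (uabsM uu) (uabsV uu) ler_pdivrMr // mul1r hpi hmax // h hpi'.
  by rewrite h1 (uabsM uv) (uabsV uv) ler_pdivrMr // mul1r hpi'.
have upi0 : 0 < u pi by case/andP: pi01.
have unit_eq x : u x = 1 -> v x = 1.
  move=> ux; apply/eqP; rewrite eq_le -h1 ux lexx /= leNgt -h ux ltxx //.
have small x : x != 0 -> u x <= 1 -> u x = v x.
  move=> x0 ux1; have ux0 : 0 < u x by rewrite (uabs_gt0 uu).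
  have pi01' : 0 <= u pi < 1 by rewrite (uabs_ge0 uu); case/andP: pi01.
  have [k hk] := filter_ex (powers_below 1 pi01' ux0).
  have ex_n : exists n, u pi ^+ n <= u x by exists k; rewrite -(mulr1 (_ ^+ _)) ltW.
  have [n hn n_min] := ex_minnP ex_n.
  have pin m : 0 < u pi ^+ m by rewrite exprn_gt0.
  have e : u (x / pi ^+ n) = 1.
    rewrite (uabsM uu) (uabsV uu) (uabsX uu).
    case: n hn n_min => [|n] hn n_min.
      by rewrite expr0 divr1; apply/eqP; rewrite eq_le ux1 -(expr0 (u pi)).
    have hn' : u x < u pi ^+ n by rewrite ltNge; apply/negP => /n_min; rewrite ltnn.
    have : u (x / pi ^+ n) <= u pi.
      by apply: pimax; rewrite (uabsM uu) (uabsV uu) (uabsX uu) ltr_pdivrMr // mul1r.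
    rewrite (uabsM uu) (uabsV uu) (uabsX uu) ler_pdivrMr // -exprS => le2.
    by apply/eqP; rewrite -(inj_eq (mulIf (lt0r_neq0 (pin n.+1)))) mul1r mulfVK ?lt0r_neq0 // eq_le le2.
  have := unit_eq _ e; move: e.
  rewrite (uabsM uu) (uabsV uu) (uabsX uu) (uabsM uv) (uabsV uv) (uabsX uv) -pi_eq.
  by move=> <- /(mulIf (invr_neq0 (lt0r_neq0 (pin n)))).
apply/funext => x; have [->|x0] := eqVneq x 0; first by rewrite (uabs0 uv) (uabs0 uu).
have [|/ltW ux1] := leP (u x) 1; first exact: small.
apply: invr_inj; rewrite -(uabsV uu) -(uabsV uv) small ?invr_neq0 //.
by rewrite (uabsV uu) invf_le1 ?(uabs_gt0 uu).
Qed.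


End PlacesAboveP.

(** * Weak approximation and the finite support of heights *)

Section PlaceSupport.
Variables (R : realType) (F : fieldExtType rat).
Implicit Types u v : F -> R.

(** By [finite_place_eq] neither open unit ball contains the other; the quotient of two witnesses
    separates the places in both directions at once. *)
Lemma finite_place_separate u v : finite_place R F u -> finite_place R F v ->
  u <> v -> exists x, 1 < u x /\ v x < 1.
Proof.
move=> fu fv uv; have uu := finite_place_abs fu; have vv := finite_place_abs fv.
have sep w w' : finite_place R F w -> finite_place R F w' -> w <> w' ->
    exists x, w x < 1 /\ 1 <= w' x.
  move=> fw fw' ww'; apply: contrapT => h; apply: ww'.
  apply: finite_place_eq => // x wx; rewrite ltNge; apply/negP => w'x.
  by apply: h; exists x.
have [a [ua va]] := sep _ _ fu fv uv.
have [b [vb ub]] := sep _ _ fv fu (nesym uv).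
have a0 : a != 0 by rewrite -(uabs_gt0 vv); apply: lt_le_trans va.
have ua0 : 0 < u a by rewrite (uabs_gt0 uu).
have va0 : 0 < v a by rewrite (uabs_gt0 vv).
exists (b / a); rewrite (uabsM uu) (uabsV uu) (uabsM vv) (uabsV vv).
by rewrite ltr_pdivlMr // ltr_pdivrMr // !mul1r (lt_le_trans ua ub) (lt_le_trans vb va).
Qed.

Lemma powers_below_seq (s : seq (F -> R)) (x y : F) :
  (forall v, v \in s -> ultrametric_abs v /\ v x < 1) ->
  \forall k \near \oo, forall v, v \in s -> v (x ^+ k * y) < 1.
Proof.
elim: s => [|w s IH] h; first by near=> k.
have [uw wx] := h w (mem_head _ _).
have wx01 : 0 <= w x < 1 by rewrite (uabs_ge0 uw).
have {}IH := IH (fun v vs => h v (mem_behead (s := w :: s) vs)).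
apply: filterS (filterI IH (powers_below (w y) wx01 ltr01)) => k [h1 h2] v.
by rewrite inE => /orP[/eqP->|/h1//]; rewrite (uabsM uw) (uabsX uw).
Unshelve. all: by end_near.
Qed.

(** Weak approximation by induction on [s]: [x] serves the places already treated and [y] separates
    [u] from the new place [w]. If [w x <= 1], a high power of [x] times [y] works. Otherwise that
    power is replaced by [x^k / (1 + x^k)], of size 1 where [x] is large and tiny where [x] is
    small. *)
Lemma finite_place_approx u (s : seq (F -> R)) : finite_place R F u ->
  (forall v, v \in s -> finite_place R F v /\ u <> v) ->
  exists x, 1 < u x /\ forall v, v \in s -> v x < 1.
Proof.
move=> fu; have uu := finite_place_abs fu; elim: s => [|w s IH] hs.
  have [pi /andP[pi0 pi1] _] := finite_place_unif fu.
  by exists pi^-1; rewrite (uabsV uu) invf_gt1.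
have [x [ux hx]] := IH (fun v vs => hs v (mem_behead (s := w :: s) vs)).
have [fw uw] := hs w (mem_head _ _); have ww := finite_place_abs fw.
have [y [uy wy]] := finite_place_separate fu fw uw.
have hs' v : v \in s -> ultrametric_abs v /\ v x < 1.
  move=> vs; split; last exact: hx.
  by have [/finite_place_abs] := hs v (mem_behead (s := w :: s) vs).
have [K _ /(_ K.+1 (leqnSn K)) hK] := powers_below_seq y hs'.
have uxK : 1 < u x ^+ K.+1 by rewrite exprn_egt1.
have [wx|wx] := leP (w x) 1.
  exists (x ^+ K.+1 * y); split.
    by rewrite (uabsM uu) (uabsX uu) -[1]mulr1 ltr_pM // ler01.
  move=> v; rewrite inE => /orP[/eqP->|/hK//].
  rewrite (uabsM ww) (uabsX ww) (le_lt_trans _ wy) // ler_piMl ?(uabs_ge0 ww) //.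
  by rewrite exprn_ile1 ?(uabs_ge0 ww).
have big v : ultrametric_abs v -> 1 < v x ->
    v (x ^+ K.+1 / (1 + x ^+ K.+1) * y) = v y.
  move=> vv vx; have vxK : 1 < v (x ^+ K.+1) by rewrite (uabsX vv) exprn_egt1.
  rewrite !(uabsM vv) (uabsV vv) (addrC 1) (uabs_dom vv) ?(uabs1 vv) //.
  by rewrite divff ?mul1r // gt_eqF // (lt_trans ltr01).
exists (x ^+ K.+1 / (1 + x ^+ K.+1) * y); split; first by rewrite big.
move=> v; rewrite inE => /orP[/eqP->|vs]; first by rewrite big.
have [vv vx] := hs' v vs.
rewrite mulrAC (uabsM vv) (uabsV vv) (uabs_dom vv) ?(uabs1 vv) ?divr1 ?hK //.
by rewrite (uabsX vv) exprn_ilt1 ?(uabs_ge0 vv).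
Qed.

Lemma alg_rat_frac (c : rat) : c%:A = (numq c)%:~R / (denq c)%:~R :> F.
Proof.
by rewrite -[LHS]/(in_alg F c) -{1}(divq_num_den c) fmorph_div !rmorph_int.
Qed.

(** An integer prime to [p] is a unit at every place above [p], by Bezout, so rationals integral at
    [p] are integral there. *)
Lemma uabs_padic_le1 u (p : nat) (c : rat) : ultrametric_abs u -> prime p ->
  u p%:R < 1 -> padic_abs R p c <= 1 -> u c%:A <= 1.
Proof.
move=> uu pp up /(padic_abs_le1_denq pp) cop.
have [v [w]] := Bezoutz p%:Z (denq c).
rewrite /gcdz /= (eqP cop : gcdn _ _ = 1%N) => e1.
have ud : 1 <= u (denq c)%:~R.
  rewrite leNgt; apply/negP => ud; have := uabs1 uu; apply/eqP; rewrite lt_eqF //.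
  have -> : 1 = v%:~R * p%:R + w%:~R * (denq c)%:~R :> F.
    by rewrite -[p%:R]/(p%:~R) -!rmorphM -rmorphD e1.
  apply: le_lt_trans (uabsD uu _ _) _; rewrite gt_max !(uabsM uu).
  by rewrite !(le_lt_trans (ler_piMl (uabs_ge0 uu _) (uabs_int uu _))).
rewrite alg_rat_frac (uabsM uu) (uabsV uu) ler_pdivrMr ?(lt_le_trans ltr01 ud) // mul1r.
exact: le_trans (uabs_int uu _) ud.
Qed.

(* Distinct places above [p] have [Q]-linearly independent witnesses [x_i]
   with [u_i x_i > 1] and [u_j x_i < 1] for [j != i]. *)
Lemma finite_places_above (p : nat) : prime p ->
  finite_set [set u : F -> R | finite_place R F u /\ u p%:R < 1].
Proof.
move=> pp; apply: contrapT => /(infinite_set_fset (\dim {:F}).+1) [B hB Bsz].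
have [s us hs] : exists2 s : seq (F -> R), uniq s & (\dim {:F} < size s)%N /\
    forall u, u \in s -> finite_place R F u /\ u p%:R < 1.
  exists (finmap.enum_fset B); first exact: finmap.fset_uniq.
  by split=> // u uB; apply: hB.
have {hs} [sz hs] := hs.
have /choice [x hx] : forall i : 'I_(size s), exists y, 1 < (tnth (in_tuple s) i) y /\
    forall v, v \in rem (tnth (in_tuple s) i) s -> v y < 1.
  move=> i; set u := tnth _ i; have us' : u \in s by rewrite mem_tnth.
  apply: finite_place_approx; first by have [] := hs u us'.
  move=> v; rewrite mem_rem_uniq // inE => /andP[/eqP vu vs].
  by split; [have [] := hs v vs | exact: nesym].
pose X := [tuple x i | i < size s].
have /negP : ~~ free X.
  apply/negP; rewrite /free => /eqP h.
  have := dimvS (subvf <<X>>%VS); rewrite h size_tuple leqNgt sz //.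
apply; apply/freeP => a ha i; apply: contrapT => /eqP ai.
have pabs := padic_abs_ultrametric R pp.
(* Dividing a linear relation by its p-adically largest coefficient makes all other coefficients
   integral, so [x j] becomes a sum of elements smaller than 1 at the [j]-th place, where it exceeds
   1. *)
have [j _ jmax] := @arg_maxP _ _ _ i xpredT (fun i => padic_abs R p (a i)) isT.
have aj : a j != 0.
  by rewrite -(uabs_gt0 pabs) (lt_le_trans _ (jmax i isT)) ?(uabs_gt0 pabs).
set u := tnth (in_tuple s) j.
have [fu up] := hs u (mem_tnth _ _); have uu := finite_place_abs fu.
have [ux _] := hx j.
have : x j = - \sum_(l < size s | l != j) (a l / a j)%:A * x l.
  move: ha; rewrite (bigD1 j) //= (nth_mktuple _ _ j) => /eqP.
  rewrite addr_eq0 => /eqP /(congr1 (fun z => (a j)^-1 *: z)).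
  rewrite scalerA mulVf // scale1r => ->.
  rewrite scalerN scaler_sumr; congr (- _); apply: eq_bigr => l _.
  by rewrite (nth_mktuple _ _ l) scalerA mulrC -scalerAl mul1r.
move=> /(congr1 u); rewrite (uabsN uu) => e; move: ux; rewrite -/u e.
apply/negP; rewrite -leNgt; apply/ltW/(uabs_sum_lt uu) => // l lj.
have [_ /(_ u)] := hx l; rewrite mem_rem_uniq // inE mem_tnth andbT.
have -> : u != tnth (in_tuple s) l.
  apply: contra lj => /eqP; rewrite /u !(tnth_nth u) => /eqP.
  by rewrite nth_uniq // => /eqP /val_inj ->.
move=> /(_ isT) uxl; rewrite (uabsM uu) (le_lt_trans _ uxl) // ler_piMl ?(uabs_ge0 uu) //.
apply: (uabs_padic_le1 uu pp up); rewrite (uabsM pabs) (uabsV pabs).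
by rewrite ler_pdivrMr ?(uabs_gt0 pabs) // mul1r; apply: jmax.
Qed.

Lemma uabs_nat_lt1 u (n : nat) : ultrametric_abs u -> (0 < n)%N -> u n%:R < 1 ->
  exists p, [/\ prime p, (p <= n)%N & u p%:R < 1].
Proof.
move=> uu; elim/ltn_ind: n => n IH n0 un.
have [n1|n1] := leqP n 1.
  have n_eq : n = 1%N by lia.
  by move: un; rewrite n_eq (uabs1 uu) ltxx.
have pp := pdiv_prime n1; have pn := dvdn_leq n0 (pdiv_dvd n).
have [up|up] := ltP (u (pdiv n)%:R) 1; first by exists (pdiv n).
have [|||q [qp qn uq]] := IH (n %/ pdiv n)%N.
- by rewrite ltn_Pdiv ?prime_gt1.
- by rewrite divn_gt0 ?prime_gt0.
- move: un; rewrite -{1}(divnK (pdiv_dvd n)) natrM (uabsM uu).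
  by apply: le_lt_trans; rewrite ler_peMr ?(uabs_ge0 uu).
- by exists q; rewrite (leq_trans qn) ?leq_div.
Qed.

(** Where [u x > 1], some coefficient of the monic minimal polynomial of [x] exceeds 1, since
    otherwise the leading term would dominate. Hence [u] lies above one of the finitely many primes
    dividing a denominator. *)
Lemma finite_places_gt1 (x : F) :
  finite_set [set u : F -> R | finite_place R F u /\ 1 < u x].
Proof.
have /polyOver1P [m hm] := minPolyOver 1%AS x.
have [N hN] := denom_bound_ex m.
apply: (@sub_finite_set _ _ (\bigcup_(p in [set p : nat | (p <= N)%N && prime p])
  [set u : F -> R | finite_place R F u /\ u p%:R < 1])); last first.
  apply: bigcup_finite; last by move=> p /= /andP[_ pp]; apply: finite_places_above.
  by apply: (sub_finite_set _ (finite_II N.+1)) => p /= /andP[].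
move=> u [fu ux]; have uu := finite_place_abs fu.
have [i hi] : exists i, 1 < u (m`_i)%:A.
  apply: contrapT => h.
  have := minPolyxx 1%AS x; have := monic_minPoly 1%AS x; rewrite hm.
  set M := map_poly _ m => /monicP lM; rewrite horner_coef.
  have sM : (0 < size M)%N.
    by rewrite size_poly_gt0 -lead_coef_eq0 lM oner_eq0.
  rewrite -(prednK sM) big_ord_recr /= -lead_coefE lM mul1r => /eqP.
  rewrite addrC addr_eq0 => /eqP /(congr1 u); apply/eqP.
  rewrite (uabsN uu) gt_eqF // (uabs_sum_lt uu) //.
    by rewrite (uabsX uu) exprn_gt0 // (lt_trans ltr01).
  move=> i _; rewrite (uabsM uu) !(uabsX uu) coef_map /=.
  have ui : u (m`_i)%:A <= 1 by rewrite leNgt; apply/negP => ?; apply: h; exists i.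
  rewrite (le_lt_trans (ler_piMl _ ui)) ?exprn_ge0 ?(uabs_ge0 uu) //.
  by rewrite ltr_eXn2l.
have ud : u (`|denq m`_i|%N)%:R < 1.
  rewrite ltNge; apply/negP => ud; move: hi; apply/negP; rewrite -leNgt.
  have -> : (m`_i)%:A = (numq m`_i)%:~R / (`|denq m`_i|%N)%:R :> F.
    rewrite -[(`|_|%N)%:R]/(`|_|%N%:Z)%:~R absz_denq.
    exact: alg_rat_frac.
  rewrite (uabsM uu) (uabsV uu) ler_pdivrMr ?(lt_le_trans ltr01 ud) // mul1r.
  exact: le_trans (uabs_int uu _) ud.
have [|p [pp pn up]] := uabs_nat_lt1 uu _ ud.
  by rewrite absz_gt0 denq_eq0.
by exists p => //=; rewrite pp (leq_trans pn (hN i)).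
Qed.

(** An embedding is determined by the image of a primitive element, which is a root of a fixed
    nonzero polynomial. *)
Lemma arch_embedding_finite : finite_set (arch_embedding R F).
Proof.
have [theta gen] := primitive_generator F.
have [m [ms evm _ _]] := rat_minimal_poly theta.
have rat_val (g : {rmorphism F -> R[i]}) (P : {poly rat}) :
    g (map_poly (in_alg F) P).[theta] = (map_poly ratr P).[g theta].
  rewrite -horner_map -map_poly_comp; congr (_.[_]); apply: eq_map_poly => c /=.
  by rewrite [_%:A]alg_rat_frac fmorph_div !rmorph_int.
apply: contrapT => /(infinite_set_fset (size m)) [B hB sB].
have ext (s s' : F -> R[i]) : s \in finmap.enum_fset B -> s' \in finmap.enum_fset B ->
    s theta = s' theta -> s = s'.
  move=> /hB [g ->] /hB [g' ->] e; apply/funext => x.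
  by have [P ->] := gen x; rewrite !rat_val e.
have m0 : map_poly ratr m != 0 :> {poly R[i]}.
  by rewrite map_poly_eq0 -size_poly_gt0 (ltn_trans _ ms).
apply/negP: sB; rewrite -ltnNge -(size_map (fun s => s theta)) -(size_map_poly (@ratr R[i])).
apply: max_poly_roots => //.
  apply/allP => _ /mapP [s /hB [g ->] ->].
  by rewrite rootE -rat_val -[_.[theta]]/(fieldExt_horner theta m) evm rmorph0.
by rewrite map_inj_in_uniq ?finmap.fset_uniq.
Qed.

End PlaceSupport.

(** * Heights *)

(** One list serves all families supported in [B], so that sums over places can be compared term by
    term. *)
Lemma fsum_finite (R : realType) (I : choiceType) (A B : set I) :
  finite_set B -> exists r : seq I,
  [/\ uniq r, forall i, i \in r <-> A i /\ B i
    & forall f : I -> R, (forall i, A i -> f i != 0 -> B i) ->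
        \sum_(i \in A) f i = \sum_(i <- r) f i].
Proof.
move=> fB; have fAB : finite_set (A `&` B) by apply: finite_setIr.
exists (finmap.enum_fset (fset_set (A `&` B))).
have mem i : i \in finmap.enum_fset (fset_set (A `&` B)) = (i \in A `&` B).
  exact: in_fset_set.
split; first exact: finmap.fset_uniq.
  by move=> i; rewrite mem inE.
move=> f hf; rewrite (fsbigE (finmap.enum_fset (fset_set (A `&` B)))).
- by rewrite [LHS]big_seq_cond [RHS]big_seq; apply: eq_bigl => i; rewrite mem
    andb_idr // !inE => -[].
- exact: finmap.fset_uniq.
- by move=> i /=; rewrite mem inE => -[].
- move=> i Ai; apply: contraNeq => fi.
  by rewrite mem inE; split=> //; apply: hf.
Qed.

Section MaxNorm.
Variables (R : realType) (K : fieldType) (v : K -> R).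
Hypotheses (v_ge0 : forall x, 0 <= v x) (v1 : v 1 = 1)
  (vM : forall x y, v (x * y) = v x * v y).

(** The leading 1 is the extra coordinate of [affine_point], so [affine_heightE] holds by
    computation and the norm is at least 1. *)
Definition max_norm (N : nat) (x : 'rV[K]_N) : R :=
  \big[Num.max/0]_(i < 1 + N) v ((row_mx 1%:M x : 'rV_(1 + N)) ord0 i).

Variable N : nat.
Implicit Type x : 'rV[K]_N.

Lemma max_norm_ge1 x : 1 <= max_norm x.
Proof.
apply: le_trans (le_bigmax _ _ (lshift N ord0)).
by rewrite row_mxEl mxE eqxx v1.
Qed.

Lemma max_norm_gt0 x : 0 < max_norm x.
Proof. exact: lt_le_trans ltr01 (max_norm_ge1 x). Qed.

Lemma max_norm_ge x i : v (x ord0 i) <= max_norm x.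
Proof.
apply: le_trans (le_bigmax _ _ (rshift 1 i)).
by rewrite row_mxEr.
Qed.

Lemma max_norm_le x (B : R) : 1 <= B -> (forall i, v (x ord0 i) <= B) ->
  max_norm x <= B.
Proof.
move=> B1 h; apply: bigmax_le => [|i _]; first exact: le_trans ler01 B1.
case: (split_ordP i) => j ->; last by rewrite row_mxEr.
by rewrite row_mxEl !ord1 mxE eqxx v1.
Qed.

Lemma multiplicative_exp a n : v (a ^+ n) = v a ^+ n.
Proof. by elim: n => [|n IH]; rewrite ?expr0 // !exprS vM IH. Qed.

Lemma max_norm_monomial x (m : multinom N) (D : nat) : (mdeg m <= D)%N ->
  v (\prod_(i < N) x ord0 i ^+ m i) <= max_norm x ^+ D.
Proof.
move=> hD; apply: (@le_trans _ _ (max_norm x ^+ mdeg m)); last first.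
  by rewrite ler_weXn2l ?max_norm_ge1.
rewrite mdegE; elim/big_ind2: _ => [|a1 n1 a2 n2 h1 h2|i _].
- by rewrite v1 expr0.
- by rewrite vM exprD ler_pM.
- by rewrite multiplicative_exp lerXn2r ?nnegrE ?max_norm_ge ?v_ge0 // ltW ?max_norm_gt0.
Qed.

End MaxNorm.

Lemma msupp_map_degree (K : fieldType) (N : nat) (g : affine_map K N) i m :
  m \in msupp (tnth g i) -> (mdeg m <= map_degree g)%N.
Proof.
move=> hm; apply: leq_trans (leq_bigmax i).
have : (mdeg m < mmeasure mdeg (tnth g i))%N by apply: mmeasure_mnm_lt.
by case: mmeasure.
Qed.

Definition self_eval (K : fieldType) (N : nat) (g : affine_map K N)
    (x : 'rV[K]_N) : 'rV[K]_N :=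
  \row_(i < N) meval (fun j => x ord0 j) (tnth g i).

Lemma max_norm_eval_ultra (R : realType) (K : fieldType) (u : K -> R) (N : nat)
    (g : affine_map K N) (c : R) (x : 'rV[K]_N) :
  ultrametric_abs u -> 1 <= c -> (forall i m, u (mcoeff m (tnth g i)) <= c) ->
  max_norm u (self_eval g x) <= c * max_norm u x ^+ map_degree g.
Proof.
move=> uu c1 hc; have Lx := max_norm_ge1 (uabs1 uu) x.
have LD : 1 <= max_norm u x ^+ map_degree g by rewrite exprn_ege1.
apply: max_norm_le; first exact: uabs1.
  by rewrite -[1]mulr1 ler_pM.
move=> i; rewrite mxE mevalE big_seq; apply: (uabs_sum_le uu).
  by rewrite mulr_ge0 ?(le_trans ler01).
move=> m hm; rewrite (uabsM uu) ler_pM ?(uabs_ge0 uu) ?hc //.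
apply: max_norm_monomial; rewrite ?(uabs1 uu) ?(msupp_map_degree hm) //.
  exact: uabs_ge0.
exact: uabsM.
Qed.

Section Height.
Variables (R : realType) (F : fieldExtType rat).

Definition arch_abs (s : F -> R[i]) : F -> R := fun x => Normc.normc (s x).

Lemma normc_ge0 (z : R[i]) : 0 <= Normc.normc z.
Proof. by case: z => a b; apply: sqrtr_ge0. Qed.

Lemma arch_abs_props s : arch_embedding R F s ->
  [/\ forall x, 0 <= arch_abs s x, arch_abs s 1 = 1,
      forall x y, arch_abs s (x * y) = arch_abs s x * arch_abs s y
    & forall (I : Type) (r : seq I) (P : pred I) (h : I -> F),
        arch_abs s (\sum_(i <- r | P i) h i) <= \sum_(i <- r | P i) arch_abs s (h i)].
Proof.
case=> g ->; rewrite /arch_abs; split.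
- by move=> x; apply: normc_ge0.
- by rewrite rmorph1 Normc.normc1.
- by move=> x y; rewrite rmorphM Normc.normcM.
- move=> I r P h; rewrite rmorph_sum /=; elim/big_ind2: _ => //.
    by rewrite Normc.normc0.
  move=> a1 b1 a2 b2 h1 h2; apply: le_trans (lerD h1 h2).
  exact: le_normcD.
Qed.

Lemma max_norm_eval_arch (N : nat) (g : affine_map F N) s (x : 'rV[F]_N) (c : R) :
  arch_embedding R F s -> 1 <= c ->
  (forall i, \sum_(m <- msupp (tnth g i)) arch_abs s (mcoeff m (tnth g i)) <= c) ->
  max_norm (arch_abs s) (self_eval g x) <= c * max_norm (arch_abs s) x ^+ map_degree g.
Proof.
move=> hs c1 hc; have [s_ge0 s1 sM sD] := arch_abs_props hs.
have Lx := max_norm_ge1 s1 x.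
have LD : 1 <= max_norm (arch_abs s) x ^+ map_degree g by rewrite exprn_ege1.
apply: (max_norm_le s1); first by rewrite -[1]mulr1 ler_pM.
move=> i; rewrite mxE mevalE.
apply: le_trans (sD _ _ _ _) _.
apply: le_trans (ler_wpM2r (le_trans ler01 LD) (hc i)).
rewrite mulr_suml big_seq [leRHS]big_seq; apply: ler_sum => m hm.
rewrite sM ler_wpM2l // max_norm_monomial ?(msupp_map_degree hm) //.
Qed.

Definition affine_height (N : nat) (x : 'rV[F]_N) : R :=
  weil_height R (row_mx 1%:M x : 'rV_(1 + N)).

Lemma affine_heightE (N : nat) (x : 'rV[F]_N) : affine_height x =
  (\dim {:F})%:R^-1 *
  (\sum_(s \in arch_embedding R F) ln (max_norm (arch_abs s) x) +
   \sum_(u \in finite_place R F) ln (max_norm u x)).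
Proof. by []. Qed.

Lemma finite_places_support (s : seq F) :
  finite_set [set u : F -> R | finite_place R F u /\ exists2 c, c \in s & 1 < u c].
Proof.
elim: s => [|c s IH].
  by rewrite (_ : [set _ | _] = set0) // -subset0 => u [_ []].
have := conj (finite_places_gt1 R c) IH; rewrite -finite_setU; apply: sub_finite_set.
move=> u [fu [d]]; rewrite inE => /orP[/eqP->|ds] ud; first by left.
by right; split=> //; exists d.
Qed.

Lemma max_norm_support (N : nat) (x : 'rV[F]_N) : exists B : set (F -> R),
  finite_set B /\ forall u, finite_place R F u -> ln (max_norm u x) != 0 -> B u.
Proof.
eexists; split; first exact: (finite_places_support [seq x ord0 i | i <- enum 'I_N]).
move=> u fu h; split=> //; have uu := finite_place_abs fu.
apply: contrapT => h2; move/eqP: h; apply.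
rewrite (_ : max_norm u x = 1) ?ln1 //; apply/eqP; rewrite eq_le.
rewrite max_norm_ge1 ?(uabs1 uu) // andbT max_norm_le ?(uabs1 uu) // => i.
rewrite leNgt; apply/negP => ui; apply: h2; exists (x ord0 i) => //.
by apply: map_f; rewrite mem_enum.
Qed.

Let dimF_gt0 : 0 < (\dim {:F})%:R :> R.
Proof. by rewrite ltr0n adim_gt0. Qed.

Lemma affine_height_ge (N : nat) (x : 'rV[F]_N) u : finite_place R F u ->
  (\dim {:F})%:R^-1 * ln (max_norm u x) <= affine_height x.
Proof.
move=> fu; rewrite affine_heightE; apply: ler_wpM2l; first by rewrite invr_ge0 ltW.
have [B [finB hB]] := max_norm_support x.
have finBu : finite_set (B `|` [set u]) by rewrite finite_setU.
have [r [_ hr rE]] := fsum_finite R (arch_embedding R F) (@arch_embedding_finite R F).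
have [r' [ur' hr' rE']] := fsum_finite R (finite_place R F) finBu.
rewrite rE // rE'; last by move=> w fw hw; left; apply: hB.
rewrite -[leLHS]add0r lerD //.
  rewrite big_seq sumr_ge0 // => s /hr [hs _].
  by have [_ s1 _ _] := arch_abs_props hs; rewrite ln_ge0 ?max_norm_ge1.
have uin : u \in r' by apply/hr'; split=> //; right.
rewrite (bigD1_seq u) //= lerDl big_seq_cond sumr_ge0 // => w /andP[/hr' [fw _] _].
by rewrite ln_ge0 ?max_norm_ge1 ?(uabs1 (finite_place_abs fw)).
Qed.

(** The local estimates are summed. The local constant is a sum of absolute values of coefficients
    at archimedean places and a maximum at finite ones, where it is 1 outside a finite set; each is
    at least 1, so its logarithm is harmless. *)
Lemma affine_height_eval (N : nat) (g : affine_map F N) : exists C : R, forall x,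
  affine_height (self_eval g x) <= (map_degree g)%:R * affine_height x + C.
Proof.
pose D := map_degree g.
pose ca (s : F -> R[i]) : R := 1 + \sum_(i < N)
  \sum_(m <- msupp (tnth g i)) arch_abs s (mcoeff m (tnth g i)).
pose cs := flatten [seq [seq mcoeff m (tnth g i) | m <- msupp (tnth g i)] | i <- enum 'I_N].
pose cu (u : F -> R) : R := \big[Num.max/1]_(c <- cs) u c.
have cu1 u : 1 <= cu u by apply: bigmax_ge_id.
have finc := finite_places_support cs; set Bc := (X in finite_set X) in finc.
have hBc u : finite_place R F u -> ln (cu u) != 0 -> Bc u.
  move=> fu h; split=> //; apply: contrapT => h2; move/eqP: h; apply.
  rewrite (_ : cu u = 1) ?ln1 //; apply/eqP; rewrite eq_le cu1 andbT.
  rewrite /cu big_seq; apply: bigmax_le => // c hc.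
  by rewrite leNgt; apply/negP => ?; apply: h2; exists c.
pose A := arch_embedding R F; pose P := finite_place R F.
exists ((\dim {:F})%:R^-1 * (\sum_(s \in A) ln (ca s) + \sum_(u \in P) ln (cu u))) => x.
have [B [finB hB]] := max_norm_support x.
have [B' [finB' hB']] := max_norm_support (self_eval g x).
(* A common finite set carrying the supports of the constants and of both heights. *)
have finU : finite_set (Bc `|` (B `|` B')) by rewrite !finite_setU.
rewrite !affine_heightE -/A -/P mulrCA -mulrDr; apply: ler_wpM2l; first by rewrite invr_ge0 ltW.
have [r [_ hr rE]] := fsum_finite R A (@arch_embedding_finite R F).
have [r' [ur' hr' rE']] := fsum_finite R P finU.
rewrite !rE //.
rewrite !rE'.
- rewrite mulrDr addrACA; apply: lerD.
    rewrite mulr_sumr -big_split /= big_seq [leRHS]big_seq; apply: ler_sum => s /hr [hs _].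
    have [s_ge0 s1 sM _] := arch_abs_props hs.
    have Lx := max_norm_gt0 s1 x.
    have ca1 : 1 <= ca s by rewrite lerDl sumr_ge0 // => i _; apply: sumr_ge0.
    have ca0 := lt_le_trans ltr01 ca1; have Lgx := max_norm_gt0 s1 (self_eval g x).
    rewrite mulr_natl -lnXn // -lnM ?posrE ?exprn_gt0 //.
    rewrite ler_ln ?posrE ?mulr_gt0 ?exprn_gt0 // mulrC.
    apply: max_norm_eval_arch => // i.
    rewrite /ca (bigD1 i) //= addrCA lerDl addr_ge0 // sumr_ge0 // => j _.
    exact: sumr_ge0.
  rewrite mulr_sumr -big_split /= big_seq [leRHS]big_seq; apply: ler_sum => u /hr' [fu _].
  have uu := finite_place_abs fu.
  have Lx := max_norm_gt0 (uabs1 uu) x.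
  have cu0 := lt_le_trans ltr01 (cu1 u); have Lgx := max_norm_gt0 (uabs1 uu) (self_eval g x).
  rewrite mulr_natl -lnXn // -lnM ?posrE ?exprn_gt0 //.
  rewrite ler_ln ?posrE ?mulr_gt0 ?exprn_gt0 // mulrC.
  apply: max_norm_eval_ultra => // i m.
  have [hm|hm] := boolP (m \in msupp (tnth g i)); last first.
    by rewrite memN_msupp_eq0 // (uabs0 uu) (le_trans ler01).
  apply: le_bigmax_seq => //; apply/flattenP.
  eexists; first by apply: map_f; rewrite mem_enum.
  exact: map_f.
- by move=> u fu /hBc; left; auto.
- by move=> u fu /hB; right; left; auto.
- by move=> u fu /hB'; right; right; auto.
Qed.

End Height.

(** * Composition of polynomial maps *)

Lemma mpoly_rmorph_ext (N : nat) (K : comNzRingType) (S : nzRingType)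
    (G H : {rmorphism mpoly N K -> S}) :
  (forall c, G (mpolyC N c) = H (mpolyC N c)) ->
  (forall i, G (mpolyX K (mnm1 i)) = H (mpolyX K (mnm1 i))) -> G =1 H.
Proof.
move=> hC hX p; rewrite [p]mpolyE !raddf_sum /=; apply: eq_bigr => m _.
rewrite -mul_mpolyC !rmorphM /= hC; congr (_ * _).
by rewrite mpolyXE_id !rmorph_prod; apply: eq_bigr => i _; rewrite !rmorphXn /= hX.
Qed.

Section Composition.
Variables (K : fieldType) (N : nat).
Implicit Types f g h : affine_map K N.

Lemma comp_mpolyA (k l : nat) (lq : N.-tuple (mpoly k K)) (lr : k.-tuple (mpoly l K)) p :
  comp_mpoly lr (comp_mpoly lq p) =
  comp_mpoly [tuple comp_mpoly lr (tnth lq i) | i < N] p.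
Proof.
apply: (mpoly_rmorph_ext (G := comp_mpoly lr \o comp_mpoly lq)) => [c|i] /=.
  by rewrite !comp_mpolyC.
by rewrite !comp_mpolyXU -!tnth_nth tnth_mktuple.
Qed.

Lemma affine_compA f g h :
  affine_comp (affine_comp f g) h = affine_comp f (affine_comp g h).
Proof. by apply: eq_from_tnth => i; rewrite !tnth_mktuple comp_mpolyA. Qed.

Lemma affine_comp1 f : affine_comp f (affine_id K N) = f.
Proof. by apply: eq_from_tnth => i; rewrite tnth_mktuple comp_mpoly_id. Qed.

Lemma affine_comp1l f : affine_comp (affine_id K N) f = f.
Proof.
by apply: eq_from_tnth => i; rewrite !tnth_mktuple comp_mpolyXU -tnth_nth.
Qed.

Lemma affine_iterD f m n :
  affine_iter f (m + n) = affine_comp (affine_iter f m) (affine_iter f n).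
Proof.
elim: m => [|m IH]; first by rewrite affine_comp1l.
by rewrite addSn /affine_iter !iterS -!/(affine_iter _ _) IH affine_compA.
Qed.

Lemma affine_iter1 f : affine_iter f 1 = f.
Proof. exact: affine_comp1. Qed.

Lemma self_eval_comp f g x : self_eval (affine_comp f g) x = self_eval f (self_eval g x).
Proof.
apply/rowP => i; rewrite !mxE tnth_mktuple comp_mpoly_meval.
by apply: meval_eq => j; rewrite mxE.
Qed.

Lemma self_eval_iter f n x : self_eval (affine_iter f n) x = iter n (self_eval f) x.
Proof.
elim: n => [|n IH]; last by rewrite /= -IH -self_eval_comp.
by apply/rowP => i; rewrite !mxE tnth_mktuple mevalXU.
Qed.

End Composition.

Definition map_affine (K E : fieldType) (phi : {rmorphism K -> E}) (N : nat)
    (f : affine_map K N) : affine_map E N :=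
  [tuple map_mpoly phi (tnth f i) | i < N].

Section BaseChange.
Variables (K E : fieldType) (phi : {rmorphism K -> E}) (N : nat).
Implicit Types f g : affine_map K N.

Lemma map_affine_comp f g :
  map_affine phi (affine_comp f g) = affine_comp (map_affine phi f) (map_affine phi g).
Proof.
apply: eq_from_tnth => i; rewrite !tnth_mktuple map_mpoly_comp; last exact: fmorph_inj.
by congr comp_mpoly; apply: eq_from_tnth => j; rewrite tnth_map tnth_mktuple.
Qed.

Lemma map_affine_iter f n : map_affine phi (affine_iter f n) = affine_iter (map_affine phi f) n.
Proof.
elim: n => [|n IH]; last by rewrite /= map_affine_comp IH.
by apply: eq_from_tnth => i; rewrite !tnth_mktuple map_mpolyX.
Qed.

Lemma map_degree_map_affine f : map_degree (map_affine phi f) = map_degree f.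
Proof.
apply: eq_bigr => i _; congr (_.-1); rewrite tnth_mktuple !mmeasureE.
by rewrite (perm_big _ (msupp_map_mpoly _ (fmorph_inj phi))).
Qed.

End BaseChange.

Lemma map_eval_tower (K F E : fieldType) (phi : {rmorphism K -> F})
    (psi : {rmorphism F -> E}) (iota : {rmorphism K -> E}) (N : nat)
    (f : affine_map K N) (x : 'rV[F]_N) : (forall a, psi (phi a) = iota a) ->
  map_eval iota f (map_mx psi x) = map_mx psi (self_eval (map_affine phi f) x).
Proof.
move=> h; apply/rowP => i; rewrite !mxE tnth_mktuple.
move: (tnth f i) => p.
have hc : (fun j => (map_mx psi x) ord0 j) =1 (fun j => psi (x ord0 j)) by move=> j; rewrite mxE.
rewrite (meval_eq _ hc).
apply: (mpoly_rmorph_ext (G := meval (fun j => psi (x ord0 j)) \o map_mpoly iota)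
  (H := psi \o (meval (fun j => x ord0 j) \o map_mpoly phi))) => [c|j] /=.
  by rewrite !map_mpolyC !mevalC h.
by rewrite !map_mpolyX !mevalXU.
Qed.

(** * Degree bounds *)

(** The bound is a number of [R] so that irrational weights are allowed, and the zero polynomial
    satisfies every bound. *)
Definition deg_le (R : numDomainType) (K : fieldType) (N : nat) (D : R) (p : mpoly N K) :=
  forall m, m \in msupp p -> (mdeg m)%:R <= D.

Section DegreeBounds.
Variables (R : numDomainType) (K : fieldType) (N : nat).
Implicit Types (p q : mpoly N K) (D E : R).

Lemma deg_leW D E p : D <= E -> deg_le D p -> deg_le E p.
Proof. by move=> DE h m /h /le_trans; apply. Qed.

Lemma deg_le_sum (I : Type) (r : seq I) (P : pred I) (F : I -> mpoly N K) D :
  (forall i, P i -> deg_le D (F i)) -> deg_le D (\sum_(i <- r | P i) F i).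
Proof.
move=> h; elim/big_ind: _ => //; first by move=> m; rewrite msupp0.
by move=> p q hp hq m /msuppD_le; rewrite mem_cat => /orP[/hp|/hq].
Qed.

Lemma deg_leM D E p q : deg_le D p -> deg_le E q -> deg_le (D + E) (p * q).
Proof.
move=> hp hq m /msuppM_le /allpairsP [[m1 m2] /= [h1 h2 ->]].
by rewrite mdegD natrD lerD ?hp ?hq.
Qed.

Lemma deg_le1 : deg_le (0 : R) (1 : mpoly N K).
Proof. by move=> m; rewrite msupp1 inE => /eqP ->; rewrite mdeg0. Qed.

Lemma deg_leX D p n : deg_le D p -> deg_le (n%:R * D) (p ^+ n).
Proof.
move=> h; elim: n => [|n IH]; first by rewrite mul0r expr0; apply: deg_le1.
by rewrite exprS -addn1 natrD mulrDl mul1r addrC; apply: deg_leM.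
Qed.

Lemma deg_leZ D c p : deg_le D p -> deg_le D (c *: p).
Proof. by move=> h m /msuppZ_le /h. Qed.

(** A weighted count: [E i] bounds the degree of what replaces the variable [i]. Unequal weights are
    what yields growth rates below the algebraic degree. *)
Lemma deg_le_comp (k : nat) (lq : k.-tuple (mpoly N K)) (E : 'I_k -> R) D (p : mpoly k K) :
  (forall m, m \in msupp p -> \sum_(i < k) (m i)%:R * E i <= D) ->
  (forall i, deg_le (E i) (tnth lq i)) -> deg_le D (comp_mpoly lq p).
Proof.
move=> hp hq; rewrite comp_mpolyE big_seq; apply: deg_le_sum => m /hp; move/deg_leW; apply.
apply: deg_leZ; elim/big_ind2: _ => [|p1 D1 p2 D2 h1 h2|i _].
- exact: deg_le1.
- exact: deg_leM.
- exact: deg_leX.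
Qed.

Lemma map_degree_le (f : affine_map K N) D : 0 <= D ->
  (forall i, deg_le D (tnth f i)) -> (map_degree f)%:R <= D.
Proof.
move=> D0 h; rewrite /map_degree.
elim/big_ind: _ => [//|a b ha hb|i _]; first by rewrite /maxn; case: ifP.
rewrite mmeasureE; set M := (X in (X.-1)%:R <= _).
suff : (M = 0)%N \/ (M.-1)%:R <= D by case=> [->|//].
rewrite /M big_seq; elim/big_ind: _ => [|a b ha hb|m hm]; first by left.
  by rewrite /maxn; case: ifP.
by right; apply: h hm.
Qed.

Lemma map_degree_deg_le (f : affine_map K N) i : deg_le ((map_degree f)%:R : R) (tnth f i).
Proof. by move=> m /msupp_map_degree; rewrite ler_nat. Qed.

End DegreeBounds.

Lemma map_degree_comp (K : fieldType) (N : nat) (f g : affine_map K N) :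
  (map_degree (affine_comp f g) <= map_degree f * map_degree g)%N.
Proof.
rewrite -(ler_nat int); apply: map_degree_le => // i; rewrite tnth_mktuple.
apply: (deg_le_comp (E := fun=> (map_degree g)%:R)); last exact: map_degree_deg_le.
move=> m /msupp_map_degree hm; rewrite -mulr_suml natrM ler_wpM2r //.
by rewrite -natr_sum ler_nat -mdegE.
Qed.

(** * Growth rates *)

Section GrowthRate.
Variable R : realType.
Implicit Types (a : nat -> R) (lambda mu : R).

Lemma root_exp_cvg1 (c : R) : 0 < c -> (c `^ (n%:R^-1)) @[n --> \oo] --> (1 : R).
Proof.
move=> c0; have -> : (fun n : nat => c `^ (n%:R^-1)) = expR \o (fun n : nat => n%:R^-1 * ln c).
  by apply/funext => n; rewrite /powR /= gt_eqF.
have h : (n%:R^-1 * ln c) @[n --> \oo] --> 0 * ln c.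
  by apply: cvgMl; rewrite -cvg_shiftS; apply: cvg_harmonic.
have := @cvg_comp _ _ _ _ expR _ _ _ h (@continuous_expR R (0 * ln c)).
rewrite mul0r expR0; apply.
Qed.

Lemma root_le (x y : R) (n : nat) : 0 <= x -> x <= y -> x `^ (n%:R^-1) <= y `^ (n%:R^-1).
Proof.
move=> x0 xy; apply: ge0_ler_powR; rewrite ?invr_ge0 ?nnegrE //.
exact: le_trans xy.
Qed.

Lemma root_geometric (K mu : R) (n : nat) : 0 <= K -> 0 <= mu -> (0 < n)%N ->
  (K * mu ^+ n) `^ (n%:R^-1) = K `^ (n%:R^-1) * mu.
Proof.
move=> K0 mu0 n0; rewrite powRM ?exprn_ge0 // -powR_mulrn // -powRrM.
by rewrite divff ?powRr1 // pnatr_eq0 -lt0n.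
Qed.

Definition growth_ge lambda a := exists2 c : R, 0 < c & forall n, c * lambda ^+ n <= a n.
(** Upper bounds are required only at rates above [lambda]: absorbing constants by passing to an
    iterate loses an arbitrarily small amount, invisible after taking [n]-th roots. *)
Definition growth_le lambda a := forall mu, lambda < mu ->
  exists K : R, forall n, a n <= K * mu ^+ n.

Lemma growth_le_root lambda a (e : R) : 0 <= lambda -> (forall n, 0 <= a n) ->
  growth_le lambda a -> 0 < e ->
  \forall n \near \oo, a n `^ (n%:R^-1) <= lambda + e.
Proof.
move=> l0 a0 ha e0; have [|K hK] := ha (lambda + e / 2).
  by rewrite ltrDl divr_gt0.
pose K1 := Num.max 1 K; have K1_gt0 : 0 < K1 by rewrite lt_max ltr01.
have mu0 : 0 <= lambda + e / 2 by rewrite addr_ge0 // divr_ge0 // ltW.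
have hcvg : (K1 `^ (n%:R^-1) * (lambda + e / 2)) @[n --> \oo] --> 1 * (lambda + e / 2).
  by apply: cvgMl; apply: root_exp_cvg1.
have e2 : 0 < e / 2 by rewrite divr_gt0.
move/cvgrPdist_lt: hcvg => /(_ _ e2) h1.
near=> n.
have n0 : (0 < n)%N by near: n; exists 1%N.
apply: (@le_trans _ _ ((K1 * (lambda + e / 2) ^+ n) `^ (n%:R^-1))).
  apply: root_le => //; apply: le_trans (hK n) _; rewrite ler_wpM2r ?exprn_ge0 //.
  by rewrite le_max lexx orbT.
rewrite root_geometric ?(ltW K1_gt0) //.
have : `|1 * (lambda + e / 2) - K1 `^ (n%:R^-1) * (lambda + e / 2)| < e / 2.
  by near: n.
rewrite ltr_norml mul1r => /andP[+ _]; move: (K1 `^ _ * _) => z; lra.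
Unshelve. all: by end_near.
Qed.

Lemma growth_root_cvg lambda a : 0 < lambda -> growth_ge lambda a ->
  growth_le lambda a -> (a n `^ (n%:R^-1)) @[n --> \oo] --> lambda.
Proof.
move=> l0 [c c0 hc] ha.
have a0 n : 0 <= a n by apply: le_trans (hc n); rewrite mulr_ge0 ?exprn_ge0 ?ltW.
apply/cvgrPdist_le => e e0.
have hcvg : (c `^ (n%:R^-1) * lambda) @[n --> \oo] --> 1 * lambda.
  by apply: cvgMl; apply: root_exp_cvg1.
move/cvgrPdist_lt: hcvg => /(_ _ e0) h1.
have h2 := growth_le_root (ltW l0) a0 ha e0.
near=> n.
have n0 : (0 < n)%N by near: n; exists 1%N.
have lb : c `^ (n%:R^-1) * lambda <= a n `^ (n%:R^-1).
  rewrite -(root_geometric (ltW c0) (ltW l0) n0); apply: root_le => //.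
  by rewrite mulr_ge0 ?exprn_ge0 ?ltW.
have : `|1 * lambda - c `^ (n%:R^-1) * lambda| < e by near: n.
have ub : a n `^ (n%:R^-1) <= lambda + e by near: n.
rewrite mul1r ltr_norml ler_norml.
move: lb ub; move: (c `^ _ * _) (a n `^ _) => z w h3 h4 /andP[h5 h6].
by apply/andP; split; lra.
Unshelve. all: by end_near.
Qed.

(** A multiplicative constant is absorbed into a slightly larger rate by a high power. *)
Lemma growth_exponent_ge1 (K mu nu : R) : 0 < mu -> mu < nu ->
  exists2 k : nat, (0 < k)%N & K * mu ^+ k <= nu ^+ k.
Proof.
move=> mu0 mn; have nu0 : 0 < nu := lt_trans mu0 mn.
have r01 : 0 <= mu / nu < 1.
  by rewrite divr_ge0 ?ltW //= ltr_pdivrMr // mul1r.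
have [k0 _ hk] := powers_below K r01 ltr01.
exists k0.+1 => //; have /= := hk k0.+1 (leqnSn _).
rewrite expr_div_n mulrAC ltr_pdivrMr ?exprn_gt0 // mul1r mulrC => /ltW //.
Qed.

End GrowthRate.

Definition degree_seq (R : realType) (K : fieldType) (N : nat) (f : affine_map K N) : nat -> R :=
  fun n => (map_degree (affine_iter f n))%:R.

Lemma dynamical_degree_eq (R : realType) (K : fieldType) (N : nat) (f : affine_map K N) (lambda : R) :
  0 < lambda -> growth_ge lambda (degree_seq R f) -> growth_le lambda (degree_seq R f) ->
  dynamical_degree R f = lambda.
Proof.
move=> l0 h1 h2; apply: (cvg_lim (@norm_hausdorff _ _)).
exact: growth_root_cvg.
Qed.

Lemma dynamical_degree_le1 (R : realType) (K : fieldType) (N : nat) (f : affine_map K N) :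
  growth_le 1 (degree_seq R f) -> dynamical_degree R f <= 1.
Proof.
move=> h; rewrite /dynamical_degree; set u := (fun n : nat => _).
(* Without convergence, [limn] takes its default value 0. *)
have [cu|/dvgP ->] := pselect (cvgn u); last exact: ler01.
apply/ler_addgt0Pr => e e0; apply: limr_le => //.
by apply: growth_le_root.
Qed.

(** * Arithmetic degrees from growth rates *)

Section ArithmeticDegree.
Variables (R : realType) (K : fieldType) (Kbar : closedFieldType)
  (iota : {rmorphism K -> Kbar}) (N : nat) (h : proj_space Kbar N -> R).
Hypotheses (h_ample : ample_height h) (h_ge1 : forall P, 1 <= h P).
Variables (F : fieldExtType rat) (phi : {rmorphism K -> F}) (psi : {rmorphism F -> Kbar}).
Hypothesis tower : forall a, psi (phi a) = iota a.
Variable f : affine_map K N.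
Let fF : affine_map F N := map_affine phi f.

Lemma iter_map_eval (x : 'rV[F]_N) n :
  iter n (map_eval iota f) (map_mx psi x) = map_mx psi (iter n (self_eval fF) x).
Proof. by elim: n => //= n ->; apply: map_eval_tower. Qed.

Lemma height_comparison : exists2 d : R, 0 < d & exists C : R, forall x n,
  `|h (affine_point (iter n (map_eval iota f) (map_mx psi x)))
     - d * affine_height R (iter n (self_eval fF) x)| <= C.
Proof.
have [d [d0 [C hC]]] := h_ample; exists d%:R; first by rewrite ltr0n.
exists C => x n; rewrite iter_map_eval; apply: (hC F psi).
by rewrite /= map_row_mx map_mx1.
Qed.

Lemma affine_height_ge0 (x : 'rV[F]_N) : 0 <= affine_height R x.
Proof.
have [theta gen] := primitive_generator F.
have [u [fu _ _]] := split_place R gen [::].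
apply: le_trans (affine_height_ge x fu); rewrite mulr_ge0 ?invr_ge0 //.
by rewrite ln_ge0 ?max_norm_ge1 ?(uabs1 (finite_place_abs fu)).
Qed.

(** For a suitable [k] the degree of [f^k] is at most [mu^k], and the height inequality for that
    single iterate is then iterated; the remaining [n %% k] steps take finitely many values. *)
Lemma height_growth_le (lambda : R) (x : 'rV[F]_N) : 1 <= lambda ->
  growth_le lambda (degree_seq R f) ->
  growth_le lambda (fun n => affine_height R (iter n (self_eval fF) x)).
Proof.
move=> l1 hdeg mu lmu; pose nu := (lambda + mu) / 2.
have [lnu numu] : lambda < nu /\ nu < mu by rewrite /nu; split; lra.
have nu1 : 1 < nu := le_lt_trans l1 lnu.
have nu0 : 0 < nu := lt_trans ltr01 nu1; have mu0 : 0 < mu := lt_trans nu0 numu.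
have mu1 : 1 < mu := lt_trans nu1 numu.
have [K0 hK] := hdeg nu lnu.
(* The 2 ensures [mu ^+ k >= 2], so that the additive constant is absorbed:
   [C0 + C <= 2 * C <= mu ^+ k * C] in [step]. *)
have [k k0 hk] := growth_exponent_ge1 (Num.max K0 2) nu0 numu.
have Dmu : (map_degree (affine_iter f k))%:R <= mu ^+ k.
  apply: le_trans (hK k) _; apply: le_trans _ hk.
  by apply: ler_wpM2r; rewrite ?le_max ?lexx // exprn_ge0 // ltW.
have mu2 : 2 <= mu ^+ k.
  apply: le_trans _ hk; rewrite -[X in X <= _]mulr1 ler_pM //.
    by rewrite le_max lexx orbT.
  by rewrite exprn_ege1 // ltW.
pose W (z : 'rV[F]_N) := affine_height R z.
have [C0 hC0] := affine_height_eval R (affine_iter fF k).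
pose C := Num.max C0 0.
have C_ge0 : 0 <= C by rewrite le_max lexx orbT.
have step z : W (iter k (self_eval fF) z) + C <= mu ^+ k * (W z + C).
  have := hC0 z; rewrite self_eval_iter -map_affine_iter map_degree_map_affine -/(W _) -/(W z) => h1.
  have h2 : C0 <= C by rewrite le_max lexx.
  have h3 : (map_degree (affine_iter f k))%:R * W z <= mu ^+ k * W z.
    by rewrite ler_wpM2r // affine_height_ge0.
  have h4 : 2 * C <= mu ^+ k * C by rewrite ler_wpM2r.
  by rewrite mulrDr; lra.
have steps t z : W (iter (t * k) (self_eval fF) z) + C <= (mu ^+ k) ^+ t * (W z + C).
  elim: t => [|t IH]; first by rewrite mul0n expr0 mul1r.
  rewrite mulSn iterD exprS -mulrA; apply: le_trans (step _) _.
  by rewrite ler_wpM2l // exprn_ge0 // ltW.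
pose B := \sum_(r < k) W (iter r (self_eval fF) x).
exists (B + C) => n; rewrite {1}(divn_eq n k) iterD.
have h1 := steps (n %/ k)%N (iter (n %% k) (self_eval fF) x).
have h2 : W (iter (n %% k) (self_eval fF) x) <= B.
  rewrite /B (bigD1 (Ordinal (ltn_pmod n k0))) //= lerDl.
  by apply: sumr_ge0 => i _; apply: affine_height_ge0.
apply: (@le_trans _ _ ((mu ^+ k) ^+ (n %/ k) * (B + C))).
  apply: (@le_trans _ _ (W (iter (n %/ k * k) (self_eval fF) (iter (n %% k) (self_eval fF) x)) + C)).
    by rewrite lerDl.
  apply: le_trans h1 _; rewrite ler_wpM2l ?lerD2r //.
  by rewrite exprn_ge0 // exprn_ge0 // ltW.
rewrite mulrC ler_wpM2l //.
  rewrite addr_ge0 // sumr_ge0 // => i _; exact: affine_height_ge0.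
by rewrite -exprM ler_weXn2l ?ltW // mulnC leq_trunc_div.
Qed.

Lemma arith_degree_eq (lambda : R) (x : 'rV[F]_N) : 1 <= lambda ->
  growth_le lambda (degree_seq R f) ->
  growth_ge lambda (fun n => affine_height R (iter n (self_eval fF) x)) ->
  has_arith_degree iota h f (map_mx psi x) lambda.
Proof.
move=> l1 hdeg [c c0 hc]; have l0 : 0 < lambda := lt_le_trans ltr01 l1.
have [d d0 [C hC]] := height_comparison.
have hH : growth_le lambda (fun n => h (affine_point (iter n (map_eval iota f) (map_mx psi x)))).
  move=> mu lmu; have [K0 hK] := height_growth_le x l1 hdeg lmu.
  have mu1 : 1 <= mu by apply: le_trans l1 (ltW lmu).
  exists (d * K0 + C) => n; have := hC x n; rewrite ler_norml => /andP[_ h1].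
  have h2 : d * affine_height R (iter n (self_eval fF) x) <= d * (K0 * mu ^+ n).
    by apply: ler_wpM2l; rewrite ?hK ?(ltW d0).
  have C0 : 0 <= C by apply: le_trans (normr_ge0 _) (hC x n).
  have h3 : C <= C * mu ^+ n by rewrite ler_peMr // exprn_ege1.
  rewrite mulrDl -mulrA; lra.
have hH' : growth_ge lambda (fun n => h (affine_point (iter n (map_eval iota f) (map_mx psi x)))).
  have C0 : 0 <= C by apply: le_trans (normr_ge0 _) (hC x 0%N).
  (* From [H >= 1] one gets [(1 + C) * H >= H + C], which is at least [d] times the Weil height: the
     bounded error turns into a constant factor, valid for every [n]. *)
  exists (d * c / (1 + C)); first by rewrite divr_gt0 ?mulr_gt0 // ltr_wpDr.
  move=> n; have := hC x n; rewrite ler_norml => /andP[h1 _].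
  rewrite mulrAC ler_pdivrMr ?ltr_wpDr // -mulrA.
  have h2 : d * (c * lambda ^+ n) <= d * affine_height R (iter n (self_eval fF) x).
    by apply: ler_wpM2l; rewrite ?hc ?(ltW d0).
  set H := h _ in h1 *; have H1 : 1 <= H by apply: h_ge1.
  have h3 : C <= H * C by rewrite ler_peMl.
  by rewrite mulrDr mulr1; lra.
have := growth_root_cvg l0 hH' hH => hcvg.
have : height_root iota h f (map_mx psi x) n @[n --> \oo] --> lambda%:E.
  by apply/cvg_EFin => //; near=> n.
by move=> /cvg_limn_einf_sup [].
Unshelve. all: by end_near.
Qed.

End ArithmeticDegree.

(** * Growth at a good place *)

Section IntegralCoefficients.
Variables (R : realType) (K : fieldType) (u : K -> R).
Hypothesis uu : ultrametric_abs u.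

Definition integral_coefs (N : nat) (p : mpoly N K) := forall m, u (mcoeff m p) <= 1.

Lemma integral_coefs_sum (N : nat) (I : Type) (r : seq I) (P : pred I) (F : I -> mpoly N K) :
  (forall i, P i -> integral_coefs (F i)) -> integral_coefs (\sum_(i <- r | P i) F i).
Proof. by move=> h m; rewrite raddf_sum /=; apply: (uabs_sum_le uu) => // i /h. Qed.

Lemma integral_coefsM (N : nat) (p q : mpoly N K) :
  integral_coefs p -> integral_coefs q -> integral_coefs (p * q).
Proof.
move=> hp hq m; rewrite mcoeffM; apply: (uabs_sum_le uu) => // i _.
by rewrite (uabsM uu) mulr_ile1 ?(uabs_ge0 uu).
Qed.

Lemma integral_coefs1 (N : nat) : integral_coefs (1 : mpoly N K).
Proof. by move=> m; rewrite mcoeff1; case: eqP; rewrite ?(uabs1 uu) ?(uabs0 uu). Qed.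

Lemma integral_coefsX (N : nat) (p : mpoly N K) n : integral_coefs p -> integral_coefs (p ^+ n).
Proof.
move=> hp; elim: n => [|n IH]; first exact: integral_coefs1.
by rewrite exprS; apply: integral_coefsM.
Qed.

Lemma integral_coefsZ (N : nat) c (p : mpoly N K) : u c <= 1 -> integral_coefs p ->
  integral_coefs (c *: p).
Proof. by move=> hc hp m; rewrite mcoeffZ (uabsM uu) mulr_ile1 ?(uabs_ge0 uu). Qed.

Lemma integral_coefs_comp (N k : nat) (lq : N.-tuple (mpoly k K)) (p : mpoly N K) :
  integral_coefs p -> (forall i, integral_coefs (tnth lq i)) ->
  integral_coefs (comp_mpoly lq p).
Proof.
move=> hp hq; rewrite comp_mpolyE; apply: integral_coefs_sum => m _.
apply: integral_coefsZ => //; elim/big_ind: _ => //.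
- exact: integral_coefs1.
- exact: integral_coefsM.
- by move=> i _; apply: integral_coefsX.
Qed.

Definition integral_map (N : nat) (f : affine_map K N) := forall i, integral_coefs (tnth f i).

Lemma integral_map_iter (N : nat) (f : affine_map K N) n :
  integral_map f -> integral_map (affine_iter f n).
Proof.
move=> hf; elim: n => [|n IH] i.
  by move=> m; rewrite tnth_mktuple mcoeffX; case: eqP; rewrite ?(uabs1 uu) ?(uabs0 uu).
by rewrite tnth_mktuple; apply: integral_coefs_comp.
Qed.

Lemma max_norm_eval_integral (N : nat) (f : affine_map K N) (x : 'rV[K]_N) :
  integral_map f -> max_norm u (self_eval f x) <= max_norm u x ^+ map_degree f.
Proof.
move=> hf; rewrite -[X in _ <= X]mul1r.
by apply: max_norm_eval_ultra => // i m; apply: hf.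
Qed.

Lemma ln_max_norm_iter_le (N : nat) (f : affine_map K N) (x : 'rV[K]_N) n :
  integral_map f -> ln (max_norm u (iter n (self_eval f) x))
    <= (map_degree (affine_iter f n))%:R * ln (max_norm u x).
Proof.
move=> hf; rewrite -self_eval_iter mulr_natl -lnXn ?max_norm_gt0 ?(uabs1 uu) //.
rewrite ler_ln ?posrE ?exprn_gt0 ?max_norm_gt0 ?(uabs1 uu) //.
exact: max_norm_eval_integral (integral_map_iter n hf).
Qed.

(* Growth along multiples of [m] propagates to all iterates, since
   [ln |f z| <= (deg f) ln |z|]. *)
Lemma ln_max_norm_growth (N : nat) (f : affine_map K N) (x : 'rV[K]_N) (m : nat) (lambda c : R) :
  integral_map f -> (0 < m)%N -> 1 <= lambda -> 0 < c ->
  (forall t, c * (lambda ^+ m) ^+ t <= ln (max_norm u (iter (m * t) (self_eval f) x))) ->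
  growth_ge lambda (fun n => ln (max_norm u (iter n (self_eval f) x))).
Proof.
(* The successor keeps [D] at least 1, so its powers increase. *)
move=> hf m0 l1 c0 h; pose D : R := (map_degree f).+1%:R.
have D1 : 1 <= D by rewrite ler1n.
have D0 : 0 < D := lt_le_trans ltr01 D1.
have ln0 z : 0 <= ln (max_norm u z) by rewrite ln_ge0 ?max_norm_ge1 ?(uabs1 uu).
have step z : ln (max_norm u (self_eval f z)) <= D * ln (max_norm u z).
  have := ln_max_norm_iter_le z 1 hf; rewrite affine_iter1 => /le_trans; apply.
  by apply: ler_wpM2r => //; rewrite ler_nat.
have steps s z : ln (max_norm u (iter s (self_eval f) z)) <= D ^+ s * ln (max_norm u z).
  elim: s => [|s IH]; first by rewrite mul1r.
  rewrite iterS exprS -mulrA; apply: le_trans (step _) _.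
  by apply: ler_wpM2l IH; apply: ltW.
exists (c / D ^+ m); first by rewrite divr_gt0 ?exprn_gt0.
(* The next multiple of [m] beyond [n] is used: its lower bound is carried back through [s <= m]
   steps, at the cost of at most [D ^+ m]. *)
move=> n; set t := (n %/ m).+1; pose s := (m * t - n)%N.
have nt : (n <= m * t)%N by rewrite /t mulnC ltnW // ltn_ceil.
have sm : (s <= m)%N by rewrite /s /t mulnS mulnC leq_subLR addnC leq_add2r leq_trunc_div.
have := h t; rewrite -{1}(subnK nt) iterD -/s => h1.
have h2 : c * lambda ^+ n <= D ^+ m * ln (max_norm u (iter n (self_eval f) x)).
  apply: (@le_trans _ _ (c * (lambda ^+ m) ^+ t)).
    by rewrite -exprM; apply: ler_wpM2l; rewrite ?(ltW c0) // ler_weXn2l.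
  apply: le_trans h1 _; apply: le_trans (steps s _) _.
  by apply: ler_wpM2r => //; rewrite ler_weXn2l.
by rewrite mulrAC ler_pdivrMr ?exprn_gt0 // [leRHS]mulrC.
Qed.

(** Integral coefficients give [ln |f^n x| <= deg (f^n) * ln |x|] with no additive error, so the
    growth of one orbit at one place bounds the degrees from below. *)
Lemma degree_growth_ge (N : nat) (f : affine_map K N) (x : 'rV[K]_N) (lambda : R) :
  integral_map f -> growth_ge lambda (fun n => ln (max_norm u (iter n (self_eval f) x))) ->
  growth_ge lambda (degree_seq R f).
Proof.
move=> hf [c c0 hc].
have x0 : 0 < ln (max_norm u x).
  by apply: lt_le_trans (hc 0%N); rewrite expr0 mulr1.
exists (c / ln (max_norm u x)); first by rewrite divr_gt0.
move=> n; rewrite mulrAC ler_pdivrMr //; apply: le_trans (hc n) _.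
exact: ln_max_norm_iter_le.
Qed.

End IntegralCoefficients.

(** * Selecting points with disjoint orbits *)

(** A greedy choice along an enumeration of the pairs [(s, t)]: each new element of [A s] avoids the
    finite list of earlier ones. *)
Lemma independent_family (T : eqType) (A : nat -> set T) (rel : T -> T -> Prop) :
  (forall x y, rel x y -> rel y x) ->
  (forall s (l : seq T), exists x, A s x /\ forall y, y \in l -> ~ rel x y) ->
  exists a : nat -> nat -> T, (forall s t, A s (a s t)) /\
    forall s t s' t', (s, t) != (s', t') -> ~ rel (a s t) (a s' t').
Proof.
move=> sym ex.
have /choice [next hnext] : forall sl : nat * seq T, exists x,
    A sl.1 x /\ forall y, y \in sl.2 -> ~ rel x y by move=> [s l]; apply: ex.
(* An integer that encodes no pair is assigned to row 0; the elements chosen there are simply never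
   read. *)
pose sg (n : nat) : nat := (odflt (0, 0)%N (unpickle n)).1.
pose l := fix l n := if n is k.+1 then next (sg k, l k) :: l k else [::].
pose b n := next (sg n, l n).
have b_in i n : (i < n)%N -> b i \in l n.
  elim: n => // n IH; rewrite ltnS leq_eqVlt => /orP[/eqP->|/IH h].
    exact: mem_head.
  by rewrite /= inE h orbT.
have b_rel i n : i != n -> ~ rel (b i) (b n).
  rewrite neq_ltn => /orP[|] h; have := b_in _ _ h.
    by move=> hin /sym; apply: (hnext (sg n, l n)).2.
  exact: (hnext (sg i, l i)).2.
exists (fun s t => b (pickle (s, t))); split.
  move=> s t; have := (hnext (sg (pickle (s, t)), l (pickle (s, t)))).1.
  have sgE : sg (pickle (s, t)) = s by rewrite /sg pickleK.
  by rewrite /= {1}sgE.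
move=> s t s' t' h; apply: b_rel; apply: contra h => /eqP h.
by apply/eqP; apply: (pcan_inj pickleK).
Qed.

(** Restricted to the line, [p] is a one-variable polynomial with infinitely many roots. *)
Lemma line_vanish (E : fieldType) (N : nat) (p : mpoly N E) (v w : 'rV[E]_N) (t : nat -> E) :
  injective t -> (forall i, meval (fun j => (v + t i *: w) ord0 j) p = 0) ->
  forall c, meval (fun j => (v + c *: w) ord0 j) p = 0.
Proof.
move=> inj_t h.
pose q : {poly E} := mmap (@polyC E) (fun j => (v ord0 j)%:P + w ord0 j *: 'X) p.
have qE c : q.[c] = meval (fun j => (v + c *: w) ord0 j) p.
  rewrite -[LHS]/((horner_eval c \o mmap (@polyC E) (fun j => (v ord0 j)%:P + w ord0 j *: 'X)) p).
  apply: mpoly_rmorph_ext => [a|i] /=.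
    by rewrite mmapC mevalC /horner_eval hornerC.
  by rewrite mmapX mmap1U mevalXU /horner_eval !hornerE !mxE mulrC.
suff q0 : q = 0 by move=> c; rewrite -qE q0 horner0.
apply/eqP; apply: contraT => q0.
have := @max_poly_roots _ q (map t (iota 0 (size q))) q0.
rewrite size_map size_iota ltnn; apply.
  by apply/allP => _ /mapP [i _ ->]; rewrite rootE qE h.
by rewrite map_inj_uniq ?iota_uniq.
Qed.

(** * Density and disjoint orbits inside an invariant region *)

Section InvariantRegion.
Variables (R : realType) (K : fieldType) (Kbar : closedFieldType)
  (iota : {rmorphism K -> Kbar}) (h : proj_space Kbar 2 -> R).
Hypotheses (h_ample : ample_height h) (h_ge1 : forall P, 1 <= h P).
Variables (F : fieldExtType rat) (phi : {rmorphism K -> F}) (psi : {rmorphism F -> Kbar}).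
Hypothesis tower : forall a, psi (phi a) = iota a.
Variable f : affine_map K 2.
Let fF : affine_map F 2 := map_affine phi f.
Variables (u : F -> R) (m : nat) (lambda : R).
Hypotheses (u_place : finite_place R F u) (f_int : integral_map u fF)
  (m_gt0 : (0 < m)%N) (lambda_gt1 : 1 < lambda)
  (deg_growth : growth_le lambda (degree_seq R f)).
Variables (U : 'rV[F]_2 -> Prop) (G : 'rV[F]_2 -> R) (C : R).
Hypotheses (C_gt0 : 0 < C)
  (U_stable : forall x, U x -> U (iter m (self_eval fF) x) /\
     G (iter m (self_eval fF) x) = lambda ^+ m * G x)
  (U_bound : forall x, U x -> 0 < G x <= C * ln (max_norm u x)).
Variables (e1 e2 : 'rV[F]_2) (pi : F) (kappa : R) (beta : nat -> R).
Hypotheses (pi_inj : injective (fun n : nat => pi ^+ n)) (pi_neq0 : pi != 0)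
  (e_span : forall y : 'rV[Kbar]_2, exists a b,
     y = a *: map_mx psi e1 + b *: map_mx psi e2)
  (kappa_gt0 : 0 < kappa).
(** In the application [pi] is small at [u]: [n] moves the point towards infinity on the line
    through 0 with direction [e1 + pi ^+ s *: e2], which is close to [e1], the direction of the
    fixed point. *)
Let pt (n s : nat) : 'rV[F]_2 := pi ^- n *: (e1 + pi ^+ s *: e2).
Hypothesis pt_U : forall s, (0 < s)%N -> exists n0, forall n, (n0 <= n)%N ->
  U (pt n s) /\ G (pt n s) = kappa * n%:R + beta s.

Let lambda_ge1 : 1 <= lambda. Proof. exact: ltW. Qed.
Let uu : ultrametric_abs u. Proof. exact: finite_place_abs. Qed.
Let d : R := lambda ^+ m.
Let d_gt1 : 1 < d. Proof. by rewrite /d exprn_egt1 // -lt0n. Qed.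
Let d_gt0 : 0 < d. Proof. exact: lt_trans d_gt1. Qed.

Lemma region_iter x t : U x -> U (iter (m * t) (self_eval fF) x) /\
  G (iter (m * t) (self_eval fF) x) = d ^+ t * G x.
Proof.
move=> Ux; elim: t => [|t [IH1 IH2]]; first by rewrite muln0 mul1r.
rewrite mulnS iterD; have [h1 h2] := U_stable IH1.
by rewrite h2 IH2 exprS mulrA.
Qed.

Lemma region_growth x : U x ->
  growth_ge lambda (fun n => ln (max_norm u (iter n (self_eval fF) x))).
Proof.
move=> Ux; have /andP[Gx _] := U_bound Ux.
apply: (ln_max_norm_growth uu f_int m_gt0 lambda_ge1 (c := G x / C)).
  by rewrite divr_gt0.
move=> t; have [h1 h2] := region_iter t Ux; have /andP[_] := U_bound h1.
rewrite h2 => h3; rewrite -(ler_pM2l C_gt0); apply: le_trans h3.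
by rewrite -/d le_eqVlt; apply/orP; left; apply/eqP; field; rewrite gt_eqF.
Qed.

Lemma region_dynamical_degree x : U x -> dynamical_degree R f = lambda.
Proof.
move=> /region_growth /(degree_growth_ge uu f_int) [c c0 hc].
apply: dynamical_degree_eq => //; first exact: lt_trans lambda_gt1.
exists c => // n; apply: le_trans (hc n) _.
by rewrite /degree_seq -map_affine_iter map_degree_map_affine.
Qed.

Lemma region_arith_degree x : U x -> has_arith_degree iota h f (map_mx psi x) lambda.
Proof.
move=> /region_growth [c c0 hc]; apply: (arith_degree_eq h_ample h_ge1 tower) => //.
exists ((\dim {:F})%:R^-1 * c).
  by rewrite mulr_gt0 // invr_gt0 ltr0n adim_gt0.
move=> n; rewrite -mulrA; apply: le_trans _ (affine_height_ge _ u_place).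
by apply: ler_wpM2l; rewrite ?invr_ge0 ?ler0n.
Qed.

Definition orbits_meet (x y : 'rV[F]_2) := exists i j : nat,
  iter i (self_eval fF) x = iter j (self_eval fF) y.

Lemma orbits_meetC x y : orbits_meet x y -> orbits_meet y x.
Proof. by case=> i [j e]; exists j, i. Qed.

(** Both orbits are moved on until [x] has made [m * i] steps, which is at least [i]. The steps of
    [y] are then divided by [m]; the remainder [r] is the origin of the [m] classes. *)
Lemma orbits_meet_sync x y : orbits_meet x y -> exists (a b : nat) (r : 'I_m),
  iter (m * a) (self_eval fF) x = iter (m * b) (self_eval fF) (iter r (self_eval fF) y).
Proof.
case=> i [j e]; have ma : (i <= m * i)%N by rewrite leq_pmull.
pose j' := (m * i - i + j)%N.
exists i, (j' %/ m)%N, (Ordinal (ltn_pmod j' m_gt0)) => /=.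
by rewrite -iterD [(m * (j' %/ m))%N]mulnC -divn_eq /j' -{1}(subnK ma) !iterD e.
Qed.

(** Two points meeting the orbit of the same [w] along multiples of [m] have values of [G] whose
    ratio is an integral power of [d], so the ratio cannot lie strictly between 1 and [d]. *)
Lemma same_class x x' w a b a' b' : U x -> U x' ->
  iter (m * a) (self_eval fF) x = iter (m * b) (self_eval fF) w ->
  iter (m * a') (self_eval fF) x' = iter (m * b') (self_eval fF) w ->
  ~ (G x < G x' < d * G x).
Proof.
move=> Ux Ux' h1 h2 /andP[l1 l2].
have e : d ^+ (b' + a) * G x = d ^+ (b + a') * G x'.
  have [_ <-] := region_iter (b' + a) Ux; have [_ <-] := region_iter (b + a') Ux'.
  by rewrite !mulnDr !iterD h1 h2 -!iterD addnC.
have /andP[Gx _] := U_bound Ux.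
have dn n : 0 < d ^+ n by rewrite exprn_gt0.
have [hab|hab] := leqP (b' + a) (b + a').
  have : d ^+ (b' + a) * G x < d ^+ (b + a') * G x'.
    apply: (@lt_le_trans _ _ (d ^+ (b' + a) * G x')); first by rewrite ltr_pM2l.
    by rewrite ler_pM2r ?(lt_trans Gx) // ler_weXn2l // ltW.
  by rewrite e ltxx.
have : d ^+ (b + a') * G x' < d ^+ (b' + a) * G x.
  apply: (@lt_le_trans _ _ (d ^+ (b + a').+1 * G x)).
    by rewrite exprSr -mulrA ltr_pM2l.
  by rewrite ler_pM2r // ler_weXn2l // ltW.
by rewrite e ltxx.
Qed.

(** By the pigeonhole principle: far out, [k + 1] consecutive points of the line have values of [G]
    within a factor less than [d], and only [k = size l * m] pairs of a [y] and a remainder are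
    available. *)
Lemma avoid_orbits s (l : seq 'rV[F]_2) : (0 < s)%N ->
  exists n, U (pt n s) /\ forall y, y \in l -> ~ orbits_meet (pt n s) y.
Proof.
move=> s0; have [n0 hn0] := pt_U s0.
pose k := (size l * m)%N.
have [n1 n1n0 hn1] : exists2 n1, (n0 <= n1)%N &
    kappa * (n1 + k)%:R + beta s < d * (kappa * n1%:R + beta s).
  (* [B] is the solution in [n] of [kappa * (n + k) + beta s = d * (kappa * n + beta s)]. *)
  pose B := (kappa * k%:R + (1 - d) * beta s) / ((d - 1) * kappa).
  have dk : 0 < (d - 1) * kappa by rewrite mulr_gt0 // subr_gt0.
  pose nB : nat := Num.bound (Num.max B 0).
  exists (n0 + nB)%N; first exact: leq_addr.
  have hB : B < (n0 + nB)%:R.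
    apply: (@le_lt_trans _ _ (Num.max B 0)); first by rewrite le_max lexx.
    apply: lt_le_trans (archi_boundP _) _; first by rewrite le_max lexx orbT.
    by rewrite ler_nat leq_addl.
  move: hB; rewrite /B ltr_pdivrMr // (natrD _ (n0 + nB) k).
  move: (k%:R) ((n0 + nB)%:R) => y z hz; nra.
apply: contrapT => H.
have bad (i : 'I_k.+1) : exists q : 'I_(size l) * 'I_m, exists a b : nat,
    iter (m * a) (self_eval fF) (pt (n1 + i) s) =
    iter (m * b) (self_eval fF) (iter q.2 (self_eval fF) (tnth (in_tuple l) q.1)).
  apply: contrapT => h2; apply: H; exists (n1 + i)%N; split.
    by have [] := hn0 (n1 + i)%N (leq_trans n1n0 (leq_addr _ _)).
  move=> y yl /orbits_meet_sync [a [b [r e]]].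
  have jl : (index y l < size l)%N by rewrite index_mem.
  by apply: h2; exists (Ordinal jl, r), a, b; rewrite /= (tnth_nth 0) /= nth_index.
have {bad} /choice [q hq] := bad.
have : ~~ injectiveb q.
  apply/negP => /injectiveP /leq_card.
  by rewrite card_prod !card_ord -/k ltnn.
move=> /injectivePn [i [i' ii' e]].
wlog lii' : i i' ii' e / (i < i')%N.
  move=> W; have := ii'; rewrite -(inj_eq val_inj) neq_ltn => /orP[l1|l1].
    exact: (W i i').
  by apply: (W i' i) => //; rewrite eq_sym.
have [a [b h1]] := hq i; have [a' [b' h2]] := hq i'.
rewrite -e in h2.
have [U1 G1] := hn0 (n1 + i)%N (leq_trans n1n0 (leq_addr _ _)).
have [U2 G2] := hn0 (n1 + i')%N (leq_trans n1n0 (leq_addr _ _)).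
apply: (same_class U1 U2 h1 h2); rewrite G1 G2; apply/andP; split.
  by rewrite ltrD2r ltr_pM2l // ltr_nat ltn_add2l.
apply: (@le_lt_trans _ _ (kappa * (n1 + k)%:R + beta s)).
  by rewrite lerD2r ler_pM2l // ler_nat leq_add2l -ltnS.
apply: lt_le_trans hn1 _; rewrite ler_pM2l // lerD2r ler_pM2l // ler_nat.
exact: leq_addr.
Qed.

(** Vanishing spreads in three moves: along each line through 0 indexed by [s]; then, with the
    coefficient [a] of [v1] fixed, across these lines in the direction [v2]; finally along [v1],
    which also reaches the points where the coefficient of [v1] is 0. *)
Lemma dense_points (A : nat -> nat -> nat) : (forall s, injective (A s)) ->
  zariski_dense (map_mx psi @` [set x | exists s t, x = pt (A s t) s.+1]).
Proof.
move=> A_inj Z [I ->] hS; apply/seteqP; split=> // y _ p Ip.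
have vanish s t : meval (fun j => (map_mx psi (pt (A s t) s.+1)) ord0 j) p = 0.
  by apply: (hS (map_mx psi (pt (A s t) s.+1))) => //; exists (pt (A s t) s.+1) => //; exists s, t.
pose c := psi pi; pose v1 := map_mx psi e1; pose v2 := map_mx psi e2.
have c0 : c != 0 by rewrite fmorph_eq0.
have c_inj : injective (fun n : nat => c ^+ n).
  by move=> i j; rewrite -!rmorphXn => /fmorph_inj /pi_inj.
have ptE n s : map_mx psi (pt n s) = c ^- n *: (v1 + c ^+ s *: v2).
  by rewrite /pt map_mxZ map_mxD map_mxZ fmorphV !rmorphXn.
have step1 s a : meval (fun j => (0 + a *: (v1 + c ^+ s.+1 *: v2)) ord0 j) p = 0.
  apply: (line_vanish (t := fun t => c ^- (A s t))) => [i j /invr_inj /c_inj /A_inj //|t].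
  by rewrite add0r -ptE.
have step2 a b : meval (fun j => (a *: v1 + b *: (a *: v2)) ord0 j) p = 0.
  apply: (line_vanish (t := fun s => c ^+ s.+1)) => [i j /c_inj []//|s].
  by have := step1 s a; rewrite add0r scalerDr !scalerA mulrC.
have [a [b ->]] := e_span y.
rewrite -/v1 -/v2 addrC.
apply: (line_vanish (t := fun n => c ^+ n)) => // n.
have cn : c ^+ n != 0 by rewrite expf_neq0.
have := step2 (c ^+ n) (b / c ^+ n); rewrite scalerA divfK // addrC.
by [].
Qed.

Lemma region_densely_many : densely_many_max_arith_degree iota h f psi.
Proof.
have [a [haA ha]] := independent_family
  (A := fun s => [set x | exists2 n, U (pt n s.+1) & x = pt n s.+1]) orbits_meetC
  (fun s l => let: ex_intro n (conj Un hn) := avoid_orbits l (ltn0Sn s) in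
     ex_intro _ (pt n s.+1) (conj (ex_intro2 _ _ n Un erefl) hn)).
have /choice [A hA] : forall st : nat * nat, exists n, U (pt n st.1.+1) /\ a st.1 st.2 = pt n st.1.+1.
  by move=> [s t]; have [n Un e] := haA s t; exists n.
(* Every orbit meets itself, so distinct indices already give distinct points. *)
have a_inj s t s' t' : a s t = a s' t' -> (s, t) = (s', t').
  move=> e; apply/eqP; apply: contrapT => /negP h1; apply: (ha _ _ _ _ h1).
  by exists 0%N, 0%N; rewrite e.
exists [set x | exists s t, x = pt (A (s, t)) s.+1]; split.
- apply: dense_points => s t t' e.
  have [_ e1'] := hA (s, t); have [_ e2'] := hA (s, t').
  have : a s t = a s t' by rewrite e1' e2' /= e.
  by move=> /a_inj [].
- move=> x [s [t ->]]; have [Ux _] := hA (s, t).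
  by rewrite (region_dynamical_degree Ux); apply: region_arith_degree.
- move=> x y [s [t ->]] [s' [t' ->]] xy.
  have [_ e] := hA (s, t); have [_ e'] := hA (s', t'); rewrite /= in e e'.
  apply/seteqP; split=> // z [[i ->] [j]].
  rewrite !(iter_map_eval tower) => /map_mx_inj e2'.
  apply: (ha s t s' t'); last by exists i, j; rewrite e e'.
  apply/eqP => -[es et]; apply: xy; by rewrite es et.
Qed.

End InvariantRegion.

(** * Plane maps in linear coordinates *)

Definition o1 : 'I_2 := lift ord0 ord0.

Lemma ord2P (i : 'I_2) : i = ord0 \/ i = o1.
Proof. by case: i => [[|[|]]] //= h; [left|right]; apply/val_inj. Qed.

Lemma big_ord2 (T : Type) (idx : T) (op : Monoid.law idx) (E : 'I_2 -> T) :
  \big[op/idx]_(i < 2) E i = op (E ord0) (E o1).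
Proof. by rewrite !big_ord_recl big_ord0 Monoid.mulm1. Qed.

Definition pair_tuple (T : Type) (a b : T) : 2.-tuple T :=
  [tuple if i == ord0 then a else b | i < 2].

Lemma pair_tuple0 (T : Type) (a b : T) : tnth (pair_tuple a b) ord0 = a.
Proof. by rewrite tnth_mktuple. Qed.

Lemma pair_tuple1 (T : Type) (a b : T) : tnth (pair_tuple a b) o1 = b.
Proof. by rewrite tnth_mktuple. Qed.

Definition mon (a b : nat) : multinom 2 := Multinom (pair_tuple a b).

Lemma mon0 a b : mon a b ord0 = a. Proof. exact: pair_tuple0. Qed.
Lemma mon1 a b : mon a b o1 = b. Proof. exact: pair_tuple1. Qed.

Lemma monE (m : multinom 2) : m = mon (m ord0) (m o1).
Proof. by apply/mnmP => i; case: (ord2P i) => ->; rewrite ?mon0 ?mon1. Qed.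

Lemma mdeg_mon a b : mdeg (mon a b) = (a + b)%N.
Proof. by rewrite mdegE big_ord2 mon0 mon1. Qed.

Lemma mdeg2E (m : multinom 2) : mdeg m = (m ord0 + m o1)%N.
Proof. by rewrite {1}[m]monE mdeg_mon. Qed.

Section LinearPlaneMap.
Variable K : fieldType.
Implicit Types a b c d : K.

Definition lin2 a b c d : affine_map K 2 :=
  pair_tuple (a *: mpolyX K (mnm1 ord0) + b *: mpolyX K (mnm1 o1))
             (c *: mpolyX K (mnm1 ord0) + d *: mpolyX K (mnm1 o1)).

Lemma lin2_comp a b c d a' b' c' d' :
  affine_comp (lin2 a b c d) (lin2 a' b' c' d') =
  lin2 (a * a' + b * c') (a * b' + b * d') (c * a' + d * c') (c * b' + d * d').
Proof.
apply: eq_from_tnth => i; rewrite tnth_mktuple.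
case: (ord2P i) => ->; rewrite ?pair_tuple0 ?pair_tuple1 comp_mpolyD !comp_mpolyZ
  !comp_mpolyXU -!tnth_nth ?pair_tuple0 ?pair_tuple1;
  by rewrite !scalerDr !scalerA addrACA -!scalerDl.
Qed.

Lemma lin2_id : lin2 1 0 0 1 = affine_id K 2.
Proof.
apply: eq_from_tnth => i; rewrite [RHS]tnth_mktuple.
by case: (ord2P i) => ->; rewrite ?pair_tuple0 ?pair_tuple1 !scale1r !scale0r ?addr0 ?add0r.
Qed.

Lemma self_eval_lin2 a b c d (x : 'rV[K]_2) :
  (self_eval (lin2 a b c d) x ord0 ord0 = a * x ord0 ord0 + b * x ord0 o1) *
  (self_eval (lin2 a b c d) x ord0 o1 = c * x ord0 ord0 + d * x ord0 o1).
Proof. by split; rewrite mxE ?pair_tuple0 ?pair_tuple1 mevalD !mevalZ !mevalXU. Qed.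

Lemma deg_le_lin2 (R : numDomainType) a b c d i : deg_le (1 : R) (tnth (lin2 a b c d) i).
Proof.
have h x y : deg_le (1 : R) (x *: mpolyX K (mnm1 ord0) + y *: mpolyX K (mnm1 o1)).
  move=> m /msuppD_le; rewrite mem_cat => /orP[] /msuppZ_le;
  by rewrite msuppX inE => /eqP ->; rewrite mdeg1.
by case: (ord2P i) => ->; rewrite ?pair_tuple0 ?pair_tuple1; apply: h.
Qed.

End LinearPlaneMap.

(** * Dominant monomials *)

Section DominantMonomial.
Variables (R : realType) (K : fieldType) (u : K -> R).
Hypothesis uu : ultrametric_abs u.
Implicit Types (p : mpoly 2 K) (z : 'rV[K]_2).

Lemma meval2E p z : meval (fun j => z ord0 j) p =
  \sum_(m <- msupp p) mcoeff m p * (z ord0 ord0 ^+ m ord0 * z ord0 o1 ^+ m o1).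
Proof. by rewrite mevalE; apply: eq_bigr => m _; rewrite big_ord2. Qed.

Lemma eval_dominant p z (a b : nat) : integral_coefs u p ->
  u (mcoeff (mon a b) p) = 1 ->
  0 < u (z ord0 ord0) ^+ a * u (z ord0 o1) ^+ b ->
  (forall m, m \in msupp p -> m != mon a b ->
     u (z ord0 ord0) ^+ m ord0 * u (z ord0 o1) ^+ m o1
       < u (z ord0 ord0) ^+ a * u (z ord0 o1) ^+ b) ->
  u (meval (fun j => z ord0 j) p) = u (z ord0 ord0) ^+ a * u (z ord0 o1) ^+ b.
Proof.
move=> hp hab pos hdom.
have mab : mon a b \in msupp p by rewrite mcoeff_msupp -(uabs_gt0 uu) hab.
rewrite meval2E (bigD1_seq (mon a b)) ?msupp_uniq //= mon0 mon1.
have e : u (mcoeff (mon a b) p * (z ord0 ord0 ^+ a * z ord0 o1 ^+ b))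
    = u (z ord0 ord0) ^+ a * u (z ord0 o1) ^+ b.
  by rewrite (uabsM uu) hab mul1r (uabsM uu) !(uabsX uu).
rewrite (uabs_dom uu) e // big_seq_cond; apply: (uabs_sum_lt uu) => // m /andP[hm mm].
rewrite (uabsM uu) (uabsM uu) !(uabsX uu).
apply: le_lt_trans (hdom m hm mm).
by rewrite ler_piMl ?mulr_ge0 ?exprn_ge0 ?(uabs_ge0 uu).
Qed.

Lemma eval_dominant_le p z (B : R) : integral_coefs u p -> 0 < B ->
  (forall m, m \in msupp p ->
     u (z ord0 ord0) ^+ m ord0 * u (z ord0 o1) ^+ m o1 < B) ->
  u (meval (fun j => z ord0 j) p) < B.
Proof.
move=> hp B0 hdom; rewrite meval2E big_seq; apply: (uabs_sum_lt uu) => // m hm.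
rewrite (uabsM uu) (uabsM uu) !(uabsX uu); apply: le_lt_trans (hdom m hm).
by rewrite ler_piMl ?mulr_ge0 ?exprn_ge0 ?(uabs_ge0 uu).
Qed.

End DominantMonomial.

(* [(a, b)] and [(a', b')] are the dominant exponents of the two coordinates on
   the region [Rg] of values [(ln |X|, ln |Y|)], and [gX A + gY B] is an
   eigenfunctional of the induced linear map, with eigenvalue [d]. *)
Definition monomial_type (R : realType) (K : fieldType) (d : R) (g : affine_map K 2) : Prop :=
  exists (a b a' b' : nat) (Rg : R -> R -> Prop) (gX gY C : R),
  [/\ (mon a b \in msupp (tnth g ord0)) && (mon a' b' \in msupp (tnth g o1)),
      forall A B, Rg A B -> [/\
        forall m, m \in msupp (tnth g ord0) -> m != mon a b ->
          (m ord0)%:R * A + (m o1)%:R * B < a%:R * A + b%:R * B,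
        forall m, m \in msupp (tnth g o1) -> m != mon a' b' ->
          (m ord0)%:R * A + (m o1)%:R * B < a'%:R * A + b'%:R * B,
        Rg (a%:R * A + b%:R * B) (a'%:R * A + b'%:R * B)
      & 0 < gX * A + gY * B <= C * A],
      forall A B, gX * (a%:R * A + b%:R * B) + gY * (a'%:R * A + b'%:R * B)
        = d * (gX * A + gY * B),
      forall (tau : R) (s : nat), 0 < tau -> (0 < s)%N -> exists n0, forall n, (n0 <= n)%N ->
        Rg (n%:R * tau) ((n%:R - s%:R) * tau)
    & (0 < gX + gY) && (0 < C)].

(* The point of [P^1] at infinity [Y = 0] is superattracting. *)
Definition superattracting_type (K : fieldType) (d : nat) (g : affine_map K 2) : Prop :=
  [/\ mon d 0 \in msupp (tnth g ord0),
      forall m, m \in msupp (tnth g ord0) -> (mdeg m <= d)%N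
    & forall m, m \in msupp (tnth g o1) -> (mdeg m < d)%N].

Section InvariantRegions.
Variables (R : realType) (K : fieldType) (u : K -> R).
Hypothesis uu : ultrametric_abs u.

(** The input of [region_densely_many] expressed in the adapted coordinates. With [tau = ln p], the
    prescribed sizes are those of [p^-n] and [p^(s-n)]. *)
Definition good_region (d tau : R) (g : affine_map K 2) (U : 'rV[K]_2 -> Prop) (G : 'rV[K]_2 -> R)
    (C kappa : R) (beta : nat -> R) : Prop :=
  [/\ 0 < C, 0 < kappa,
      forall z, U z -> U (self_eval g z) /\ G (self_eval g z) = d * G z,
      forall z, U z -> 0 < G z <= C * ln (max_norm u z)
    & forall s, (0 < s)%N -> exists n0, forall n (z : 'rV[K]_2), (n0 <= n)%N ->
        u (z ord0 ord0) = expR (n%:R * tau) ->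
        u (z ord0 o1) = expR ((n%:R - s%:R) * tau) ->
        U z /\ G z = kappa * n%:R + beta s].

Variables (g : affine_map K 2) (tau : R).
Hypotheses (g_unit : forall i m, m \in msupp (tnth g i) -> u (mcoeff m (tnth g i)) = 1)
  (tau_gt0 : 0 < tau).

Lemma unit_coefs_integral i : integral_coefs u (tnth g i).
Proof.
move=> m; have [/g_unit -> //|h] := boolP (m \in msupp (tnth g i)).
by rewrite memN_msupp_eq0 // (uabs0 uu).
Qed.

Let expM (x y : R) (a b : nat) : 0 < x -> 0 < y ->
  x ^+ a * y ^+ b = expR (a%:R * ln x + b%:R * ln y).
Proof. by move=> x0 y0; rewrite expRD !expRM_natl !lnK ?posrE. Qed.

Lemma ln_max_norm_ge (z : 'rV[K]_2) i : 0 < u (z ord0 i) ->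
  ln (u (z ord0 i)) <= ln (max_norm u z).
Proof.
by move=> h; rewrite ler_ln ?posrE ?max_norm_gt0 ?(uabs1 uu) ?max_norm_ge.
Qed.

Lemma monomial_region (d : R) : monomial_type d g -> exists U G C kappa beta,
  good_region d tau g U G C kappa beta.
Proof.
move=> [a [b [a' [b' [Rg [gX [gY [C [/andP[hab hab'] hRg heig hpt /andP[gXY C0]]]]]]]]]].
pose A (z : 'rV[K]_2) := ln (u (z ord0 ord0)).
pose B (z : 'rV[K]_2) := ln (u (z ord0 o1)).
exists (fun z : 'rV[K]_2 => [/\ 0 < u (z ord0 ord0), 0 < u (z ord0 o1) & Rg (A z) (B z)]).
(* [kappa] and [beta] come from expanding [gX * (n * tau) + gY * ((n - s) * tau)]. *)
exists (fun z : 'rV[K]_2 => gX * A z + gY * B z), C, ((gX + gY) * tau), (fun s => - (gY * s%:R * tau)).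
split=> //; first by rewrite mulr_gt0.
- move=> z [z0 z1 /hRg [h1 h2 h3 _]].
  have e0 : u (self_eval g z ord0 ord0) = u (z ord0 ord0) ^+ a * u (z ord0 o1) ^+ b.
    rewrite mxE; apply: (eval_dominant uu); rewrite ?g_unit //.
    - exact: unit_coefs_integral.
    - by rewrite mulr_gt0 ?exprn_gt0.
    - by move=> m hm mm; rewrite !expM // ltr_expR; apply: h1.
  have e1 : u (self_eval g z ord0 o1) = u (z ord0 ord0) ^+ a' * u (z ord0 o1) ^+ b'.
    rewrite mxE; apply: (eval_dominant uu); rewrite ?g_unit //.
    - exact: unit_coefs_integral.
    - by rewrite mulr_gt0 ?exprn_gt0.
    - by move=> m hm mm; rewrite !expM // ltr_expR; apply: h2.
  have eA : A (self_eval g z) = a%:R * A z + b%:R * B z by rewrite /A e0 expM // expRK.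
  have eB : B (self_eval g z) = a'%:R * A z + b'%:R * B z by rewrite /B e1 expM // expRK.
  rewrite eA eB heig e0 e1; split=> //; split=> //; by rewrite mulr_gt0 ?exprn_gt0.
- move=> z [z0 z1 /hRg [_ _ _ /andP[h1 h2]]]; rewrite h1 /=.
  by apply: le_trans h2 _; rewrite ler_pM2l // ln_max_norm_ge.
- move=> s s0; have [n0 hn0] := hpt tau s tau_gt0 s0; exists n0 => n z hn e0 e1.
  rewrite /A /B e0 e1 !expRK !expR_gt0; split; first by split=> //; apply: hn0.
  ring.
Qed.

(** For [|Y| < |X|] and [|X| > 1] the monomial [X^d] strictly dominates the first coordinate and
    exceeds the second, so [ln |X|] alone is an eigenfunctional. The second coordinate is only
    bounded from above, since it may vanish. *)
Lemma superattracting_region (d : nat) : (0 < d)%N -> superattracting_type d g ->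
  exists U G C kappa beta, good_region d%:R tau g U G C kappa beta.
Proof.
move=> d0 [hd hP hQ].
pose x (z : 'rV[K]_2) := u (z ord0 ord0); pose y (z : 'rV[K]_2) := u (z ord0 o1).
exists (fun z : 'rV[K]_2 => 1 < x z /\ y z < x z), (fun z : 'rV[K]_2 => ln (x z)), 1, tau, (fun=> 0).
have y0 z : 0 <= y z by apply: uabs_ge0.
have mono z m (e : nat) : 1 < x z -> y z < x z -> (mdeg m <= e)%N ->
    x z ^+ m ord0 * y z ^+ m o1 <= x z ^+ e.
  move=> z1 z2; have x0 : 0 <= x z by apply: uabs_ge0.
  rewrite mdeg2E => hm; apply: (@le_trans _ _ (x z ^+ m ord0 * x z ^+ m o1)).
    by apply: ler_wpM2l; rewrite ?exprn_ge0 // lerXn2r ?nnegrE // ltW.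
  by rewrite -exprD ler_weXn2l // ltW.
split=> //.
- move=> z [z1 z2]; have x0 : 0 < x z := lt_trans ltr01 z1.
  have e0 : x (self_eval g z) = x z ^+ d.
    rewrite /x mxE (eval_dominant uu (a := d) (b := 0)) ?expr0 ?mulr1 ?g_unit //.
    - exact: unit_coefs_integral.
    - by rewrite exprn_gt0.
    - move=> m hm mm; have := hP m hm; rewrite leq_eqVlt => /orP[/eqP e|lt].
        rewrite -/(x z) -/(y z).
        have m1 : (0 < m o1)%N.
          rewrite lt0n; apply: contra mm => /eqP m1; apply/eqP.
          by rewrite [m]monE m1 -e mdeg2E m1 addn0.
        rewrite -e mdeg2E exprD ltr_pM2l ?exprn_gt0 // ltrXn2r ?nnegrE ?(ltW x0) //.
        by rewrite -lt0n.
      have d1 : (mdeg m <= d.-1)%N by rewrite -ltnS prednK.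
      apply: le_lt_trans (mono z m _ z1 z2 d1) _.
      by rewrite ltr_eXn2l // prednK.
  have e1 : y (self_eval g z) < x z ^+ d.
    rewrite /y mxE; apply: (eval_dominant_le uu).
    - exact: unit_coefs_integral.
    - by rewrite exprn_gt0.
    - move=> m /hQ lt; have d1 : (mdeg m <= d.-1)%N by rewrite -ltnS prednK.
      apply: le_lt_trans (mono z m _ z1 z2 d1) _.
      by rewrite ltr_eXn2l // prednK.
  rewrite e0; split; last by rewrite lnXn // mulr_natl.
  by split=> //; rewrite exprn_egt1 // -lt0n.
- move=> z [z1 _]; rewrite ln_gt0 //= mul1r ln_max_norm_ge //.
  exact: lt_trans z1.
- move=> s s0; exists 1%N => n z n0 e0 e1; rewrite /x /y e0 e1 expRK addr0.
  split; last exact: mulrC.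
  rewrite expR_gt1 ltr_expR ltr_pM2r // mulr_gt0 ?ltr0n //; split=> //.
  by rewrite ltrBlDr ltrDl ltr0n.
Qed.

End InvariantRegions.

(** * Linear changes of coordinates *)

Section Coordinates.
Variables (F : fieldType) (a b c d a' b' c' d' : F).
Hypotheses (MM' : [/\ a * a' + b * c' = 1, a * b' + b * d' = 0,
                      c * a' + d * c' = 0 & c * b' + d * d' = 1])
           (M'M : [/\ a' * a + b' * c = 1, a' * b + b' * d = 0,
                      c' * a + d' * c = 0 & c' * b + d' * d = 1]).
Let l := lin2 a b c d.
Let l' := lin2 a' b' c' d'.

Definition conj_map (g : affine_map F 2) : affine_map F 2 :=
  affine_comp l (affine_comp g l').

Lemma lin2_invl : affine_comp l l' = affine_id F 2.
Proof. by rewrite lin2_comp; case: MM' => -> -> -> ->; apply: lin2_id. Qed.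

Lemma lin2_invr : affine_comp l' l = affine_id F 2.
Proof. by rewrite lin2_comp; case: M'M => -> -> -> ->; apply: lin2_id. Qed.

Lemma conj_map_comp g : affine_comp (conj_map g) l = affine_comp l g.
Proof. by rewrite /conj_map !affine_compA lin2_invr affine_comp1. Qed.

Lemma conj_map_square g :
  affine_comp l' (affine_comp (affine_comp (conj_map g) (conj_map g)) l) = affine_comp g g.
Proof.
rewrite (affine_compA (conj_map g)) conj_map_comp -(affine_compA (conj_map g)) conj_map_comp.
by rewrite (affine_compA l) -(affine_compA l') lin2_invr affine_comp1l.
Qed.

Lemma conj_map_eval g x : self_eval (conj_map g) (self_eval l x) = self_eval l (self_eval g x).
Proof. by rewrite -!self_eval_comp conj_map_comp. Qed.

(** With weights [w0], [w1] on the two coordinates, one application of the conjugated map multiplies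
    weighted degrees by at most [lambda]; returning to the original coordinates costs only a
    constant. *)
Lemma conj_deg_growth (R : realType) (g : affine_map F 2) (w0 w1 lambda : R) :
  0 < w0 -> 0 < w1 -> 0 < lambda ->
  (forall m, m \in msupp (tnth (conj_map g) ord0) ->
     (m ord0)%:R * w0 + (m o1)%:R * w1 <= lambda * w0) ->
  (forall m, m \in msupp (tnth (conj_map g) o1) ->
     (m ord0)%:R * w0 + (m o1)%:R * w1 <= lambda * w1) ->
  exists C : R, forall n, degree_seq R g n <= C * lambda ^+ n.
Proof.
move=> w00 w10 l0 hP hQ.
pose w (i : 'I_2) := if i == ord0 then w0 else w1.
have w_gt0 i : 0 < w i by rewrite /w; case: ifP.
(* Chosen so that [C * w i >= 1], the start of the induction, where the coordinates are linear
   forms. *)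
pose C := w0^-1 + w1^-1.
have C0 : 0 < C by rewrite addr_gt0 ?invr_gt0.
have Cw i : 1 <= C * w i.
  rewrite /C mulrDl; case: (ord2P i) => ->; rewrite /w /= mulVf ?gt_eqF //.
    by rewrite lerDl mulr_ge0 ?invr_ge0 ?ltW.
  by rewrite lerDr mulr_ge0 ?invr_ge0 ?ltW.
have ln n : 0 < lambda ^+ n by rewrite exprn_gt0.
have hX n i : deg_le (C * lambda ^+ n * w i) (tnth (affine_comp l (affine_iter g n)) i).
  elim: n i => [|n IH] i.
    rewrite affine_comp1 expr0 mulr1.
    by apply: deg_leW (Cw i) _; apply: deg_le_lin2.
  have -> : affine_comp l (affine_iter g n.+1) =
      affine_comp (conj_map g) (affine_comp l (affine_iter g n)).
    by rewrite -affine_compA conj_map_comp affine_compA.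
  rewrite tnth_mktuple; apply: (deg_le_comp (E := fun i => C * lambda ^+ n * w i)) => // m hm.
  rewrite big_ord2 /= !(mulrCA _ (C * _)) -mulrDr exprS.
  rewrite (_ : C * (lambda * lambda ^+ n) * w i = C * lambda ^+ n * (lambda * w i)); last by ring.
  by apply: ler_wpM2l; [rewrite ltW // mulr_gt0|move: hm; case: (ord2P i) => ->; [exact: hP|exact: hQ]].
exists (C * (w0 + w1)) => n.
have -> : degree_seq R g n = (map_degree (affine_comp l' (affine_comp l (affine_iter g n))))%:R.
  by rewrite -affine_compA lin2_invr affine_comp1l.
have E0 : 0 <= C * (w0 + w1) * lambda ^+ n.
  by apply: ltW; rewrite mulr_gt0 // mulr_gt0 // addr_gt0.
apply: map_degree_le => // i; rewrite tnth_mktuple.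
apply: (deg_le_comp (E := fun i => C * lambda ^+ n * w i)) => [m /deg_le_lin2 hm|j]; last exact: hX.
have {}hm : (mdeg m)%:R <= 1 :> R := hm R.
have hw j : C * lambda ^+ n * w j <= C * (w0 + w1) * lambda ^+ n.
  rewrite mulrAC; apply: ler_wpM2r; first exact: ltW.
  apply: ler_wpM2l; first exact: ltW.
  by rewrite /w; case: ifP => _; rewrite ?lerDl ?lerDr ltW.
apply: (@le_trans _ _ ((mdeg m)%:R * (C * (w0 + w1) * lambda ^+ n))).
  by rewrite mdeg2E natrD [leRHS]mulrDl big_ord2; apply: lerD; apply: ler_wpM2l.
by rewrite ler_piMl.
Qed.

End Coordinates.

Section DenselyManyCoordinates.
Variables (R : realType) (K : fieldType) (Kbar : closedFieldType)
  (iota : {rmorphism K -> Kbar}) (h : proj_space Kbar 2 -> R).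
Hypotheses (h_ample : ample_height h) (h_ge1 : forall P, 1 <= h P).
Variables (F : fieldExtType rat) (phi : {rmorphism K -> F}) (psi : {rmorphism F -> Kbar}).
Hypothesis tower : forall x, psi (phi x) = iota x.
Variables (f : affine_map K 2) (m : nat) (lambda : R).
Hypotheses (m_gt0 : (0 < m)%N) (lambda_gt1 : 1 < lambda)
  (deg_growth : growth_le lambda (degree_seq R f)).
Variables (a b c d a' b' c' d' : F).
Hypotheses (MM' : [/\ a * a' + b * c' = 1, a * b' + b * d' = 0,
                      c * a' + d * c' = 0 & c * b' + d * d' = 1])
           (M'M : [/\ a' * a + b' * c = 1, a' * b + b' * d = 0,
                      c' * a + d' * c = 0 & c' * b + d' * d = 1]).
Let fF : affine_map F 2 := map_affine phi f.
Let g := conj_map a b c d a' b' c' d' (affine_iter fF m).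

(** The place depends on the coefficients, so regions are requested at every place where the nonzero
    coefficients of [g] are units. [split_place] then supplies one where those of [f] and the
    nonzero entries of the coordinate change are units too. *)
Lemma densely_many_of_good_region :
  (forall (u : F -> R) (tau : R), ultrametric_abs u ->
     (forall i k, k \in msupp (tnth g i) -> u (mcoeff k (tnth g i)) = 1) -> 0 < tau ->
     exists U G C kappa beta, good_region u (lambda ^+ m) tau g U G C kappa beta) ->
  densely_many_max_arith_degree iota h f psi.
Proof.
move=> hreg.
have [coefs in_coefs] : exists coefs : affine_map F 2 -> seq F,
    forall k i n, n \in msupp (tnth k i) -> mcoeff n (tnth k i) \in coefs k.
  exists (fun k => flatten [seq [seq mcoeff n (tnth k i) | n <- msupp (tnth k i)] | i <- enum 'I_2]).
  move=> k i n hn; apply/flattenP; eexists; first by apply: map_f; rewrite mem_enum.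
  exact: map_f.
have [theta gen] := primitive_generator F.
have [u [fu hu [p pp up]]] := split_place R gen ([:: a; b; c; d] ++ (coefs fF ++ coefs g)).
have uu := finite_place_abs fu.
have u_coef (k : affine_map F 2) i n : {subset coefs k <= [:: a; b; c; d] ++ (coefs fF ++ coefs g)} ->
    n \in msupp (tnth k i) -> u (mcoeff n (tnth k i)) = 1.
  by move=> sub hn; apply: hu; rewrite -?mcoeff_msupp //; apply: sub; apply: in_coefs.
have le1 x : x \in [:: a; b; c; d] -> u x <= 1.
  move=> hx; have [->|x0] := eqVneq x 0; first by rewrite (uabs0 uu).
  by rewrite hu // mem_cat hx.
have fF_int : integral_map u fF.
  apply: unit_coefs_integral => // i n; apply: u_coef => x.
  by rewrite !mem_cat => ->; rewrite orbT.
have g_unit i k : k \in msupp (tnth g i) -> u (mcoeff k (tnth g i)) = 1.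
  by apply: u_coef => x; rewrite !mem_cat => ->; rewrite !orbT.
pose tau : R := ln p%:R.
have p1 : 1 < p%:R :> R by rewrite ltr1n prime_gt1.
have p0 : 0 < p%:R :> R := lt_trans ltr01 p1.
have tau0 : 0 < tau by rewrite ln_gt0.
have [U [G [C [kappa [beta [C0 kappa0 hU hG hpt]]]]]] := hreg u tau uu g_unit tau0.
pose l := lin2 a b c d; pose l' := lin2 a' b' c' d'.
(* The columns of the inverse matrix: [l] sends [pi ^- n *: (e1 + pi ^+ s *: e2)] to the point with
   coordinates [pi^-n] and [pi^-n pi^s]. *)
pose e1 : 'rV[F]_2 := \row_i (if i == ord0 then a' else c').
pose e2 : 'rV[F]_2 := \row_i (if i == ord0 then b' else d').
pose pi : F := p%:R.
have pi0 : pi != 0 by rewrite -(uabs_gt0 uu) up invr_gt0.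
apply: (region_densely_many h_ample h_ge1 tower fu fF_int m_gt0 lambda_gt1 deg_growth
  (U := fun x => U (self_eval l x)) (G := fun x => G (self_eval l x)) C0 _ _
  (e1 := e1) (e2 := e2) (pi := pi) (kappa := kappa) (beta := beta)) => //.
- move=> x /hU; rewrite conj_map_eval // self_eval_iter => -[h1 h2]; split=> //.
(* The entries of [l] are integral at [u], so [l] does not increase [max_norm] and the bound on [G]
   passes to the original coordinates. *)
- move=> x /hG /andP[-> h1]; apply: le_trans h1 _; rewrite ler_pM2l //.
  rewrite ler_ln ?posrE ?max_norm_gt0 ?(uabs1 uu) //.
  apply: (max_norm_le (uabs1 uu)); first by rewrite max_norm_ge1 ?(uabs1 uu).
  have lin (x0 y0 : F) : u x0 <= 1 -> u y0 <= 1 ->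
      u (x0 * x ord0 ord0 + y0 * x ord0 o1) <= max_norm u x.
    move=> hx hy; apply: le_trans (uabsD uu _ _) _; rewrite ge_max !(uabsM uu).
    by rewrite !(le_trans (ler_piMl _ _) (max_norm_ge u x _)) ?(uabs_ge0 uu).
  by move=> i; case: (ord2P i) => ->; rewrite self_eval_lin2; apply: lin; apply: le1; rewrite !inE eqxx ?orbT.
- have up0 : 0 < u pi by rewrite (uabs_gt0 uu).
  move=> i j e; have := congr1 u e; rewrite !(uabsX uu); apply: ieexprIn => //.
  by rewrite up invr_eq1 gt_eqF.
- move=> y; exists (psi a * y ord0 ord0 + psi b * y ord0 o1), (psi c * y ord0 ord0 + psi d * y ord0 o1).
  case: M'M => q1 q2 q3 q4.
  apply/rowP => i; case: (ord2P i) => ->; rewrite !mxE /=.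
    transitivity (psi (a' * a + b' * c) * y ord0 ord0 + psi (a' * b + b' * d) * y ord0 o1).
      by rewrite q1 q2 rmorph1 rmorph0 mul1r mul0r addr0.
    by rewrite !rmorphD !rmorphM /=; ring.
  transitivity (psi (c' * a + d' * c) * y ord0 ord0 + psi (c' * b + d' * d) * y ord0 o1).
    by rewrite q3 q4 rmorph1 rmorph0 mul1r mul0r add0r.
  by rewrite !rmorphD !rmorphM /=; ring.
- move=> s s0; have [n0 hn0] := hpt s s0; exists n0 => n hn.
  pose z : 'rV[F]_2 := \row_i (if i == ord0 then pi ^- n else pi ^- n * pi ^+ s).
  have -> : pi ^- n *: (e1 + pi ^+ s *: e2) = self_eval l' z.
    by apply/rowP => i; case: (ord2P i) => ->; rewrite self_eval_lin2 !mxE /=; ring.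
  rewrite -self_eval_comp lin2_invl // -[affine_id _ _]/(affine_iter l 0) self_eval_iter.
  have u_exp (k : nat) : u pi ^+ k = expR (- (k%:R * tau)).
    by rewrite up exprVn expRN expRM_natl lnK.
  apply: hn0 => //.
    by rewrite mxE /= (uabsV uu) (uabsX uu) u_exp expRN invrK.
  by rewrite mxE /= (uabsM uu) (uabsV uu) !(uabsX uu) !u_exp -expRN opprK -expRD -mulrBl.
Qed.

End DenselyManyCoordinates.

(** * Normal forms at a fixed point at infinity *)

(* In degree [d], the second coordinate vanishes to higher order than the first
   one at the point [Y = 0] of the line at infinity. *)
Definition normal_top (K : fieldType) (d j : nat) (g : affine_map K 2) : Prop :=
  [/\ (j <= d)%N, mon (d - j) j \in msupp (tnth g ord0),
      forall i m, m \in msupp (tnth g i) -> (mdeg m <= d)%N,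
      forall m, m \in msupp (tnth g ord0) -> mdeg m = d -> (j <= m o1)%N
    & forall m, m \in msupp (tnth g o1) -> mdeg m = d -> (j < m o1)%N].

Section NormalTop.
Variables (R : realType) (K : fieldType) (d j : nat) (g : affine_map K 2).
Hypotheses (d2 : (1 < d)%N) (g_top : normal_top d j g).

Lemma mdeg2R (m : multinom 2) : (m ord0)%:R = (mdeg m)%:R - (m o1)%:R :> R.
Proof. by rewrite mdeg2E natrD addrK. Qed.

(** The logarithmic size of a monomial is [deg * A - (m o1) * (A - B)]. In degree [d], a higher
    power of [Y] loses a multiple of [A - B]. In lower degree at least [A] is lost, against a gain
    of at most [d * (A - B)], which is smaller than [A]. *)
Lemma dominated (i : nat) (m : multinom 2) (A B : R) : (i <= d)%N -> (mdeg m <= d)%N ->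
  (mdeg m = d -> (i <= m o1)%N) -> m != mon (d - i) i ->
  B < A -> d%:R * (A - B) < A ->
  (m ord0)%:R * A + (m o1)%:R * B < (d - i)%:R * A + i%:R * B.
Proof.
move=> id md mtop mm BA AB; rewrite mdeg2R natrB //.
have W0 : 0 < A - B by rewrite subr_gt0.
have [e|e] := eqVneq (mdeg m) d.
  have lt : (i < m o1)%N.
    rewrite ltn_neqAle mtop // andbT; apply: contra mm => /eqP im; apply/eqP.
    by rewrite [m]monE -im -e mdeg2E im addnK.
  have := mulr_gt0 (_ : 0 < (m o1)%:R - i%:R :> R) W0.
  by rewrite subr_gt0 ltr_nat lt e => /(_ isT); lra.
have lt : (mdeg m)%:R + 1 <= d%:R :> R.
  by rewrite natr1 ler_nat ltn_neqAle e.
have A0 : 0 < A by apply: le_lt_trans AB; rewrite mulr_ge0 // ltW.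
have h1 : 0 <= (d%:R - ((mdeg m)%:R + 1)) * A by rewrite mulr_ge0 ?subr_ge0 // ltW.
have h2 : 0 <= (m o1)%:R * (A - B) by rewrite mulr_ge0 // ltW.
have h3 : 0 <= (d%:R - i%:R) * (A - B) by rewrite mulr_ge0 ?subr_ge0 ?ler_nat // ltW.
lra.
Qed.

Lemma normal_top_monomial (m0 : multinom 2) :
  m0 \in msupp (tnth g o1) -> mdeg m0 = d -> monomial_type (d%:R : R) g.
Proof.
move=> hm0 dm0; have [jd hj hdeg hP hQ] := g_top.
(* The least exponent of [Y] in the top degree of the second coordinate will be [l]. *)
pose good l := (l <= d)%N && (mon (d - l) l \in msupp (tnth g o1)).
have ex_good (m : multinom 2) : m \in msupp (tnth g o1) -> mdeg m = d -> good (m o1).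
  move=> hm dm; rewrite /good; have := dm; rewrite mdeg2E => <-.
  by rewrite leq_addl addnK -monE hm.
have [l /andP[ld hl] l_min] := ex_minnP (ex_intro good _ (ex_good _ hm0 dm0)).
have jl : (j < l)%N by have := hQ _ hl; rewrite mdeg_mon subnK // mon1; apply.
(* The second condition is that of [dominated]. It persists because the gap [A - B] is multiplied by
   [l - j], with [0 < l - j <= d], while [A] becomes [d * A - j * (A - B)]. *)
pose Rg (A B : R) := B < A /\ d%:R * (A - B) < A.
have d1R : 1 <= d%:R :> R by rewrite ler1n ltnW.
have jdR : j%:R <= d%:R :> R by rewrite ler_nat.
have ldR : l%:R <= d%:R :> R by rewrite ler_nat.
have jlR : j%:R + 1 <= l%:R :> R by rewrite natr1 ler_nat.
have j0 : 0 <= j%:R :> R by [].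
(* The exponent matrix has rows [(d - j, j)] and [(d - l, l)], with left eigenvector [(d - l, j)]
   for the eigenvalue [d]. This vector is zero exactly when [l = d] and [j = 0]; the matrix is then
   [d] times the identity and [(1, 0)] serves. *)
have [gX [gY [g0 g0' gXY heig]]] : exists gX gY : R, [/\ 0 <= gX, 0 <= gY, 0 < gX + gY &
    forall A B, gX * ((d - j)%:R * A + j%:R * B) + gY * ((d - l)%:R * A + l%:R * B)
      = d%:R * (gX * A + gY * B)].
  rewrite !natrB //; have [/andP[/eqP -> /eqP ->]|h] := boolP ((l == d) && (j == 0%N)).
    by exists 1, 0; split=> //; rewrite ?addr0 // => A B; ring.
  exists (d%:R - l%:R), j%:R; split; rewrite ?subr_ge0 //; last by move=> A B; ring.
  have [jz|jz] := posnP j; last by rewrite ltr_wpDl ?subr_ge0 ?ltr0n.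
  rewrite jz addr0 subr_gt0 ltr_nat ltn_neqAle ld andbT.
  by move: h; rewrite jz eqxx andbT.
exists (d - j)%N, j, (d - l)%N, l, Rg, gX, gY, (gX + gY); split=> //.
- by rewrite hj hl.
- move=> A B [BA AB].
  have W0 : 0 < A - B by rewrite subr_gt0.
  have dW : A - B <= d%:R * (A - B) by rewrite ler_peMl // ltW.
  have B0 : 0 < B by lra.
  have A0 : 0 < A := lt_trans B0 BA.
  split.
  + by move=> m hm mm; apply: dominated => //; [exact: hdeg hm|exact: hP].
  + move=> m hm mm; apply: dominated => //; first exact: hdeg hm.
    move=> dm; apply: l_min; exact: ex_good.
  + rewrite /Rg !natrB //.
    have h1 : 0 < (l%:R - j%:R) * (A - B) by rewrite mulr_gt0 // subr_gt0 ltr_nat.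
    have h2 : 0 <= (d%:R - l%:R) * (d%:R * (A - B)).
      by rewrite mulr_ge0 ?subr_ge0 // mulr_ge0 // ltW.
    have h3 : 0 <= (d%:R - 1) * (j%:R * (A - B)).
      by rewrite mulr_ge0 ?subr_ge0 // mulr_ge0 // ltW.
    have h4 : d%:R * (d%:R * (A - B)) < d%:R * A by rewrite ltr_pM2l // (lt_le_trans ltr01).
    by split; lra.
  + apply/andP; split.
      have h1 : 0 <= gX * (A - B) by rewrite mulr_ge0 // ltW.
      have h2 : 0 < (gX + gY) * B by rewrite mulr_gt0.
      lra.
    have h1 : 0 <= gY * (A - B) by rewrite mulr_ge0 // ltW.
    lra.
- move=> tau s tau0 s0; exists (d * s).+1 => n hn; rewrite /Rg.
  have h1 : 0 < s%:R * tau by rewrite mulr_gt0 ?ltr0n.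
  have h2 : 0 < (n%:R - d%:R * s%:R) * tau by rewrite mulr_gt0 // subr_gt0 -natrM ltr_nat.
  by split; lra.
- by rewrite gXY.
Qed.

Hypothesis Q_low : forall m, m \in msupp (tnth g o1) -> (mdeg m < d)%N.

Lemma normal_top_superattracting : j = 0%N -> superattracting_type d g.
Proof.
move=> j0; have [_ hj hdeg _ _] := g_top; rewrite j0 subn0 in hj.
by split=> // m; apply: hdeg.
Qed.

(** In the composition, [X] is replaced by degree at most [d] and [Y] by degree at most [d - 1].
    Since [j > 0], every monomial of degree [d] contains [Y] and loses at least one degree. *)
Lemma normal_top_unstable : (0 < j)%N -> (map_degree (affine_comp g g) < d ^ 2)%N.
Proof.
move=> j0; have [jd hj hdeg hP _] := g_top.
have d1 : (0 < d)%N := ltnW d2.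
rewrite -(@prednK (d ^ 2)) ?expn_gt0 ?d1 // ltnS -(ler_nat int).
apply: map_degree_le => // i; rewrite tnth_mktuple.
apply: (deg_le_comp (E := fun i => if i == ord0 then d%:R else d.-1%:R)) => [m hm|i'].
  rewrite big_ord2 /= -!natrM -natrD ler_nat -ltnS prednK ?expn_gt0 ?d1 //.
  have : (mdeg m < d)%N \/ mdeg m = d /\ (0 < m o1)%N.
    have := hdeg i m hm; rewrite leq_eqVlt => /orP[/eqP e|]; last by left.
    case: (ord2P i) hm => -> hm; last by have := Q_low hm; rewrite e ltnn.
    by right; split=> //; apply: leq_trans (hP m hm e).
  rewrite mdeg2E; move: (m ord0) (m o1) d1 => x y.
  case: (d) => // k _ /=; rewrite -mulnn; nia.
case: (ord2P i') => -> m hm; rewrite /= ler_nat; first exact: hdeg hm.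
by rewrite -ltnS prednK // Q_low.
Qed.

End NormalTop.

Lemma small_multinom (m : multinom 2) : (mdeg m <= 2)%N ->
  m \in [:: mon 0 0; mon 1 0; mon 0 1; mon 2 0; mon 1 1; mon 0 2].
Proof.
rewrite mdeg2E => h; rewrite [m]monE; move: (m ord0) (m o1) h.
by move=> [|[|[|x]]] [|[|[|y]]] h; rewrite ?inE ?eqxx ?orbT //; move: h; lia.
Qed.

(** * Quadratic maps with nilpotent top form *)

Section QuadraticNormalTop.
Variables (R : realType) (K : fieldType) (g : affine_map K 2).
Hypotheses (P_deg : forall m, m \in msupp (tnth g ord0) -> (mdeg m <= 2)%N)
  (P_top : mon 2 0 \notin msupp (tnth g ord0))
  (Q_low : forall m, m \in msupp (tnth g o1) -> (mdeg m < 2)%N).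

Lemma quadratic_P_cases (T : Prop) m : m \in msupp (tnth g ord0) ->
  (m = mon 0 0 -> T) -> (m = mon 1 0 -> T) -> (m = mon 0 1 -> T) ->
  (m = mon 1 1 -> T) -> (m = mon 0 2 -> T) -> T.
Proof.
move=> hm h1 h2 h3 h4 h5; have := small_multinom (P_deg hm); rewrite !inE.
case/or4P => [/eqP //|/eqP //|/eqP //|/or3P[/eqP e|/eqP//|/eqP//]].
by move: P_top; rewrite -e hm.
Qed.

Lemma linear_Q_cases (T : Prop) m : m \in msupp (tnth g o1) ->
  (m = mon 0 0 -> T) -> (m = mon 1 0 -> T) -> (m = mon 0 1 -> T) -> T.
Proof.
move=> hm h1 h2 h3; have lt := Q_low hm; have := small_multinom (ltnW lt); rewrite !inE.
by case/or4P => [/eqP //|/eqP //|/eqP //|/or3P[] /eqP e]; rewrite e mdeg_mon in lt.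
Qed.

Lemma golden_ratio : exists2 r : R, 1 < r & r * r = r + 1.
Proof.
have s5 : Num.sqrt 5 * Num.sqrt 5 = 5 :> R by rewrite -expr2 sqr_sqrtr.
exists ((1 + Num.sqrt 5) / 2); last by field: s5.
have : 1 < Num.sqrt 5 :> R by rewrite -[X in X < _]sqrtr1 ltr_sqrt // ltr1n.
lra.
Qed.

Lemma sqrt_two : exists2 r : R, 1 < r & r * r = 2.
Proof.
exists (Num.sqrt 2); last by rewrite -expr2 sqr_sqrtr.
by rewrite -[X in X < _]sqrtr1 ltr_sqrt // ltr1n.
Qed.

(** The hypothesis of [conj_deg_growth]: positive weights that the exponents multiply by at most
    [lambda]. *)
Definition weights_le (w0 w1 lambda : R) : Prop :=
  (forall m, m \in msupp (tnth g ord0) -> (m ord0)%:R * w0 + (m o1)%:R * w1 <= lambda * w0) /\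
  (forall m, m \in msupp (tnth g o1) -> (m ord0)%:R * w0 + (m o1)%:R * w1 <= lambda * w1).

(** The second coordinate is affine in [Y] alone and the first has degree at most 1 in [X], so
    iterating creates no exponential growth: a heavy weight on [X] gives every rate above 1. *)
Lemma quadratic_linear_growth (lambda : R) : mon 1 0 \notin msupp (tnth g o1) -> 1 < lambda ->
  exists w0 w1, [/\ 0 < w0, 0 < w1 & weights_le w0 w1 lambda].
Proof.
move=> hb l1; pose e := lambda - 1.
have e0 : 0 < e by rewrite subr_gt0.
have ei : 0 < e^-1 by rewrite invr_gt0.
(* The term [e^-1] makes up for [X Y], since [e * w0 >= 1], and the 2 covers [Y^2]. *)
exists (e^-1 + 2), 1.
have el : lambda * e^-1 = e^-1 + 1 by rewrite /e; field; rewrite gt_eqF.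
split=> //; first by lra.
split=> m.
  move/quadratic_P_cases; apply => ->; rewrite mon0 mon1; lra.
move=> hm; apply: (linear_Q_cases hm) => em; first by rewrite em mon0 mon1; lra.
  by rewrite -em hm in hb.
by rewrite em mon0 mon1; lra.
Qed.

(** The dominant pair [(X Y, X)] has exponent matrix with rows [(1, 1)] and [(1, 0)]. It is
    symmetric, so its eigenvector [(r, 1)] gives both the functional [G] and the weights that bound
    the degrees. *)
Lemma quadratic_golden : mon 1 0 \in msupp (tnth g o1) -> mon 1 1 \in msupp (tnth g ord0) ->
  exists lambda : R, [/\ 1 < lambda, monomial_type (lambda : R) g &
    exists w0 w1, [/\ 0 < w0, 0 < w1 & weights_le w0 w1 lambda]].
Proof.
move=> hb h11; have [r r1 rr] := golden_ratio.
exists r; split=> //.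
  exists 1%N, 1%N, 1%N, 0%N, (fun A B => 0 < B /\ B < A), r, 1, (r + 1); split=> //.
  - by rewrite hb h11.
  - move=> A B [B0 BA]; split.
    + move=> m /quadratic_P_cases h mm; apply: h => e; move: mm; rewrite e ?eqxx // mon0 mon1; lra.
    + move=> m /linear_Q_cases h mm; apply: h => e; move: mm; rewrite e ?eqxx // mon0 mon1; lra.
    + by lra.
    + have h1 : 0 < r * A by rewrite mulr_gt0; lra.
      by lra.
  - by move=> A B; transitivity ((r + 1) * A + r * B); [ring|rewrite -rr; ring].
  - move=> tau s tau0 s0; exists s.+1 => n hn.
    have h1 : 0 < s%:R * tau by rewrite mulr_gt0 ?ltr0n.
    have h2 : 0 < (n%:R - s%:R) * tau by rewrite mulr_gt0 // subr_gt0 ltr_nat.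
    by split; lra.
  - by lra.
exists r, 1; split=> //; first by lra.
split=> m.
  move/quadratic_P_cases; apply => ->; rewrite mon0 mon1; lra.
by move/linear_Q_cases; apply => ->; rewrite mon0 mon1; lra.
Qed.

(** The dominant pair [(Y^2, X)] has exponent matrix with rows [(0, 2)] and [(1, 0)]: the left
    eigenvector [(1, r)] gives [G], the right eigenvector [(r, 1)] the weights. The map
    [(A, B) -> (2 B, A)] preserves [B < A < 2 B]. *)
Lemma quadratic_sqrt2 : mon 1 0 \in msupp (tnth g o1) -> mon 1 1 \notin msupp (tnth g ord0) ->
  mon 0 2 \in msupp (tnth g ord0) ->
  exists lambda : R, [/\ 1 < lambda, monomial_type (lambda : R) g &
    exists w0 w1, [/\ 0 < w0, 0 < w1 & weights_le w0 w1 lambda]].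
Proof.
move=> hb h11 h02; have [r r1 rr] := sqrt_two.
have r2 : r < 2 by nra.
exists r; split=> //.
  exists 0%N, 2%N, 1%N, 0%N, (fun A B => B < A /\ A < 2 * B), 1, r, (1 + r); split=> //.
  - by rewrite hb h02.
  - move=> A B [BA AB]; have B0 : 0 < B by lra.
    split.
    + move=> m hm mm; apply: (quadratic_P_cases hm) => e; move: mm; rewrite ?e ?eqxx // ?mon0 ?mon1; try lra.
      by rewrite -e hm in h11.
    + move=> m /linear_Q_cases h mm; apply: h => e; move: mm; rewrite e ?eqxx // mon0 mon1; lra.
    + by lra.
    + have h1 : 0 < r * B by rewrite mulr_gt0; lra.
      have h2 : 0 < r * (A - B) by rewrite mulr_gt0; lra.
      by lra.
  - by move=> A B; transitivity (r * A + 2 * B); [ring|rewrite -rr; ring].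
  - move=> tau s tau0 s0; exists (2 * s).+1 => n hn.
    have h1 : 0 < s%:R * tau by rewrite mulr_gt0 ?ltr0n.
    have h2 : 0 < (n%:R - 2 * s%:R) * tau by rewrite mulr_gt0 // subr_gt0 -natrM ltr_nat.
    by split; lra.
  - by lra.
exists r, 1; split=> //; first by lra.
split=> m.
  move=> hm; apply: (quadratic_P_cases hm) => e; rewrite ?e ?mon0 ?mon1; try lra.
  by rewrite -e hm in h11.
by move/linear_Q_cases; apply => ->; rewrite mon0 mon1; lra.
Qed.

End QuadraticNormalTop.

(** A nonzero polynomial of least size vanishing at [z] is irreducible, and [SubFieldExtType]
    realizes the field that [z] generates. *)
Lemma simple_extension (K : fieldType) (E : fieldType) (iota : {rmorphism K -> E}) (z : E) :
  algebraicOver iota z -> exists (L : fieldExtType K) (jL : {rmorphism L -> E}),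
    (forall a : K, jL a%:A = iota a) /\ exists y, jL y = z.
Proof.
case=> p0 p0n0 p0z.
pose good n := `[< exists p : {poly K}, [/\ p != 0, root (map_poly iota p) z & size p = n] >].
have ex_good : exists n, good n by exists (size p0); apply/asboolP; exists p0.
have [n /asboolP [p [pn0 pz pn]] n_min] := ex_minnP ex_good.
have irr : irreducible_poly p.
  apply: (proj1 (subfx_irreducibleP pz pn0)) => q qz qn0.
  by rewrite pn; apply: n_min; apply/asboolP; exists q.
pose L := SubFieldExtType pz irr.
pose jL : {rmorphism L -> E} := (subfx_inj : {rmorphism subFExtend iota z p -> E}).
exists L, jL; split; first exact: subfx_inj_base.
by exists (subfx_root iota z p : L); apply: subfx_inj_root.
Qed.

(** * The action on the line at infinity *)

Section TopForm.
Variable K : fieldType.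
Implicit Types p : mpoly 2 K.

(* [slope_eval p] is [p(t, s t)] as a polynomial in [t] over [K[s]]. *)
Definition slope_eval : mpoly 2 K -> {poly {poly K}} :=
  mmap (polyC \o polyC) (fun i : 'I_2 => if i == ord0 then 'X else 'X%:P * 'X).

HB.instance Definition _ := GRing.RMorphism.on slope_eval.

(** The homogeneous part of degree [d] at [(1, s)], a polynomial in the slope [s] on the line at
    infinity. Vanishing at infinite slope shows as a drop of its size. *)
Definition top_form (d : nat) p : {poly K} := (slope_eval p)`_d.

Lemma mcoeff_sum_delta (N : nat) (p : mpoly N K) (k : multinom N) :
  \sum_(m <- msupp p) mcoeff m p * (m == k)%:R = mcoeff k p.
Proof.
rewrite {3}[p]mpolyE raddf_sum /=; apply: eq_bigr => m _.
by rewrite mcoeffZ mcoeffX.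
Qed.

Lemma top_form_coef d p i : (top_form d p)`_i =
  if (i <= d)%N then mcoeff (mon (d - i) i) p else 0.
Proof.
have -> : (top_form d p)`_i =
    \sum_(m <- msupp p) mcoeff m p * ((mdeg m == d) && (m o1 == i))%:R.
  rewrite /top_form /slope_eval /mmap !coef_sum; apply: eq_bigr => m _.
  have -> : (polyC \o polyC) (mcoeff m p) * mmap1 (fun i : 'I_2 =>
      if i == ord0 then 'X else 'X%:P * 'X) m =
      ((mcoeff m p)%:P * 'X^(m o1))%:P * 'X^(mdeg m).
    rewrite /mmap1 big_ord2 /= polyCM polyC_exp mdeg2E exprD exprMn.
    by rewrite -[RHS]mulrA; congr (_ * _); apply: mulrCA.
  rewrite coefCM coefXn [d == _]eq_sym; case: eqP => _; last by rewrite !mulr0 coef0.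
  by rewrite mulr1 coefCM coefXn eq_sym.
case: leqP => id.
  rewrite -(mcoeff_sum_delta p); apply: eq_bigr => m _; congr (_ * (_ : bool)%:R).
  apply/andP/eqP => [[/eqP e1 /eqP e2]|->]; last by rewrite mdeg_mon mon1 subnK // !eqxx.
  by rewrite [LHS]monE -e2 -e1 mdeg2E addnK.
rewrite big1 // => m _; case: (eqVneq (mdeg m) d) => [e|]; last by rewrite mulr0.
case: eqVneq => [e2|]; last by rewrite mulr0.
by move: id; rewrite -e -e2 mdeg2E ltnNge leq_addl.
Qed.

Lemma top_formD d p q : top_form d (p + q) = top_form d p + top_form d q.
Proof. by rewrite /top_form rmorphD coefD. Qed.

Lemma top_formZ d c p : top_form d (c *: p) = c *: top_form d p.
Proof.
apply/polyP => i; rewrite coefZ !top_form_coef mcoeffZ.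
by case: (i <= d)%N; rewrite ?mulr0.
Qed.

(** The shear fixes [X] and adds [alpha X] to [Y], hence translates slopes. *)
Lemma top_form_shear d p (alpha : K) :
  top_form d (comp_mpoly (lin2 1 0 alpha 1) p) = top_form d p \Po ('X + alpha%:P).
Proof.
suff h : slope_eval (comp_mpoly (lin2 1 0 alpha 1) p) =
    map_poly (comp_poly ('X + alpha%:P)) (slope_eval p).
  by rewrite /top_form h coef_map.
apply: (mpoly_rmorph_ext (G := slope_eval \o comp_mpoly (lin2 1 0 alpha 1))
  (H := map_poly (comp_poly ('X + alpha%:P)) \o slope_eval)) => [c|i] /=.
  by rewrite comp_mpolyC /slope_eval !mmapC /= map_polyC /= comp_polyC.
rewrite comp_mpolyXU -tnth_nth.
have sX (j : 'I_2) : slope_eval (mpolyX K (mnm1 j)) = if j == ord0 then 'X else 'X%:P * 'X.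
  by rewrite /slope_eval mmapX mmap1U.
have sZ c q : slope_eval (c *: q) = c%:P%:P * slope_eval q by rewrite /slope_eval mmapZ.
case: (ord2P i) => ->; rewrite ?pair_tuple0 ?pair_tuple1 rmorphD /= !sZ !sX /=.
  by rewrite map_polyX mul1r mul0r addr0.
rewrite rmorphM /= map_polyX map_polyC /= comp_polyX polyCD mulrDl polyC1 mul1r.
by rewrite addrC.
Qed.

End TopForm.

Lemma top_form_map (K L : fieldType) (phi : {rmorphism K -> L}) d (p : mpoly 2 K) :
  top_form d (map_mpoly phi p) = map_poly phi (top_form d p).
Proof.
apply/polyP => i; rewrite coef_map !top_form_coef mcoeff_map_mpoly.
by case: (i <= d)%N; rewrite //= raddf0.
Qed.

Lemma mcoeff_swap (K : fieldType) (p : mpoly 2 K) a b :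
  mcoeff (mon a b) (comp_mpoly (lin2 0 1 1 0) p) = mcoeff (mon b a) p.
Proof.
rewrite -(mcoeff_sum_delta p) comp_mpolyE raddf_sum /=; apply: eq_bigr => m _.
have -> : \prod_(i < 2) tnth (lin2 0 1 1 0) i ^+ m i = mpolyX K (mon (m o1) (m ord0)).
  rewrite mpolyXE_id !big_ord2 /= pair_tuple0 pair_tuple1 !scale1r !scale0r add0r addr0.
  by rewrite mon0 mon1 mulrC.
rewrite mcoeffZ mcoeffX; congr (_ * (_ : bool)%:R).
apply/eqP/eqP => [e|->]; last by rewrite mon0 mon1.
by rewrite [LHS]monE -(mon1 (m o1) (m ord0)) -[X in mon _ X](mon0 (m o1) (m ord0)) e mon0 mon1.
Qed.

Section NormalForm.
Variables (K : fieldType) (d : nat) (g : affine_map K 2).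
Hypothesis g_deg : (map_degree g <= d)%N.

Lemma conj_map_deg a b c e a' b' c' e' i m :
  m \in msupp (tnth (conj_map a b c e a' b' c' e' g) i) -> (mdeg m <= d)%N.
Proof.
move=> hm; rewrite -(ler_nat int); move: m hm.
have h1 j : deg_le (d%:R : int) (tnth (affine_comp g (lin2 a' b' c' e')) j).
  rewrite tnth_mktuple; apply: (deg_le_comp (E := fun=> 1)) => [m hm|k].
    rewrite big_ord2 /= !mulr1 -natrD -mdeg2E ler_nat.
    exact: leq_trans (msupp_map_degree hm) g_deg.
  exact: deg_le_lin2.
rewrite -/(deg_le (d%:R : int) _) tnth_mktuple.
apply: (deg_le_comp (E := fun=> d%:R)) => // m /deg_le_lin2 hm.
have {}hm : (mdeg m)%:R <= 1 :> int := hm int.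
by rewrite big_ord2 /= -mulrDl -natrD -mdeg2E ler_piMl.
Qed.

(** On slopes the map is [s -> B(s) / A(s)], and [alpha] is a fixed point. Coprimality gives
    [A(alpha) != 0], so once [alpha] is moved to 0 the first top form vanishes exactly as much as
    the common factor [D], and the second, [D (B - alpha A)], at least once more. *)
Lemma shear_normal_top (D A B : {poly K}) (alpha : K) :
  top_form d (tnth g ord0) = D * A -> top_form d (tnth g o1) = D * B ->
  D != 0 -> coprimep A B -> (B - 'X * A).[alpha] = 0 ->
  exists j, normal_top d j (conj_map 1 0 (- alpha) 1 1 0 alpha 1 g).
Proof.
move=> hP hQ D0 cop root_a; set g' := conj_map _ _ _ _ _ _ _ _ _.
pose sh := 'X + alpha%:P : {poly K}.
have top0 : top_form d (tnth g' ord0) = (D * A) \Po sh.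
  rewrite -hP -top_form_shear; congr (top_form d _).
  rewrite tnth_mktuple pair_tuple0 comp_mpolyD !comp_mpolyZ !comp_mpolyXU -!tnth_nth.
  by rewrite scale1r scale0r addr0 tnth_mktuple.
have top1 : top_form d (tnth g' o1) = (D * (B - alpha *: A)) \Po sh.
  have -> : D * (B - alpha *: A) = - alpha *: (D * A) + D * B.
    by rewrite mulrBr scaleNr addrC scalerAr.
  rewrite -hP -hQ comp_polyD comp_polyZ -!top_form_shear -top_formZ -top_formD.
  congr (top_form d _).
  rewrite tnth_mktuple pair_tuple1 comp_mpolyD !comp_mpolyZ !comp_mpolyXU -!tnth_nth.
  by rewrite scale1r !tnth_mktuple.
have sh0 : sh.[0] = alpha by rewrite /sh !hornerE.
have A0 : A.[alpha] != 0.
  apply: contraTneq cop => Aa; apply/negP => /coprimep_root h.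
  have /h : root A alpha by rewrite rootE Aa.
  by move: root_a; rewrite !hornerE Aa mulr0 subr0 => ->; rewrite eqxx.
have Dsh0 : D \Po sh != 0.
  by rewrite comp_poly2_eq0 // /sh size_XaddC.
(* [j] is the order of vanishing of the common factor at the fixed slope. *)
have [j [E + DE]] := multiplicity_XsubC (D \Po sh) 0.
rewrite Dsh0 /= => E0; rewrite subr0 in DE.
have /factor_theorem [B2 hB2] : root ((B - alpha *: A) \Po sh) 0.
  rewrite rootE horner_comp sh0; apply/eqP.
  by move: root_a; rewrite !hornerE.
rewrite subr0 in hB2.
have c0 i : (top_form d (tnth g' ord0))`_i = if (i < j)%N then 0 else (E * (A \Po sh))`_(i - j).
  by rewrite top0 comp_polyM DE mulrAC coefMXn.
have c1 i : (top_form d (tnth g' o1))`_i = if (i < j.+1)%N then 0 else (E * B2)`_(i - j.+1).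
  by rewrite top1 comp_polyM DE hB2 mulrACA -exprSr coefMXn.
have cj : (top_form d (tnth g' ord0))`_j != 0.
  rewrite c0 ltnn subnn -horner_coef0 hornerM mulf_neq0 //.
  by rewrite horner_comp sh0.
have jd : (j <= d)%N.
  by rewrite leqNgt; apply: contra cj => jd; rewrite top_form_coef leqNgt jd.
have topE i m : m \in msupp (tnth g' i) -> mdeg m = d -> (top_form d (tnth g' i))`_(m o1) != 0.
  move=> hm dm; rewrite top_form_coef -{1}dm mdeg2E leq_addl.
  by rewrite -dm mdeg2E addnK -monE -mcoeff_msupp.
exists j; split=> //.
- by move: cj; rewrite top_form_coef jd mcoeff_msupp.
- by move=> i m; apply: conj_map_deg.
- by move=> m hm dm; rewrite leqNgt; apply: contra (topE _ _ hm dm) => lt; rewrite c0 lt.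
- by move=> m hm dm; rewrite ltnNge; apply: contra (topE _ _ hm dm) => lt; rewrite c1 ltnS lt.
Qed.

(** The inequality of sizes says that the infinite slope is fixed. Exchanging the coordinates brings
    it to slope 0, and the order of vanishing of a top form there is [d] minus its degree in the
    slope. *)
Lemma swap_normal_top :
  (size (top_form d (tnth g ord0)) < size (top_form d (tnth g o1)))%N ->
  exists j, normal_top d j (conj_map 0 1 1 0 0 1 1 0 g).
Proof.
set P := top_form d (tnth g ord0); set Q := top_form d (tnth g o1) => lt.
set g' := conj_map _ _ _ _ _ _ _ _ _.
have g0 : tnth g' ord0 = comp_mpoly (lin2 0 1 1 0) (tnth g o1).
  rewrite tnth_mktuple pair_tuple0 comp_mpolyD !comp_mpolyZ !comp_mpolyXU -!tnth_nth.
  by rewrite scale1r scale0r add0r tnth_mktuple.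
have g1 : tnth g' o1 = comp_mpoly (lin2 0 1 1 0) (tnth g ord0).
  rewrite tnth_mktuple pair_tuple1 comp_mpolyD !comp_mpolyZ !comp_mpolyXU -!tnth_nth.
  by rewrite scale1r scale0r addr0 tnth_mktuple.
have Q0 : (0 < size Q)%N by apply: leq_ltn_trans lt.
pose k := (size Q).-1.
have Qk : Q`_k != 0 by rewrite -lead_coefE lead_coef_eq0 -size_poly_gt0.
have kd : (k <= d)%N.
  by rewrite leqNgt; apply: contra Qk => h; rewrite top_form_coef leqNgt h.
have coefE i m : mdeg m = d -> mcoeff m (comp_mpoly (lin2 0 1 1 0) (tnth g i))
    = (top_form d (tnth g i))`_(m ord0).
  move=> dm; rewrite [m in LHS]monE mcoeff_swap top_form_coef.
  by rewrite -{1}dm mdeg2E leq_addr -dm mdeg2E addKn.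
exists (d - k)%N; split.
- exact: leq_subr.
- by rewrite g0 mcoeff_msupp coefE ?mon0 ?subKn // mdeg_mon ?subKn // subnKC.
- by move=> i m; apply: conj_map_deg.
- move=> m; rewrite g0 mcoeff_msupp => hm dm; rewrite coefE // -/Q in hm.
  have : (m ord0 <= k)%N.
    by rewrite leqNgt; apply: contra hm => h; rewrite nth_default // -(prednK Q0).
  by rewrite leq_subLR -dm mdeg2E leq_add2r.
- move=> m; rewrite g1 mcoeff_msupp => hm dm; rewrite coefE // -/P in hm.
  have : (m ord0 < k)%N.
    rewrite ltnNge; apply: contra hm => h; rewrite nth_default //.
    by apply: leq_trans h; rewrite -ltnS prednK.
  by rewrite ltn_subLR // -dm mdeg2E ltn_add2r.
Qed.

End NormalForm.

(** Finite fixed slopes are the roots of [B - 'X * A]. There are none only if this is a nonzero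
    constant, which makes [B] larger than [A] and the infinite slope fixed. *)
Lemma fixed_point_dichotomy (K : fieldType) (E : closedFieldType) (iota : {rmorphism K -> E})
    (P Q : {poly K}) : (P != 0) || (Q != 0) ->
  (size P < size Q)%N \/ exists D A B : {poly K}, exists alpha : E,
    [/\ P = D * A, Q = D * B, D != 0, coprimep A B
      & (map_poly iota (B - 'X * A)).[alpha] = 0].
Proof.
move=> PQ0; pose D := gcdp P Q.
have D0 : D != 0 by rewrite gcdp_eq0 negb_and.
have [/dvdpP[A hA] /dvdpP[B hB]] := (dvdp_gcdl P Q, dvdp_gcdr P Q).
rewrite -/D in hA hB; have cop : coprimep A B.
  have := coprimep_div_gcd PQ0; rewrite -/D.
  by rewrite {1}hA {1}hB !mulpK.
(* The zero polynomial, when all slopes are fixed, has size 0 and falls on the side with a root. *)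
have [hT|/closed_rootP [alpha /rootP root_a]] := eqVneq (size (map_poly iota (B - 'X * A))) 1%N; last first.
  by right; exists D, A, B, alpha; rewrite hA hB ![D * _]mulrC.
left; have D1 : (0 < size D)%N by rewrite size_poly_gt0.
move: hT; rewrite size_map_poly => /eqP /size_poly1P [c c0 hc].
have {hc} hB' : B = 'X * A + c%:P by rewrite -hc addrC subrK.
have [A0|A0] := eqVneq A 0.
  rewrite hA A0 mul0r size_poly0 hB hB' A0 mulr0 add0r size_poly_gt0.
  by rewrite mulf_neq0 // polyC_eq0.
have sA : (0 < size A)%N by rewrite size_poly_gt0.
have sB : size B = (size A).+1.
  have sXA : size ('X * A) = (size A).+1 by rewrite mulrC size_mulX.
  by rewrite hB' size_polyDl sXA // size_polyC c0 ltnS.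
have B0 : B != 0 by rewrite -size_poly_gt0 sB.
rewrite hA hB !size_mul // sB.
by rewrite addSn /= -ltnS prednK // addn_gt0 sA.
Qed.

(** The coordinate change involves only the fixed slope, so the extension generated by that slope
    suffices. *)
Lemma normal_form_exists (K : fieldType) (E : closedFieldType) (iota : {rmorphism K -> E})
    (g : affine_map K 2) : (forall z : E, algebraicOver iota z) -> (0 < map_degree g)%N ->
  exists (L : fieldExtType K) (jL : {rmorphism L -> E}), (forall a : K, jL a%:A = iota a) /\
    exists a b c e a' b' c' e' : L,
    [/\ [/\ a * a' + b * c' = 1, a * b' + b * e' = 0, c * a' + e * c' = 0 & c * b' + e * e' = 1],
        [/\ a' * a + b' * c = 1, a' * b + b' * e = 0, c' * a + e' * c = 0 & c' * b + e' * e = 1]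
      & exists j, normal_top (map_degree g) j
          (conj_map a b c e a' b' c' e' (map_affine (in_alg L) g))].
Proof.
move=> alg; set d := map_degree g => d0.
pose P := top_form d (tnth g ord0); pose Q := top_form d (tnth g o1).
(* Otherwise no monomial of degree [d] would occur in either coordinate. *)
have PQ0 : (P != 0) || (Q != 0).
  apply: contraLR d0; rewrite negb_or !negbK -/d => /andP[/eqP P0 /eqP Q0].
  rewrite -leqNgt leqNgt; apply/negP => d0.
  suff : (d <= d.-1)%N by rewrite -ltnS prednK // ltnn.
  rewrite -(ler_nat int); apply: map_degree_le => // i m hm; rewrite ler_nat -ltnS prednK //.
  rewrite ltn_neqAle (msupp_map_degree hm) andbT; apply/eqP => dm.
  have : top_form d (tnth g i) = 0 by case: (ord2P i) => ->.
  move=> /(congr1 (fun q : {poly K} => q`_(m o1))).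
  rewrite top_form_coef coef0 -{1}dm mdeg2E leq_addl -dm mdeg2E addnK -monE => /eqP.
  by rewrite mcoeff_eq0 hm.
have gd (L : fieldExtType K) : (map_degree (map_affine (in_alg L) g) <= d)%N.
  by rewrite map_degree_map_affine.
have topL (L : fieldExtType K) i : top_form d (tnth (map_affine (in_alg L) g) i) =
    map_poly (in_alg L) (top_form d (tnth g i)).
  by rewrite tnth_mktuple top_form_map.
have [lt|[D [A [B [alpha [hP hQ D0 cop root_a]]]]]] := fixed_point_dichotomy iota PQ0.
  (* The infinite slope is rational over [K]; generating by 0 supplies an extension of the required
     type. *)
  have [L [jL [hL _]]] := simple_extension (alg 0).
  exists L, jL; split=> //; exists 0, 1, 1, 0, 0, 1, 1, 0; split.
  - by split; ring.
  - by split; ring.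
  - by apply: swap_normal_top => //; rewrite !topL !size_map_poly.
have [L [jL [hL [beta hbeta]]]] := simple_extension (alg alpha).
exists L, jL; split=> //; exists 1, 0, (- beta), 1, 1, 0, beta, 1; split.
- by split; ring.
- by split; ring.
- apply: (@shear_normal_top _ _ _ (gd L) (map_poly (in_alg L) D) (map_poly (in_alg L) A)
    (map_poly (in_alg L) B)).
  + by rewrite topL -/P hP rmorphM.
  + by rewrite topL -/Q hQ rmorphM.
  + by rewrite map_poly_eq0.
  + by rewrite coprimep_map.
  + apply: (fmorph_inj jL); rewrite rmorph0 -horner_map /= hbeta -root_a.
    rewrite !rmorphB !rmorphM /= !map_polyX -!map_poly_comp.
    by congr (_ - _ * _).[_]; apply: eq_map_poly => x /=; rewrite hL.
Qed.

Lemma growth_le_of_bound (R : realType) (lambda C : R) (s : nat -> R) : 0 <= lambda ->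
  (forall n, s n <= C * lambda ^+ n) -> growth_le lambda s.
Proof.
move=> l0 h mu lmu; exists `|C| => n; apply: le_trans (h n) _.
apply: (@le_trans _ _ (`|C| * lambda ^+ n)).
  by apply: ler_wpM2r; [exact: exprn_ge0|exact: ler_norm].
by apply: ler_wpM2l => //; apply: lerXn2r; rewrite ?nnegrE // ltW // (le_lt_trans l0).
Qed.

(** Submultiplicativity of degrees, after writing [n] as a multiple of [m] plus a remainder; [C]
    accounts for all remainders. *)
Lemma iterate_degree_bound (K : fieldType) (f : affine_map K 2) (m : nat) : (0 < m)%N ->
  exists C, forall n,
    (map_degree (affine_iter f n) <= C * map_degree (affine_iter f m) ^ (n %/ m))%N.
Proof.
move=> m0; exists (\sum_(r < m) map_degree (affine_iter f r))%N => n.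
have hq q : (map_degree (affine_iter f (m * q)) <= map_degree (affine_iter f m) ^ q)%N.
  elim: q => [|q IH].
    rewrite muln0 expn0 -(ler_nat int); apply: map_degree_le => // i k.
    by rewrite tnth_mktuple msuppX inE => /eqP ->; rewrite mdeg1.
  rewrite mulnS affine_iterD expnS; apply: leq_trans (map_degree_comp _ _) _.
  by rewrite leq_mul2l IH orbT.
rewrite {1}(divn_eq n m) addnC affine_iterD [(n %/ m * m)%N]mulnC.
apply: leq_trans (map_degree_comp _ _) _; apply: leq_mul; last exact: hq.
by rewrite (bigD1 (Ordinal (ltn_pmod n m0))) //= leq_addr.
Qed.

Lemma map_degree_lin2 (K : fieldType) (a b c d : K) : (map_degree (lin2 a b c d) <= 1)%N.
Proof.
by rewrite -(ler_nat int); apply: map_degree_le => // i; apply: deg_le_lin2.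
Qed.

(** * Assembling the cases *)

Section MainCases.
Variables (R : realType) (K : fieldType) (Kbar : closedFieldType)
  (iota : {rmorphism K -> Kbar}) (h : proj_space Kbar 2 -> R).
Hypotheses (h_ample : ample_height h) (h_ge1 : forall P, 1 <= h P).
Variables (F : fieldExtType rat) (phi : {rmorphism K -> F}) (psi : {rmorphism F -> Kbar}).
Hypothesis tower : forall x, psi (phi x) = iota x.
Variables (f : affine_map K 2) (m : nat).
Hypothesis m_gt0 : (0 < m)%N.
Variables (a b c e a' b' c' e' : F).
Hypotheses (MM' : [/\ a * a' + b * c' = 1, a * b' + b * e' = 0,
                      c * a' + e * c' = 0 & c * b' + e * e' = 1])
           (M'M : [/\ a' * a + b' * c = 1, a' * b + b' * e = 0,
                      c' * a + e' * c = 0 & c' * b + e' * e = 1]).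
Let g := map_affine phi (affine_iter f m).
Let g' := conj_map a b c e a' b' c' e' g.
Let d := map_degree (affine_iter f m).
Hypothesis d_gt1 : (1 < d)%N.
Variable j : nat.
Hypothesis g'_top : normal_top d j g'.

(** The rate is the [m]-th root of [d]: [iterate_degree_bound] shows that degrees grow no faster,
    and the region for [f^m] expands by exactly [d]. *)
Lemma densely_many_stable :
  (exists i k, [/\ k \in msupp (tnth g' i), i = o1 & mdeg k = d]) \/
  (forall k, k \in msupp (tnth g' o1) -> (mdeg k < d)%N) /\ j = 0%N ->
  densely_many_max_arith_degree iota h f psi.
Proof.
move=> hcase; pose lambda : R := d%:R `^ (m%:R^-1).
have lm : lambda ^+ m = d%:R.
  by rewrite -powR_mulrn ?powR_ge0 // -powRrM mulVf ?powRr1 // pnatr_eq0 -lt0n.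
have l1 : 1 < lambda.
  rewrite ltNge; apply/negP => l1.
  have : lambda ^+ m <= 1 by apply: exprn_ile1 => //; apply: powR_ge0.
  by rewrite lm leNgt ltr1n d_gt1.
apply: (densely_many_of_good_region h_ample h_ge1 tower m_gt0 l1 _ MM' M'M).
  have [C hC] := iterate_degree_bound f m_gt0.
  apply: (growth_le_of_bound (C := C%:R)) => [|n]; first exact: powR_ge0.
  apply: (@le_trans _ _ (C * d ^ (n %/ m))%:R); first by rewrite ler_nat hC.
  rewrite natrM natrX -lm -exprM; apply: ler_wpM2l => //.
  by rewrite ler_weXn2l ?(ltW l1) // mulnC leq_trunc_div.
move=> u tau uu g_unit tau0; rewrite lm; move: g_unit; rewrite -map_affine_iter -/g -/g' => g_unit.
case: hcase => [[i [k [hk ie dk]]]|[low j0]].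
  rewrite ie in hk.
  by apply: monomial_region => //; apply: normal_top_monomial d_gt1 g'_top k hk dk.
apply: superattracting_region => //; first exact: ltnW.
exact: normal_top_superattracting g'_top low j0.
Qed.

(** If [j] were positive, the second iterate of [g'] would have degree below [d^2]; linear
    conjugation does not raise degrees, so [f^m] would not be stable. *)
Lemma stable_j0 : algebraically_stable (affine_iter f m) ->
  (forall k, k \in msupp (tnth g' o1) -> (mdeg k < d)%N) -> j = 0%N.
Proof.
move=> stab low; apply/eqP; rewrite -leqn0 leqNgt; apply/negP => j0.
have lt := normal_top_unstable d_gt1 g'_top low j0.
have := stab 2%N isT; rewrite -/d => dd; move: lt; rewrite -dd ltnNge => /negP; apply.
rewrite -(map_degree_map_affine phi) map_affine_iter -/g.
have -> : affine_iter g 2 = affine_comp (lin2 a' b' c' e') (affine_comp (affine_comp g' g') (lin2 a b c e)).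
  by rewrite (conj_map_square M'M) (affine_iterD g 1 1) !affine_iter1.
apply: leq_trans (map_degree_comp _ _) _.
rewrite -[X in (_ <= X)%N]mul1n; apply: leq_mul; first exact: map_degree_lin2.
apply: leq_trans (map_degree_comp _ _) _.
rewrite -[X in (_ <= X)%N]muln1; apply: leq_mul => //; exact: map_degree_lin2.
Qed.

End MainCases.

(** The case is decided by two monomials: [X] in the second coordinate, without which the dynamical
    degree is at most 1, and then [X Y] in the first. *)
Lemma densely_many_quadratic (R : realType) (K : fieldType) (Kbar : closedFieldType)
    (iota : {rmorphism K -> Kbar}) (h : proj_space Kbar 2 -> R)
    (h_ample : ample_height h) (h_ge1 : forall P, 1 <= h P)
    (F : fieldExtType rat) (phi : {rmorphism K -> F}) (psi : {rmorphism F -> Kbar})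
    (tower : forall x, psi (phi x) = iota x) (f : affine_map K 2)
    (a b c e a' b' c' e' : F)
    (MM' : [/\ a * a' + b * c' = 1, a * b' + b * e' = 0,
               c * a' + e * c' = 0 & c * b' + e * e' = 1])
    (M'M : [/\ a' * a + b' * c = 1, a' * b + b' * e = 0,
               c' * a + e' * c = 0 & c' * b + e' * e = 1]) (j : nat)
    (g' := conj_map a b c e a' b' c' e' (map_affine phi f)) :
  1 < dynamical_degree R f -> normal_top 2 j g' -> (0 < j)%N ->
  (forall k, k \in msupp (tnth g' o1) -> (mdeg k < 2)%N) ->
  densely_many_max_arith_degree iota h f psi.
Proof.
move=> delta1 g'_top j0 low; have [j2 hj hdeg hP hQ] := g'_top.
have P_deg k : k \in msupp (tnth g' ord0) -> (mdeg k <= 2)%N by apply: hdeg.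
have P_top : mon 2 0 \notin msupp (tnth g' ord0).
  apply/negP => h20; have := hP _ h20; rewrite mdeg_mon mon1 leqn0 => /(_ erefl) /eqP jz.
  by rewrite jz in j0.
have bound (w0 w1 lambda : R) : 0 < w0 -> 0 < w1 -> 0 < lambda -> weights_le g' w0 w1 lambda ->
    exists C : R, forall n, degree_seq R f n <= C * lambda ^+ n.
  move=> w00 w10 l0 [hw0 hw1].
  have [C hC] := conj_deg_growth M'M w00 w10 l0 hw0 hw1.
  exists C => n; apply: le_trans (hC n).
  by rewrite /degree_seq -map_affine_iter map_degree_map_affine.
have finish (lambda : R) : 1 < lambda -> monomial_type lambda g' ->
    (exists w0 w1, [/\ 0 < w0, 0 < w1 & weights_le g' w0 w1 lambda]) ->
    densely_many_max_arith_degree iota h f psi.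
  move=> l1 mt [w0 [w1 [w00 w10 hw]]].
  have l0 : 0 < lambda := lt_trans ltr01 l1.
  apply: (densely_many_of_good_region h_ample h_ge1 tower (ltn0Sn 0) l1 _ MM' M'M).
    by have [C] := bound w0 w1 lambda w00 w10 l0 hw; apply: growth_le_of_bound; apply: ltW.
  move=> u tau uu; rewrite affine_iter1 expr1 -/g' => g_unit tau0.
  exact: monomial_region.
have [hb|hb] := boolP (mon 1 0 \in msupp (tnth g' o1)); last first.
  suff : dynamical_degree R f <= 1 by rewrite leNgt delta1.
  apply: dynamical_degree_le1 => mu mu1.
  have [w0 [w1 [w00 w10 hw]]] := quadratic_linear_growth P_deg P_top low hb mu1.
  exact: bound w00 w10 (lt_trans ltr01 mu1) hw.
have [h11|h11] := boolP (mon 1 1 \in msupp (tnth g' ord0)).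
  have [lambda [l1 mt hw]] := quadratic_golden R P_deg P_top low hb h11.
  exact: finish l1 mt hw.
(* Here [j] is 1 or 2, and [X Y] is absent, so the guaranteed monomial of [normal_top] is [Y^2]. *)
have h02 : mon 0 2 \in msupp (tnth g' ord0).
  case: j j0 j2 hj {g'_top hP hQ} => [|[|[|]]] //= _ _ hj11; by rewrite hj11 in h11.
have [lambda [l1 mt hw]] := quadratic_sqrt2 R P_deg P_top low hb h11 h02.
exact: finish l1 mt hw.
Qed.

Theorem theoremA1 (R : realType)
    (K : fieldExtType rat) (Kbar : closedFieldType)
    (iota : {rmorphism K -> Kbar})
    (Kbar_algebraic : forall z : Kbar, algebraicOver iota z)
    (h : proj_space Kbar 2 -> R)
    (h_ample : ample_height h)
    (h_ge1 : forall P : proj_space Kbar 2, 1 <= h P)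
    (f : affine_map K 2)
    (f_dominant : dominant iota f)
    (delta_gt1 : 1 < dynamical_degree R f)
    (f_stable_or_quadratic :
       (exists m : nat, (0 < m)%N /\ algebraically_stable (affine_iter f m))
       \/ quadratic f) :
  exists (L : fieldExtType K) (jL : {rmorphism L -> Kbar}),
    (forall a : K, jL a%:A = iota a) /\
    densely_many_max_arith_degree iota h f jL.
Proof.
have [m [m_gt0 d_gt1 stab]] : exists m, [/\ (0 < m)%N, (1 < map_degree (affine_iter f m))%N
    & algebraically_stable (affine_iter f m) \/ m = 1%N /\ quadratic f].
  case: f_stable_or_quadratic => [[m [m0 stab]]|quad]; last first.
    by exists 1%N; rewrite affine_iter1 quad; split=> //; right.
  exists m; split=> //; last by left.
  (* If [f^m] had degree at most 1, the degrees of all iterates would be bounded, against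
     [delta_gt1]. *)
  rewrite ltnNge; apply/negP => d1.
  suff : dynamical_degree R f <= 1 by rewrite leNgt delta_gt1.
  have [C hC] := iterate_degree_bound f m0.
  apply/dynamical_degree_le1/(growth_le_of_bound (C := C%:R)) => // n.
  rewrite expr1n mulr1 ler_nat; apply: leq_trans (hC n) _.
  rewrite -[leqRHS]muln1 leq_mul2l; apply/orP; right.
  move: d1; case: (map_degree _) => [|[|//]] _; last by rewrite exp1n.
  by case: (n %/ m)%N => // k; rewrite exp0n.
have [L [jL [hL [a [b [c [e [a' [b' [c' [e' [MM' M'M [j g'_top]]]]]]]]]]]]] :=
  normal_form_exists Kbar_algebraic (ltnW d_gt1).
exists L, jL; split=> //.
(* Heights need an extension of the rationals, while [L] was built over [K]; [baseFieldType] is the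
   same field seen over the rationals. *)
pose F : fieldExtType rat := baseFieldType L.
pose phi : {rmorphism K -> F} := in_alg L.
pose psi : {rmorphism F -> Kbar} := jL.
pose g' : affine_map F 2 := conj_map a b c e a' b' c' e' (map_affine phi (affine_iter f m)).
have stable := densely_many_stable h_ample h_ge1 (hL : forall x, psi (phi x) = iota x)
  m_gt0 MM' M'M d_gt1 g'_top.
(* A nonzero top form in the second coordinate gives a monomial region for any [j]. If it is zero,
   [j = 0] is superattracting, and [j > 0] is excluded by stability or left to the quadratic
   analysis with [m = 1]. *)
have [[k [hk dk]]|low] := pselect (exists k, k \in msupp (tnth g' o1) /\
    mdeg k = map_degree (affine_iter f m)).
  by apply: stable; left; exists o1, k.
have {}low k : k \in msupp (tnth g' o1) -> (mdeg k < map_degree (affine_iter f m))%N.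
  move=> hk; have [_ _ hdeg _ _] := g'_top.
  rewrite ltn_neqAle (hdeg o1 k hk) andbT; apply/eqP => dk.
  by apply: low; exists k.
have [j0|j0] := posnP j; first by apply: stable; right.
case: stab => [stab|[m1 quad]].
  by move: j0; rewrite (stable_j0 (F := F) (phi := phi) M'M d_gt1 g'_top stab low).
move: g'_top low; rewrite {}/g' m1 affine_iter1 quad => g'_top low.
exact: (densely_many_quadratic (F := F) (phi := phi) h_ample h_ge1
  (hL : forall x, psi (phi x) = iota x) MM' M'M delta_gt1 g'_top j0 low).
Qed.
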